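(* Let $F$ be a probability distribution on $[0,1]$ with $\delta=\mathbb{E}[X_1^2]>0$ for $X_1\sim F$, and for each $n$ let $(X,A)\sim\mathrm{RDPG}(F)$ be a one-dimensional random dot product graph on $n$ vertices, with estimate $\hat X=\hat\lambda^{1/2}\hat V$ of $X$. Then for each fixed index $i$ and any $z\in\mathbb{R}$, as $n\to\infty$, $$\mathbb{P}\bigl\{\sqrt{n}\,(\hat X_i-X_i)\le z\bigr\}\longrightarrow \int \Phi\bigl(z,\delta^{-2}\sigma^2(x)\bigr)\,dF(x),$$ where $\sigma^2(x)=x\,\mathbb{E}[X_1^3]-x^2\,\mathbb{E}[X_1^4]$. That is, $\sqrt n(\hat X_i-X_i)$ converges in distribution to a mixture of centered normals.
   Context: One-dimensional random dot product graph: for a distribution $F$ on $[0,1]$, $(X,A)\sim\mathrm{RDPG}(F)$ means that $X_1,\dots,X_n$ are i.i.d. with law $F$, $X=[X_1,\dots,X_n]^\top\in\mathbb{R}^{n\times 1}$, and $A\in\{0,1\}^{n\times n}$ is a symmetric matrix with zero diagonal such that, conditionally on $X$, the entries $A_{ij}$, $i<j$, are independent with $A_{ij}\sim\mathrm{Bernoulli}(X_iX_j)$. Estimate: $\hat\lambda=\lambda_1(A)$ is the largest eigenvalue of $A$, $\hat V$ is an associated unit eigenvector, with sign chosen so that $\hat V^\top X\ge 0$, and $\hat X=\hat\lambda^{1/2}\hat V$. $\Phi(z,\sigma^2)$ is the cumulative distribution function at $z$ of the normal law with mean $0$ and variance $\sigma^2$ (for $\sigma^2=0$, the point mass at $0$).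 *)

(* Defs.v *)
From HB Require Import structures.
From mathcomp Require Import all_boot all_order all_algebra.
From mathcomp Require Import all_classical all_reals all_analysis.

Set Implicit Arguments.
Unset Strict Implicit.
Unset Printing Implicit Defensive.

Import Order.TTheory GRing.Theory Num.Theory.
Import numFieldNormedType.Exports.

Local Open Scope classical_set_scope.
Local Open Scope ring_scope.

(* Mutual independence of a finite family of random variables; the product
   rule for subfamilies is the case where some of the [B k] are [setT]. *)
Definition mutually_independent (R : realType) (d : measure_display)
    (T : measurableType d) (P : probability T R) (I : finType)
    (d' : measure_display) (T' : measurableType d')
    (Y : I -> {RV P >-> T'}) : Prop :=
  forall B : I -> set T', (forall k, measurable (B k)) ->
    P (\bigcap_k (Y k @^-1` B k)) = (\prod_k P (Y k @^-1` B k))%E.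

(* [Y] is a version of the conditional probability P(E | G), where [G] is a
   sub-sigma-algebra of the measurable sets of [T]. *)
Definition is_cond_prob (R : realType) (d : measure_display)
    (T : measurableType d) (P : probability T R) (G : set (set T))
    (E : set T) (Y : T -> R) : Prop :=
  [/\ forall B : set R, measurable B -> G (Y @^-1` B),
      P.-integrable setT (EFin \o Y)
    & forall D : set T, G D -> (\int[P]_(w in D) (Y w)%:E)%E = P (E `&` D)].

(* Conditional independence given [G] of the finite family of the [Y k], [k]
   satisfying [Q]. *)
Definition cond_independent (R : realType) (d : measure_display)
    (T : measurableType d) (P : probability T R) (G : set (set T))
    (I : finType) (Q : pred I) (d' : measure_display) (T' : measurableType d')
    (Y : I -> {RV P >-> T'}) : Prop :=
  forall (B : I -> set T') (p : I -> T -> R),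
    (forall k, Q k -> measurable (B k)) ->
    (forall k, Q k -> is_cond_prob P G (Y k @^-1` B k) (p k)) ->
    is_cond_prob P G (\bigcap_(k in [set k | Q k]) (Y k @^-1` B k))
      (fun w => \prod_(k | Q k) p k w).

(* (X, A) ~ RDPG(F) on n vertices. The adjacency matrix is given by its
   entries, with [true] for 1 and [false] for 0. *)
Record RDPG (R : realType) (F : probability R R) (n : nat)
    (d : measure_display) (T : measurableType d) (P : probability T R)
    (X : 'I_n -> {RV P >-> R}) (A : 'I_n -> 'I_n -> {RV P >-> bool}) : Prop := {
  RDPG_indep : mutually_independent X ;
  RDPG_law : forall (k : 'I_n) (B : set R), measurable B ->
    distribution P (X k) B = F B ;
  RDPG_sym : forall (k l : 'I_n) (w : T), A k l w = A l k w ;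
  RDPG_diag : forall (k : 'I_n) (w : T), A k k w = false ;
  RDPG_cond_indep : cond_independent (g_sigma_preimage X)
    (fun e : 'I_n * 'I_n => (e.1 < e.2)%N) (fun e => A e.1 e.2) ;
  RDPG_cond_law : forall (k l : 'I_n) (B : set bool), (k < l)%N ->
    is_cond_prob P (g_sigma_preimage X) (A k l @^-1` B)
      (fun w => fine (bernoulli_prob (X k w * X l w) B)) }.

Definition largest_eigenvalue (R : realType) (n : nat) (M : 'M[R]_n)
    (l : R) : Prop :=
  eigenvalue M l /\ forall a : R, eigenvalue M a -> a <= l.

(* [xhat] is the estimate of the column [x] computed from the matrix [M], for
   some choice of the unit eigenvector. The norm of [V] is Euclidean, hence not
   the library's [`|V|], which is the maximum norm. *)
Definition is_estimate (R : realType) (n : nat) (x : 'cV[R]_n) (M : 'M[R]_n)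
    (xhat : 'cV[R]_n) : Prop :=
  exists (l : R) (V : 'cV[R]_n),
    [/\ largest_eigenvalue M l,
        M *m V = l *: V,
        (V^T *m V) 0 0 = 1,
        0 <= (V^T *m x) 0 0
      & xhat = Num.sqrt l *: V].

Definition moment (R : realType) (F : probability R R) (k : nat) : R :=
  fine 'E_F[fun x : R => x ^+ k].

Definition sigma2 (R : realType) (F : probability R R) (x : R) : R :=
  x * moment F 3 - x ^+ 2 * moment F 4.

(* Distribution function of N(0, v). The second parameter of [normal_prob] is
   the standard deviation, and [normal_prob 0 0] is not a point mass. *)
Definition Phi (R : realType) (z v : R) : \bar R :=
  if v == 0 then \d_(0 : R) `]-oo, z]
  else normal_prob 0 (Num.sqrt v) `]-oo, z].

(* Main.v *)
(* Let [N] be the number of vertices, [x] the latent vector, [l] the largest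
   eigenvalue of the adjacency matrix [A] and [H = A - x x^T].

   Second moments and Chebyshev's inequality bound [H x], [x^T H x], the row [i]
   of [H^2 x] and the Frobenius norm of [H^2] with probability close to 1; the
   last one yields [|H| = o(N)], which is all that is needed of the spectrum.
   Iterating the eigenvector equation once, [sqrt N (xhat_i - x_i)] is then
   [(H x)_i / (delta sqrt N) + o(1)]. Given [x], [(H x)_i] is a sum of
   independent centered terms: Lindeberg's replacement compares the expectation
   of a smooth function of it with a Gaussian one, and the law of large numbers
   replaces the conditional variance by [sigma2 x_i]. The indicator of
   ]-oo, z] is squeezed between two logistic functions of increasing slope.

   The squeeze is lossy where the limit variance vanishes and [z = 0]. But the
   variance vanishes only if [x_i = 0], where the vertex [i] is almost surely
   isolated and [xhat_i = 0], or if [x_i = 1] and [F] is a Bernoulli law, where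
   the graph is almost surely a clique and [xhat_i <= 1]. In both cases the
   error is nonpositive, so that the event has conditional probability 1 as soon
   as [z >= 0]. *)
Require Import Defs.
From HB Require Import structures.
From mathcomp Require Import all_boot all_order all_algebra.
From mathcomp Require Import all_classical all_reals all_analysis.
From mathcomp Require Import measurable_realfun ring lra.

Set Implicit Arguments.
Unset Strict Implicit.
Unset Printing Implicit Defensive.

Import Order.TTheory GRing.Theory Num.Theory.
Import numFieldNormedType.Exports.

Local Open Scope classical_set_scope.
Local Open Scope ring_scope.

(** * Expectations of bounded functions *)

(** Three limits are taken in a fixed order. At tail level [K] the good event fails with probability
    at most [6 / K^2] whatever the size; the number of vertices then grows with [K] and the slope of
    the logistic function fixed; the slope goes to infinity last. All estimates are therefore
    explicit in [N], [K] and the slope. The Frobenius norm of [H] itself can be of order [N], too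
    large for a perturbation of an eigenvalue of order [N]. Off its diagonal, an entry of [H^2] is a
    sum of uncorrelated terms and only of order [sqrt N], so the squared Frobenius norm of [H^2] is
    of order [N^3] and [|H|] is [O(N^(3/4))]. Conditioning is made concrete: given [x] the graph
    takes finitely many values, so a conditional expectation is a finite sum over configurations
    with product weights. Positions are clamped to [[0, 1]], which changes them on a null set only
    and makes the bounds on the noise hold everywhere. Given [x], the diagonal [- x_k^2] of [H] is
    not random. It is split off, so that every entry of the noise is centered, and put back as a
    perturbation of norm at most 1. *)

Definition bounded_measurable (d : measure_display) (T : measurableType d)
    (R : realType) (f : T -> R) :=
  measurable_fun setT f /\ exists M, forall x, `|f x| <= M.

Section BoundedMeasurable.
Context (d : measure_display) (T : measurableType d) (R : realType).
Implicit Types f g : T -> R.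

Lemma bounded_measurable_cst (c : R) : bounded_measurable (fun _ : T => c).
Proof. by split; [exact: measurable_cst|exists `|c|]. Qed.

Lemma bounded_measurableD f g : bounded_measurable f ->
  bounded_measurable g -> bounded_measurable (fun x => f x + g x).
Proof.
move=> [mf [M fM]] [mg [K gK]]; split; first exact: measurable_funD.
by exists (M + K) => x; rewrite (le_trans (ler_normD _ _))// lerD.
Qed.

Lemma bounded_measurableM f g : bounded_measurable f ->
  bounded_measurable g -> bounded_measurable (fun x => f x * g x).
Proof.
move=> [mf [M fM]] [mg [K gK]]; split; first exact: measurable_funM.
by exists (M * K) => x; rewrite normrM ler_pM.
Qed.

Lemma bounded_measurableN f : bounded_measurable f ->
  bounded_measurable (fun x => - f x).
Proof.
move=> [mf [M fM]]; split; first exact: measurableT_comp.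
by exists M => x; rewrite normrN.
Qed.

Lemma bounded_measurableB f g : bounded_measurable f ->
  bounded_measurable g -> bounded_measurable (fun x => f x - g x).
Proof.
by move=> bf bg; apply: bounded_measurableD => //; exact: bounded_measurableN.
Qed.

Lemma bounded_measurable_norm f : bounded_measurable f ->
  bounded_measurable (fun x => `|f x|).
Proof.
move=> [mf [M fM]]; split; first exact: measurableT_comp.
by exists M => x; rewrite normr_id.
Qed.

Lemma bounded_measurableX f n : bounded_measurable f ->
  bounded_measurable (fun x => f x ^+ n).
Proof.
move=> bf; elim: n => [|n IH].
  by under eq_fun do rewrite expr0; exact: bounded_measurable_cst.
by under eq_fun do rewrite exprS; exact: bounded_measurableM.
Qed.

Lemma bounded_measurable_sum (I : Type) (r : seq I) (P : pred I)
    (f : I -> T -> R) : (forall i, P i -> bounded_measurable (f i)) ->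
  bounded_measurable (fun x => \sum_(i <- r | P i) f i x).
Proof.
move=> bf; elim: r => [|i r IH].
  by under eq_fun do rewrite big_nil; exact: bounded_measurable_cst.
under eq_fun do rewrite big_cons; have [Pi|//] := boolP (P i).
exact: bounded_measurableD (bf _ Pi) IH.
Qed.

Lemma bounded_measurable_prod (I : Type) (r : seq I) (P : pred I)
    (f : I -> T -> R) : (forall i, P i -> bounded_measurable (f i)) ->
  bounded_measurable (fun x => \prod_(i <- r | P i) f i x).
Proof.
move=> bf; elim: r => [|i r IH].
  by under eq_fun do rewrite big_nil; exact: bounded_measurable_cst.
under eq_fun do rewrite big_cons; have [Pi|//] := boolP (P i).
exact: bounded_measurableM (bf _ Pi) IH.
Qed.

Lemma bounded_measurable_indic (A : set T) : measurable A ->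
  bounded_measurable (\1_A : T -> R).
Proof.
move=> mA; split; first exact: measurable_indic.
by exists 1 => x; rewrite indicE; case: (_ \in _); rewrite ?normr1 ?normr0.
Qed.

Lemma bounded_measurable_comp (d' : measure_display) (T' : measurableType d')
    (g : T' -> T) f : measurable_fun setT g -> bounded_measurable f ->
  bounded_measurable (fun x => f (g x)).
Proof.
by move=> mg [mf [M fM]]; split; [exact: measurableT_comp|exists M].
Qed.

Variable P : probability T R.

Lemma bounded_measurable_integrable f : bounded_measurable f ->
  P.-integrable setT (EFin \o f).
Proof.
move=> [mf [M fM]]; apply: measurable_bounded_integrable => //.
  by rewrite (le_lt_trans (probability_le1 _ _)) ?ltry.
by exists M; split; [exact: num_real|] => x Mx y _; exact: le_trans (fM y) (ltW Mx).
Qed.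

Lemma EFin_expect f : bounded_measurable f ->
  ((\int[P]_x f x)%:E = \int[P]_x (f x)%:E)%E.
Proof.
move=> bf; rewrite /Rintegral fineK//.
exact: integrable_fin_num (bounded_measurable_integrable bf).
Qed.

Lemma expectD f g : bounded_measurable f -> bounded_measurable g ->
  \int[P]_x (f x + g x) = \int[P]_x f x + \int[P]_x g x.
Proof. by move=> bf bg; rewrite RintegralD//; exact: bounded_measurable_integrable. Qed.

Lemma expectB f g : bounded_measurable f -> bounded_measurable g ->
  \int[P]_x (f x - g x) = \int[P]_x f x - \int[P]_x g x.
Proof. by move=> bf bg; rewrite RintegralB//; exact: bounded_measurable_integrable. Qed.

Lemma expectZ c f : bounded_measurable f ->
  \int[P]_x (c * f x) = c * \int[P]_x f x.
Proof. by move=> bf; rewrite RintegralZl//; exact: bounded_measurable_integrable. Qed.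

Lemma expect_cst c : \int[P]_x c = c.
Proof. by rewrite Rintegral_cst//= probability_setT mulr1. Qed.

Lemma le_expect f g : bounded_measurable f -> bounded_measurable g ->
  (forall x, f x <= g x) -> \int[P]_x f x <= \int[P]_x g x.
Proof. by move=> bf bg fg; apply: le_Rintegral => //; exact: bounded_measurable_integrable. Qed.

Lemma expect_sum (I : Type) (r : seq I) (Q : pred I) (f : I -> T -> R) :
  (forall i, Q i -> bounded_measurable (f i)) ->
  \int[P]_x (\sum_(i <- r | Q i) f i x) = \sum_(i <- r | Q i) \int[P]_x f i x.
Proof.
move=> bf; elim: r => [|i r IH].
  by under eq_Rintegral do rewrite big_nil; rewrite expect_cst big_nil.
under eq_Rintegral do rewrite big_cons; rewrite big_cons.
case: ifP => // Qi; rewrite -IH -expectD//; first exact: bf.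
exact: bounded_measurable_sum.
Qed.

Lemma norm_expect f : bounded_measurable f ->
  `|\int[P]_x f x| <= \int[P]_x `|f x|.
Proof. by move=> bf; apply: le_normr_Rintegral => //; exact: bounded_measurable_integrable. Qed.

Lemma norm_expect_le f c : bounded_measurable f -> (forall x, `|f x| <= c) ->
  `|\int[P]_x f x| <= c.
Proof.
move=> bf fc; rewrite (le_trans (norm_expect bf))// -[leRHS]expect_cst.
by apply: le_expect => //; [exact: bounded_measurable_norm|
  exact: bounded_measurable_cst].
Qed.

Lemma expect_indic (A : set T) : measurable A ->
  \int[P]_x (\1_A x : R) = fine (P A).
Proof. by move=> mA; rewrite /Rintegral integral_indic// setIT. Qed.

Lemma expect_prob (A : set T) : measurable A ->
  ((\int[P]_x (\1_A x : R))%:E = P A)%E.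
Proof. by move=> mA; rewrite expect_indic// fineK// fin_num_measure. Qed.

Lemma eq_expect_ae f g (A : set T) : bounded_measurable f ->
  bounded_measurable g -> measurable A -> P A = 1%E ->
  (forall x, A x -> f x = g x) -> \int[P]_x f x = \int[P]_x g x.
Proof.
move=> bf bg mA PA fg; congr fine; apply: ae_eq_integral => //.
- by apply/measurable_EFinP; case: bf.
- by apply/measurable_EFinP; case: bg.
exists (~` A); split; first exact: measurableC.
- by rewrite /= probability_setC// PA subee.
by move=> x /= nfg Ax; apply: nfg => _; rewrite fg.
Qed.

Lemma markov_expect f (c e : R) : bounded_measurable f -> (forall x, 0 <= f x) ->
  0 < c -> \int[P]_x f x <= e * c -> (P [set x | (c < f x)%R] <= e%:E)%E.
Proof.
move=> bf f0 c0 fe; have [mf _] := bf.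
have mA : measurable [set x | c < f x].
  rewrite (_ : mkset _ = setT `&` f @^-1` `]c, +oo[%classic); first exact: mf.
  by rewrite setTI; apply/seteqP; split => x /=; rewrite in_itv/= andbT.
rewrite -expect_prob// lee_fin -(ler_pM2r c0) (le_trans _ fe)// mulrC -expectZ; last first.
  exact: bounded_measurable_indic.
apply: le_expect => //.
  by apply: bounded_measurableM; [exact: bounded_measurable_cst|
    exact: bounded_measurable_indic].
move=> x; rewrite indicE; have [|_] := boolP (x \in _); last by rewrite mulr0.
by move=> /set_mem /= /ltW; rewrite mulr1.
Qed.

(** Produces the set of full probability itself, measurable, so that finitely many almost sure
    identities can be intersected and then used pointwise. *)
Lemma expect_eq0 f : bounded_measurable f -> (forall x, 0 <= f x) ->
  \int[P]_x f x = 0 ->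
  exists2 Om, measurable Om & P Om = 1%E /\ forall x, Om x -> f x = 0.
Proof.
move=> bf f0 fE; have [mf _] := bf.
exists (f @^-1` [set 0]); first by rewrite -[X in measurable X]setTI; exact: mf.
split => //; have mN : measurable (f @^-1` [set 0]).
  by rewrite -[X in measurable X]setTI; exact: mf.
have [N [mN' PN sN]] : ae_eq P setT (EFin \o f) (cst 0%E).
  apply/ae_eq_integral_abs => //; first exact/measurable_EFinP.
  under eq_integral do rewrite /= ger0_norm//.
  by rewrite -EFin_expect// fE.
have PC : P (~` (f @^-1` [set 0])) = 0%E.
  apply/eqP; rewrite eq_le measure_ge0 andbT -PN.
  apply: le_measure; rewrite ?inE//; first exact: measurableC.
  by move=> x /= nf; apply: sN => /= /(_ Logic.I) [].
by rewrite -[_ @^-1` _]setCK probability_setC ?PC ?sube0//; exact: measurableC.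
Qed.

End BoundedMeasurable.

(** Both [w] and the Radon-Nikodym derivative integrate to [nu A] over every measurable [A], hence
    agree almost everywhere. The derivative is taken for [nu'], which is [nu] packaged as a finite
    measure; finiteness comes from the integrability of [w]. *)
Lemma ge0_integral_density (d : measure_display) (T : measurableType d)
    (R : realType) (mu : {sigma_finite_measure set T -> \bar R})
    (nu : {measure set T -> \bar R}) (w f : T -> \bar R) :
  mu.-integrable setT w ->
  (forall A, measurable A -> nu A = \int[mu]_(x in A) w x)%E ->
  measurable_fun setT f -> (forall x, 0 <= f x)%E ->
  (\int[nu]_x f x = \int[mu]_x (f x * w x))%E.
Proof.
move=> iw nuw mf f0.
have nufin : (nu setT < +oo)%E.
  rewrite nuw//; have := integrable_fin_num measurableT iw.
  by rewrite fin_numElt => /andP[].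
pose nu' := mfrestr measurableT nufin.
have nu'w A : measurable A -> (nu' A = \int[mu]_(x in A) w x)%E.
  by move=> mA; rewrite /nu' /mfrestr /mrestr setIT nuw.
have -> : (\int[nu]_x f x = \int[nu']_x f x)%E.
  by apply: eq_measure_integral => A mA _; apply: (etrans (nuw A mA)); exact/esym/nu'w.
have dom : nu' `<< mu.
  apply/null_content_dominatesP => A mA muA; apply: (etrans (nu'w A mA)).
  apply: null_set_integral => //; exact: measurable_funTS (measurable_int _ iw).
rewrite -(Radon_Nikodym_SigmaFinite.change_of_variables dom)//.
have iF := Radon_Nikodym_SigmaFinite.f_integrable dom.
apply: ae_eq_integral => //.
- by apply: emeasurable_funM => //; exact: measurable_int iF.
- by apply: emeasurable_funM => //; exact: measurable_int iw.
apply: ae_eqe_mul2l; apply: integral_ae_eq => //.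
  exact: measurable_int iw.
by move=> A _ mA; rewrite -Radon_Nikodym_SigmaFinite.f_integral//; exact: nu'w.
Qed.

(** * Gaussian smoothing *)

Section Gaussian.
Context (R : realType).
Local Notation mu := (@lebesgue_measure R).
Local Notation gauss := (@normal_prob R 0 1).

Lemma ge0_integral_affine (G : R -> R) (a b : R) : 0 < a -> continuous G ->
  (forall x, 0 <= G x) ->
  (\int[mu]_x (G x)%:E = \int[mu]_x (G (a * x + b) * a)%:E)%E.
Proof.
move=> a0 cG G0; pose F (x : R) : R := a * x + b.
have dF (x : R) : is_derive x 1 F a.
  rewrite /F; apply: is_derive_eq.
  by rewrite addr0 /GRing.scale/= mulr1.
have F'E : F^`()%classic = cst a.
  by apply/funext => x; rewrite derive1E; exact: (@derive_val _ _ _ _ _ _ _ (dF x)).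
have := @increasing_ge0_integration_by_substitutionT R F G.
rewrite F'E; apply => //.
- by move=> x y xy; rewrite /F ltrD2r ltr_pM2l.
- by move=> x; exact: cvg_cst.
- exact: is_cvg_cst.
- exact: is_cvg_cst.
- apply: (@cvg_comp _ _ _ (fun x => a * x) (fun y => y + b)).
    by apply: gt0_cvgMrNy => //; exact: cvg_id.
  exact: cvg_addrr_Ny.
- apply: (@cvg_comp _ _ _ (fun x => a * x) (fun y => y + b)).
    by apply: gt0_cvgMry => //; exact: cvg_id.
  exact: cvg_addrr.
Qed.

Lemma ge0_integral_normal (s : R) (f : R -> R) : measurable_fun setT f ->
  (forall x, 0 <= f x) ->
  (\int[normal_prob 0%R s]_x (f x)%:E =
   \int[mu]_x (f x * normal_pdf 0 s x)%:E)%E.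
Proof.
move=> mf f0; under [RHS]eq_integral do rewrite EFinM.
apply: (@ge0_integral_density _ _ _ mu (normal_prob 0 s)
  (fun x => (normal_pdf 0 s x)%:E)) => //.
- exact: integrable_normal_pdf.
- exact/measurable_EFinP.
Qed.

Lemma normal_pdf_std (s x : R) : 0 < s ->
  normal_pdf 0 s (s * x) * s = normal_pdf 0 1 x.
Proof.
move=> s0; rewrite !normal_pdfE ?oner_neq0 ?gt_eqF// /normal_peak /normal_fun.
rewrite !subr0 expr1n mul1r mulrAC; congr (_ * expR _).
  rewrite -mulrnAr sqrtrM ?sqr_ge0// sqrtr_sqr gtr0_norm// invfM mulrAC mulVf ?mul1r//.
  by rewrite gt_eqF.
by rewrite exprMn; field; rewrite gt_eqF.
Qed.

Lemma ge0_integral_normal_scale (s : R) (f : R -> R) : 0 < s -> continuous f ->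
  (forall x, 0 <= f x) ->
  (\int[normal_prob 0%R s]_x (f x)%:E = \int[gauss]_x (f (s * x))%:E)%E.
Proof.
move=> s0 cf f0.
have cs : continuous (fun x : R => s * x).
  by move=> x; apply: cvgM; [exact: cvg_cst|exact: cvg_id].
have cfs : continuous (fun x => f (s * x)).
  by move=> x; apply: (cvg_comp _ _ (cs x)); exact: cf.
rewrite !ge0_integral_normal//; try exact: continuous_measurable_fun.
rewrite (@ge0_integral_affine _ s 0)//.
- apply: eq_integral => x _; congr EFin.
  by rewrite addr0 -mulrA normal_pdf_std.
- move=> x; apply: cvgM; first exact: cf.
  by apply: continuous_normal_pdf; rewrite gt_eqF.
- by move=> x; rewrite mulr_ge0// normal_pdf_ge0.
Qed.

(* Completing the square in [z], after the substitution [x = s z + t w]. *)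
Lemma normal_pdf_convolution (s t x z : R) : 0 < s -> 0 < t ->
  let c2 := s ^+ 2 + t ^+ 2 in let c := Num.sqrt c2 in
  normal_pdf 0 1 z * (normal_pdf 0 1 ((x - s * z) / t) / t) =
  normal_pdf 0 c x * normal_pdf (s * x / c2) (t / c) z.
Proof.
move=> s0 t0 c2 c.
have c20 : 0 < c2 by rewrite addr_gt0 ?exprn_gt0.
have c0 : 0 < c by rewrite sqrtr_gt0.
have c2E : c ^+ 2 = c2 by rewrite sqr_sqrtr// ltW.
have tc0 : 0 < t / c by rewrite divr_gt0.
rewrite !normal_pdfE ?oner_neq0 ?(gt_eqF c0) ?(gt_eqF tc0)//.
rewrite /normal_peak /normal_fun.
pose p : R := pi *+ 2.
have pk a : 0 < a -> (Num.sqrt (a ^+ 2 * pi *+ 2))^-1 = a^-1 * (Num.sqrt p)^-1.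
  by move=> a0; rewrite -mulrnAr sqrtrM ?sqr_ge0// sqrtr_sqr gtr0_norm// invfM.
rewrite !pk// invr1 !mul1r.
have E1 : expR (- (z - 0) ^+ 2 / (1 ^+ 2 *+ 2)) *
   expR (- ((x - s * z) / t - 0) ^+ 2 / (1 ^+ 2 *+ 2)) =
   expR (- (x - 0) ^+ 2 / (c ^+ 2 *+ 2)) *
   expR (- (z - s * x / c2) ^+ 2 / ((t / c) ^+ 2 *+ 2)).
  rewrite -!expRD; congr expR; rewrite expr_div_n c2E /c2.
  by field; rewrite ?(gt_eqF t0) ?(gt_eqF c20).
transitivity ((Num.sqrt p)^-1 * (Num.sqrt p)^-1 * t^-1 *
  (expR (- (z - 0) ^+ 2 / (1 ^+ 2 *+ 2)) *
   expR (- ((x - s * z) / t - 0) ^+ 2 / (1 ^+ 2 *+ 2)))); first by ring.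
rewrite E1.
transitivity ((Num.sqrt p)^-1 * (Num.sqrt p)^-1 * (c^-1 * (t / c)^-1) *
   (expR (- (x - 0) ^+ 2 / (c ^+ 2 *+ 2)) *
   expR (- (z - s * x / c2) ^+ 2 / ((t / c) ^+ 2 *+ 2)))); last by ring.
by congr (_ * _ * _); field; rewrite ?(gt_eqF t0) ?(gt_eqF c0).
Qed.

End Gaussian.

(** * Moments of the standard normal law *)

Section GaussianMoments.
Context (R : realType).
Local Notation mu := (@lebesgue_measure R).
Local Notation gauss := (@normal_prob R 0 1).

(** Multiplying the standard density by [exp (t z)] gives [exp (t^2 / 2)] times the density of mean
    [t]. *)
Lemma gauss_integral_expR (t : R) :
  (\int[gauss]_z (expR (t * z))%:E = (expR (t ^+ 2 / 2))%:E)%E.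
Proof.
rewrite ge0_integral_normal//; last first.
  exact: measurableT_comp.
transitivity (\int[mu]_z ((expR (t ^+ 2 / 2))%:E * (normal_pdf t 1 z)%:E))%E.
  apply: eq_integral => z _; rewrite -EFinM; congr EFin.
  rewrite !normal_pdfE ?oner_neq0// /normal_fun mulrCA [RHS]mulrCA -!expRD.
  by congr (_ * expR _); field.
rewrite ge0_integralZl//= ?integral_normal_pdf ?mule1//.
- by apply/measurable_EFinP; exact: measurable_normal_pdf.
- by move=> z _; rewrite lee_fin normal_pdf_ge0.
Qed.

(** The exponential turns the standard density into [1 / a] times the density of standard deviation
    [1 / a]. For [a < 1] the exponent is nonnegative, and yet the integral converges. *)
Lemma gauss_integral_expR_sqr (a : R) : 0 < a ->
  (\int[gauss]_z (expR (- (a ^+ 2 - 1) * z ^+ 2 / 2))%:E = (a^-1)%:E)%E.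
Proof.
move=> a0; rewrite ge0_integral_normal//; last first.
  apply: measurableT_comp => //; apply: measurable_funM => //.
  exact: measurable_funM.
transitivity (\int[mu]_z ((a^-1)%:E * (normal_pdf 0 a^-1 z)%:E))%E.
  apply: eq_integral => z _; rewrite -EFinM; congr EFin.
  rewrite !normal_pdfE ?oner_neq0 ?gt_eqF ?invr_gt0// /normal_fun.
  have -> : normal_peak a^-1 = a * normal_peak 1.
    rewrite /normal_peak -!mulrnAr sqrtrM ?sqr_ge0// sqrtr_sqr.
    by rewrite gtr0_norm ?invr_gt0// expr1n mul1r invfM invrK.
  rewrite mulrCA -expRD -!mulrA mulKf ?gt_eqF//.
  by congr (_ * expR _); field; rewrite gt_eqF.
rewrite ge0_integralZl//= ?integral_normal_pdf ?mule1//.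
- by apply/measurable_EFinP; exact: measurable_normal_pdf.
- by move=> z _; rewrite lee_fin normal_pdf_ge0.
- by rewrite lee_fin invr_ge0 ltW.
Qed.

Lemma gauss_integrable_expR (t : R) :
  gauss.-integrable setT (fun z => (expR (t * z))%:E).
Proof.
apply/integrableP; split.
  by apply/measurable_EFinP; apply: measurableT_comp.
under eq_integral do rewrite /= ger0_norm ?expR_ge0//.
by rewrite gauss_integral_expR ltry.
Qed.

Lemma gauss_integrable_norm_expR (C : R) (f : R -> R) : measurable_fun setT f ->
  (forall z, `|f z| <= C * expR `|z|) -> gauss.-integrable setT (EFin \o f).
Proof.
move=> mf fC.
have C0 : 0 <= C.
  have := fC 0; rewrite normr0 expR0 mulr1; exact: le_trans.
have ig : gauss.-integrable setT
    (fun z => (C * (expR (1 * z) + expR (-1 * z)))%:E).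
  under eq_fun do rewrite EFinM EFinD.
  apply: integrableZl => //; apply: integrableD => //; exact: gauss_integrable_expR.
apply: (le_integrable measurableT _ _ ig); first exact/measurable_EFinP.
move=> z _ /=; rewrite lee_fin (le_trans (fC z))//.
rewrite [leRHS]ger0_norm ?mulr_ge0 ?addr_ge0 ?expR_ge0//.
rewrite ler_wpM2l// mul1r mulN1r.
by case: (ger0P z) => _; rewrite ?lerDl ?lerDr expR_ge0.
Qed.

(** [|z|^n <= n! exp |z|], from a single term of the exponential series. *)
Lemma gauss_integrableX n : gauss.-integrable setT (fun z => (`|z| ^+ n)%:E).
Proof.
apply: (@gauss_integrable_norm_expR n`!%:R).
  by apply: measurable_funX.
move=> z; rewrite normrX normr_id; case: n => [|n].
  by rewrite expr0 fact0 mul1r -expR0 ler_expR.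
rewrite mulrC -ler_pdivrMr ?ltr0n ?fact_gt0//.
by rewrite (le_trans _ (expR_ge1Dxn n (normr_ge0 z)))// lerDr.
Qed.

Lemma gauss_integrable_id : gauss.-integrable setT (EFin \o id).
Proof.
apply: (le_integrable measurableT _ _ (gauss_integrableX 1)) => //.
  exact/measurable_EFinP.
by move=> z _ /=; rewrite expr1 normr_id.
Qed.

Lemma gauss_integrable_sqr : gauss.-integrable setT (fun z => (z ^+ 2)%:E).
Proof.
apply: (le_integrable measurableT _ _ (gauss_integrableX 2)) => //.
  exact/measurable_EFinP/measurable_funX.
by move=> z _ /=; rewrite real_normK ?num_real.
Qed.

(** Integrating [exp (t z) >= 1 + t z] bounds [t m] by [exp (t^2 / 2) - 1], which is of order [t^2];
    small [t] of either sign force [m = 0]. *)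
Lemma gauss_expect_id : \int[gauss]_z z = 0.
Proof.
set m := Rintegral _ _ _.
have tm t : t * m <= expR (t ^+ 2 / 2) - 1.
  rewrite lerBrDl -[X in X + _](expect_cst gauss) -RintegralZl//; last first.
    exact: gauss_integrable_id.
  rewrite -RintegralD//; first last.
  - exact: (integrableZl measurableT t gauss_integrable_id).
  - exact/bounded_measurable_integrable/bounded_measurable_cst.
  rewrite (_ : expR _ = \int[gauss]_z expR (t * z)); last first.
    by rewrite /Rintegral gauss_integral_expR.
  apply: le_Rintegral => //; last by move=> z _; exact: expR_ge1Dx.
    have i1 := bounded_measurable_integrable gauss (bounded_measurable_cst _ 1).
    exact: (integrableD measurableT i1
      (integrableZl measurableT t gauss_integrable_id)).
  exact: gauss_integrable_expR.
(* With [u = s^2 / 2 <= 1/2], [exp (-u) >= 1 - u] gives [exp u <= 1 / (1 - u) <= 1 + 2 u]. *)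
have half (s : R) : 0 <= s <= 1 -> expR (s ^+ 2 / 2) - 1 <= s ^+ 2.
  move=> /andP[s0 s1]; have := expR_ge1Dx (- (s ^+ 2 / 2)); rewrite expRN.
  have e0 := expR_gt0 (s ^+ 2 / 2); move=> h.
  have s2 : s ^+ 2 <= 1 by rewrite expr_le1.
  have : (1 - s ^+ 2 / 2) * expR (s ^+ 2 / 2) <= 1.
    by rewrite -ler_pdivlMr// mul1r.
  nra.
have ms (s : R) : 0 < s <= 1 -> `|m| <= s.
  move=> /andP[s0 s1]; have h := half s; rewrite s1 (ltW s0) in h.
  have h1 := tm s; have h2 := tm (- s); rewrite sqrrN in h2.
  move: h => /(_ isT) h; rewrite ler_norml; apply/andP.
  by split; rewrite -(ler_pM2l s0); lra.
apply/eqP; rewrite -normr_eq0; apply/eqP/le_anti; rewrite normr_ge0 andbT.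
apply/ler_addgt0Pr => e e0; rewrite add0r.
have [e1|e1] := leP e 1; first by rewrite ms// e0.
by rewrite (le_trans _ (ltW e1))// ms// ltr01 lexx.
Qed.

(* Integrating [exp (- h z^2 / 2) >= 1 - h z^2 / 2], with [h = a^2 - 1] of
   either sign, bounds the second moment from both sides. *)
Lemma gauss_expect_sqr : \int[gauss]_z (z ^+ 2) = 1.
Proof.
set m := Rintegral _ _ _.
have am a : 0 < a -> 1 - (a ^+ 2 - 1) / 2 * m <= a^-1.
  move=> a0; rewrite -[X in X - _](expect_cst gauss) -RintegralZl//; last first.
    exact: gauss_integrable_sqr.
  have i1 : gauss.-integrable setT (EFin \o (fun z => (a ^+ 2 - 1) / 2 * z ^+ 2)).
    exact: (integrableZl measurableT _ gauss_integrable_sqr).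
  have i2 : gauss.-integrable setT (EFin \o (fun z => 1 : R)).
    exact/bounded_measurable_integrable/bounded_measurable_cst.
  rewrite -RintegralB//.
  rewrite (_ : a^-1 = \int[gauss]_z expR (- (a ^+ 2 - 1) * z ^+ 2 / 2)); last first.
    by rewrite /Rintegral gauss_integral_expR_sqr.
  apply: le_Rintegral => //.
  - exact: (integrableB measurableT i2 i1).
  - apply/integrableP; split.
      apply/measurable_EFinP/measurableT_comp => //.
      by apply: measurable_funM => //; exact: measurable_funM.
    under eq_integral do rewrite /= ger0_norm ?expR_ge0//.
    by rewrite gauss_integral_expR_sqr// ltry.
  - move=> z _; rewrite (le_trans _ (expR_ge1Dx _))//.
    by rewrite le_eqVlt; apply/orP; left; apply/eqP; field.
have m0 : 0 <= m by apply: Rintegral_ge0 => z _; exact: sqr_ge0.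
have am' a : 0 < a -> (1 - (a ^+ 2 - 1) / 2 * m) * a <= 1.
  by move=> a0; rewrite -ler_pdivlMr// mul1r am.
(* [am'] is applied at [a = 1 + h] if [m < 1] and at [a = 1 - h] if [m > 1], with [h] small enough
   compared with [|m - 1|] for the first order term to give a contradiction. *)
have [m1|m1|//] := ltgtP m 1.
- have h0 : 0 < (1 - m) / 4 by lra.
  have : 0 < 1 + (1 - m) / 4 by lra.
  move=> /am'; set h := (1 - m) / 4 in h0 *; have mh : m = 1 - 4 * h by rewrite /h; field.
  by rewrite mh; rewrite mh in m0; nra.
- pose h := (m - 1) / (3 * m).
  have h0 : 0 < h by rewrite /h divr_gt0; lra.
  have h1 : h < 3^-1 by rewrite /h ltr_pdivrMr; lra.
  have hm : 3 * h * m = m - 1 by rewrite /h; field; lra.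
  have : 0 < 1 - h by lra.
  by move=> /am'; nra.
Qed.

Definition gauss_moment3 : R := \int[gauss]_z (`|z| ^+ 3).

End GaussianMoments.

(** * Sums of independent Gaussian variables *)

Section GaussianConvolution.
Context (R : realType).
Local Notation mu := (@lebesgue_measure R).
Local Notation gauss := (@normal_prob R 0 1).

Lemma continuous_affine (a b : R) : continuous (fun x : R => a * x + b).
Proof.
move=> x; apply: cvgD; last exact: cvg_cst.
by apply: cvgM; [exact: cvg_cst|exact: cvg_id].
Qed.

Lemma measurable_affine2 (a b c : R) :
  measurable_fun setT (fun p : R * R => a * p.1 + b * p.2 + c).
Proof.
apply: measurable_funD => //; apply: measurable_funD.
  by apply: measurable_funM => //; exact: measurable_fst.
by apply: measurable_funM => //; exact: measurable_snd.
Qed.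

(** The substitution [x = s z + t w] in the inner integral, followed by Tonelli, leaves for each [x]
    the integral in [z] of the left side of [normal_pdf_convolution]; its right side integrates to
    [normal_pdf 0 c x]. *)
Lemma ge0_gauss_convolution (g : R -> R) (s t : R) : 0 < s -> 0 < t ->
  continuous g -> (forall x, 0 <= g x) ->
  (\int[gauss]_z \int[gauss]_w (g (s * z + t * w)%R)%:E =
   \int[gauss]_z (g (Num.sqrt (s ^+ 2 + t ^+ 2) * z)%R)%:E)%E.
Proof.
move=> s0 t0 cg g0; set c2 := s ^+ 2 + t ^+ 2; set c := Num.sqrt c2.
have c20 : 0 < c2 by rewrite addr_gt0 ?exprn_gt0.
have c0 : 0 < c by rewrite sqrtr_gt0.
have mg : measurable_fun setT g by exact: continuous_measurable_fun.
have mp := measurable_normal_pdf (0 : R) 1.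
have inner z : (\int[gauss]_w (g (s * z + t * w)%R)%:E =
    \int[mu]_x (g x * (normal_pdf 0 1 ((x - s * z) / t) / t))%:E)%E.
  have cgz : continuous (fun w => g (s * z + t * w)).
    under eq_fun do rewrite addrC.
    by move=> w; exact: (continuous_comp (@continuous_affine t (s * z) w) (cg _)).
  rewrite ge0_integral_normal//; last exact: continuous_measurable_fun.
  rewrite (@ge0_integral_affine _ _ t^-1 (- (s * z / t))) ?invr_gt0//.
  - apply: eq_integral => x _; congr EFin.
    have -> : t^-1 * x - s * z / t = (x - s * z) / t by field; rewrite gt_eqF.
    rewrite -mulrA; congr (g _ * _); field; exact: lt0r_neq0.
  - move=> w; apply: cvgM; first exact: cgz.
    by apply: continuous_normal_pdf; exact: oner_neq0.
  - by move=> w; rewrite mulr_ge0// normal_pdf_ge0.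
pose F (p : R * R) : \bar R :=
  (g p.2 * (normal_pdf 0 1 p.1 * (normal_pdf 0 1 ((p.2 - s * p.1) / t) / t)))%:E.
have mF : measurable_fun setT F.
  apply/measurable_EFinP/measurable_funM.
    by apply: measurableT_comp => //; exact: measurable_snd.
  apply: measurable_funM.
    by apply: measurableT_comp => //; exact: measurable_fst.
  apply: measurable_funM => //; apply: measurableT_comp => //.
  apply: (eq_measurable_fun (fun p : R * R => - (s / t) * p.1 + t^-1 * p.2 + 0)).
    by move=> p _; field; rewrite gt_eqF.
  exact: measurable_affine2.
have F0 p : (0 <= F p)%E.
  by rewrite lee_fin !mulr_ge0// ?normal_pdf_ge0// invr_ge0 ltW.
transitivity (\int[mu]_z \int[mu]_x F (z, x))%E.
  under eq_integral do rewrite inner.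
  rewrite (@ge0_integral_density _ _ _ mu gauss
    (fun x => (normal_pdf 0 1 x)%:E)) //.
  - apply: eq_integral => z _; rewrite -ge0_integralZr//=.
    + by apply: eq_integral => x _; rewrite -EFinM /F/=; congr EFin; ring.
    + apply/measurable_EFinP/measurable_funM => //.
      apply: measurable_funM => //; apply: measurableT_comp => //.
      by apply: measurable_funM => //; exact: measurable_funB.
    + move=> x _; rewrite lee_fin.
      by rewrite !mulr_ge0// ?normal_pdf_ge0// invr_ge0 ltW.
    + by rewrite lee_fin normal_pdf_ge0.
  - exact: integrable_normal_pdf.
  - apply: (@measurable_fun_fubini_tonelli_F _ _ _ _ _ mu
      (fun p : R * R => (g p.2 * (normal_pdf 0 1 ((p.2 - s * p.1) / t) / t))%:E)).
    + apply/measurable_EFinP/measurable_funM.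
        by apply: measurableT_comp => //; exact: measurable_snd.
      apply: measurable_funM => //; apply: measurableT_comp => //.
      apply: (eq_measurable_fun (fun p : R * R => - (s / t) * p.1 + t^-1 * p.2 + 0)).
        by move=> p _; field; rewrite gt_eqF.
      exact: measurable_affine2.
    + by move=> p; rewrite lee_fin !mulr_ge0// ?normal_pdf_ge0// invr_ge0 ltW.
  - move=> z; apply: integral_ge0 => x _.
    by rewrite lee_fin !mulr_ge0// ?normal_pdf_ge0// invr_ge0 ltW.
apply: (etrans (@fubini_tonelli _ _ _ _ R mu mu F mF F0)).
rewrite -(ge0_integral_normal_scale c0 cg g0) ge0_integral_normal//.
apply: eq_integral => x _.
under eq_integral.
  move=> z _; rewrite /F/= (normal_pdf_convolution x z s0 t0) -/c2 -/c mulrA.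
  rewrite EFinM; over.
rewrite ge0_integralZl//= ?integral_normal_pdf ?mule1//.
- by apply/measurable_EFinP; exact: measurable_normal_pdf.
- by move=> z _; rewrite lee_fin normal_pdf_ge0.
- by rewrite lee_fin mulr_ge0// normal_pdf_ge0.
Qed.

(** The convolution of [g] with a centered normal law of standard deviation [|s|], written over the
    standard law so that [s = 0] gives back [g]. *)
Definition gauss_smooth (g : R -> R) (s y : R) : R := \int[gauss]_z g (y + s * z).

Lemma gauss_smooth0 (g : R -> R) y : gauss_smooth g 0 y = g y.
Proof.
by rewrite /gauss_smooth; under eq_Rintegral do rewrite mul0r addr0; rewrite expect_cst.
Qed.

Lemma bounded_measurable_affine (g : R -> R) (s y : R) : bounded_measurable g ->
  bounded_measurable (fun z : R => g (y + s * z)).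
Proof.
apply: bounded_measurable_comp; apply: measurable_funD => //.
Qed.

(** Semigroup property: independent Gaussian steps add their variances. A vanishing step is treated
    apart, because the convolution of densities requires both deviations to be positive. *)
Lemma gauss_smooth_comp (g : R -> R) (s t y : R) : 0 <= s -> 0 <= t ->
  continuous g -> bounded_measurable g -> (forall x, 0 <= g x) ->
  \int[gauss]_z gauss_smooth g t (y + s * z) =
  gauss_smooth g (Num.sqrt (s ^+ 2 + t ^+ 2)) y.
Proof.
move=> + + cg bg g0; rewrite le_eqVlt => /predU1P[<- t0|s0].
  under eq_Rintegral do rewrite mul0r addr0.
  by rewrite expect_cst expr0n add0r sqrtr_sqr ger0_norm.
rewrite le_eqVlt => /predU1P[<-|t0].
  under eq_Rintegral do rewrite gauss_smooth0.
  by rewrite expr0n addr0 sqrtr_sqr gtr0_norm.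
pose h x := g (y + x).
have ch : continuous h.
  have cy : continuous (fun x : R => y + x).
    by move=> x; apply: cvgD; [exact: cvg_cst|exact: cvg_id].
  by move=> x; exact: (continuous_comp (cy x) (cg _)).
have := @ge0_gauss_convolution h s t s0 t0 ch (fun x => g0 _).
rewrite /h /gauss_smooth /Rintegral => E; congr fine.
rewrite -E; apply: eq_integral => z _.
rewrite -/(Rintegral _ _ _) EFin_expect; last exact: bounded_measurable_affine.
by apply: eq_integral => w _; rewrite addrA.
Qed.

End GaussianConvolution.

(** * Logistic test functions *)

Section Taylor.
Context (R : realType).
Implicit Types (f g a b : R -> R).

Lemma mean_value_bound f (df : R -> R) (u v C : R) :
  (forall x : R, is_derive x 1 f (df x)) ->
  (forall x, `|x - u| <= `|v - u| -> `|df x| <= C) ->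
  `|f v - f u| <= C * `|v - u|.
Proof.
move=> fdf dfC.
have cf : continuous f.
  by move=> x; apply/differentiable_continuous/derivable1_diffP; have [] := fdf x.
have [uv|vu] := leP u v.
- have [|c] := MVT_segment uv (fun x _ => fdf x); first exact: continuous_subspaceT.
  rewrite in_itv /= => /andP[uc cv] ->; rewrite normrM ler_wpM2r// dfC//.
  by rewrite !ger0_norm ?subr_ge0// lerB.
- have [|c] := MVT_segment (ltW vu) (fun x _ => fdf x); first exact: continuous_subspaceT.
  rewrite in_itv /= => /andP[vc cu] E; rewrite distrC E normrM distrC ler_wpM2r// dfC//.
  by rewrite distrC (distrC v) !ger0_norm ?subr_ge0 ?(ltW vu)// lerB.
Qed.

(** [a] and [b] stand for the first two derivatives of [g]. Only the expansion is recorded, and not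
    differentiability, because the expansion passes to Gaussian smoothings by mere integration. *)
Definition taylor3 g a b (K : R) := forall y h,
  `|g (y + h) - g y - a y * h - b y * (h ^+ 2 / 2)| <= K * `|h| ^+ 3.

(** Three nested mean value bounds: for [b], for [a] minus its tangent, for [g] minus its quadratic
    part. This yields the constant [K] where Taylor's formula would give [K / 6]. *)
Lemma is_derive_taylor3 g a b (c : R -> R) (K : R) :
  (forall x : R, is_derive x 1 g (a x)) -> (forall x : R, is_derive x 1 a (b x)) ->
  (forall x : R, is_derive x 1 b (c x)) -> (forall x, `|c x| <= K) ->
  taylor3 g a b K.
Proof.
move=> dg da db cK y h.
have K0 : 0 <= K by exact: le_trans (cK 0).
have bb u : `|b u - b y| <= K * `|u - y| by apply: (mean_value_bound db) => x _.
have aa u : `|a u - a y - b y * (u - y)| <= K * `|u - y| ^+ 2.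
  pose q (u : R) : R := a u - b y * u.
  have dq (x : R) : is_derive x 1 q (b x - b y).
    by apply: is_derive_eq; rewrite /GRing.scale/= mulr1.
  have -> : a u - a y - b y * (u - y) = q u - q y by rewrite /q; ring.
  rewrite expr2 mulrA; apply: (mean_value_bound dq) => x xu.
  by rewrite (le_trans (bb x))// ler_wpM2l.
pose p (u : R) : R := g u - a y * u - b y * ((u - y) ^+ 2 / 2).
have dp (x : R) : is_derive x 1 p (a x - a y - b y * (x - y)).
  apply: is_derive_eq; rewrite /GRing.scale/=.
  by field.
have -> : g (y + h) - g y - a y * h - b y * (h ^+ 2 / 2) = p (y + h) - p y.
  by rewrite /p; field.
have hE : `|h| = `|y + h - y| by rewrite addrC addKr.
rewrite exprSr mulrA [X in _ * X]hE.
apply: (mean_value_bound dp) => x xu.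
by rewrite (le_trans (aa x))// ler_wpM2l// ler_sqr ?nnegrE// hE.
Qed.

(** The decreasing sigmoid, a smooth stand-in for the indicator of []-oo, 0]]. *)
Definition logistic (x : R) : R := (1 + expR x)^-1.

Lemma logistic_gt0 x : 0 < logistic x.
Proof. by rewrite invr_gt0 addr_gt0 ?expR_gt0. Qed.

Lemma logistic_lt1 x : logistic x < 1.
Proof. by rewrite invf_lt1 ?addr_gt0 ?expR_gt0// ltrDl expR_gt0. Qed.

Lemma is_derive_logistic (x : R) :
  is_derive x 1 logistic (logistic x ^+ 2 - logistic x).
Proof.
have h : 1 + expR x != 0 by rewrite gt_eqF// addr_gt0 ?expR_gt0.
rewrite /logistic; apply: is_derive_eq.
by rewrite /GRing.scale/=; field.
Qed.

Lemma logistic_le_expR x : logistic x <= expR (- x).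
Proof.
rewrite expRN /logistic lef_pV2 ?posrE ?addr_gt0 ?expR_gt0//.
by rewrite lerDr.
Qed.

Lemma logistic_ge_expR x : 1 - expR x <= logistic x.
Proof.
have e0 := expR_gt0 x.
rewrite /logistic -[leRHS]mul1r ler_pdivlMr ?addr_gt0//; nra.
Qed.

Definition logistic_step (M c t : R) : R := logistic (M * (t - c)).

Lemma logistic_step_gt0 M c t : 0 < logistic_step M c t.
Proof. exact: logistic_gt0. Qed.

Lemma logistic_step_lt1 M c t : logistic_step M c t < 1.
Proof. exact: logistic_lt1. Qed.

Lemma is_derive_logistic_step (M c x : R) : let l := logistic_step M c in
  is_derive x 1 l (M * (l x ^+ 2 - l x)).
Proof.
move=> l; have -> : l = logistic \o (fun t => M * (t - c)) by [].
have d1 : is_derive x 1 (fun t : R => M * (t - c)) M.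
  by apply: is_derive_eq; rewrite /GRing.scale/= subr0 mulr1.
have d2 := is_derive_logistic (M * (x - c)).
by apply: is_derive_eq; rewrite /GRing.scale/= mulrC.
Qed.

Lemma continuous_logistic_step M c : continuous (logistic_step M c).
Proof.
move=> x; apply/differentiable_continuous/derivable1_diffP.
by have [] := is_derive_logistic_step M c x.
Qed.

Lemma bounded_measurable_logistic_step M c :
  bounded_measurable (logistic_step M c).
Proof.
split; first by apply: continuous_measurable_fun; exact: continuous_logistic_step.
by exists 1 => x; rewrite gtr0_norm ?logistic_step_gt0// ltW// logistic_step_lt1.
Qed.

Lemma logistic_step_lipschitz M c u v : 0 <= M ->
  `|logistic_step M c u - logistic_step M c v| <= M * `|u - v|.
Proof.
move=> M0; apply: (mean_value_bound (is_derive_logistic_step M c)) => x _.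
have := logistic_step_gt0 M c x; have := logistic_step_lt1 M c x.
set l := logistic_step M c x => l1 l0.
rewrite normrM ger0_norm// ler_piMr// ler_norml; apply/andP; split; nra.
Qed.

(** The derivatives of [l] are polynomials in [l]. The third one is [M^3] times
    [(6 l^2 - 6 l + 1) (l^2 - l)], and both factors lie in [[-1, 1]] when [0 < l < 1]. *)
Lemma logistic_step_taylor3 M c : 0 <= M ->
  exists a b, [/\ bounded_measurable a, bounded_measurable b &
    taylor3 (logistic_step M c) a b (M ^+ 3)].
Proof.
move=> M0; set l := logistic_step M c.
have bl : bounded_measurable l by exact: bounded_measurable_logistic_step.
exists (fun x => M * (l x ^+ 2 - l x)),
  (fun x => M ^+ 2 * (2 * l x ^+ 3 - 3 * l x ^+ 2 + l x)).
have bc (k : R) := @bounded_measurable_cst _ R R k.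
have bX n := bounded_measurableX n bl.
split.
- exact: (bounded_measurableM (bc M) (bounded_measurableB (bX 2) bl)).
- exact: (bounded_measurableM (bc (M ^+ 2)) (bounded_measurableD
    (bounded_measurableB (bounded_measurableM (bc 2) (bX 3))
      (bounded_measurableM (bc 3) (bX 2))) bl)).
refine (@is_derive_taylor3 _ _ _
  (fun x => M ^+ 3 * ((6 * l x ^+ 2 - 6 * l x + 1) * (l x ^+ 2 - l x))) _ _ _ _ _).
- exact: is_derive_logistic_step.
- move=> x; have dl := is_derive_logistic_step M c x; rewrite -/l in dl.
  by apply: is_derive_eq; rewrite /GRing.scale/=; ring.
- move=> x; have dl := is_derive_logistic_step M c x; rewrite -/l in dl.
  by apply: is_derive_eq; rewrite /GRing.scale/=; ring.
- move=> x; have := logistic_step_gt0 M c x; have := logistic_step_lt1 M c x.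
  rewrite -/l; move: (l x) => k k1 k0.
  rewrite normrM ger0_norm ?exprn_ge0// ler_piMr ?exprn_ge0// normrM.
  by rewrite mulr_ile1// ler_norml; apply/andP; split; nra.
Qed.

End Taylor.

(** * From logistic functions to the indicator of a half-line *)

Section LogisticLimit.
Context (R : realType).
Local Notation mu := (@lebesgue_measure R).
Local Notation gauss := (@normal_prob R 0 1).

(** Pointwise convergence may fail at [z] only, which is a null set for a nondegenerate normal law,
    so dominated convergence applies. For [v = 0] the smoothing is evaluation at [0], a point where
    convergence is known because then [z != 0]. *)
Lemma cvg_gauss_smooth_Phi (f : nat -> R -> R) (z v : R) :
  (forall k, continuous (f k)) -> (forall k t, 0 <= f k t <= 1) ->
  (forall t, t < z -> f k t @[k --> \oo] --> (1 : R)) ->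
  (forall t, z < t -> f k t @[k --> \oo] --> (0 : R)) ->
  0 <= v -> v != 0 \/ z != 0 ->
  (gauss_smooth (f k) (Num.sqrt v) 0)%:E @[k --> \oo] --> Phi z v.
Proof.
move=> cf f01 flt fgt v0 vz; rewrite /Phi.
have mf k : measurable_fun setT (f k) by exact: continuous_measurable_fun.
have [v0'|vN0] := eqVneq v 0.
  have z0 : z != 0 by case: vz => //; rewrite v0' eqxx.
  rewrite v0' sqrtr0; under eq_fun do rewrite gauss_smooth0.
  apply: cvg_EFin; first exact: nearW.
  rewrite /dirac indicE; have [zlt|zgt|] := ltgtP z 0.
  - rewrite memNset /=; first exact: fgt.
    by rewrite in_itv/= leNgt zlt.
  - rewrite mem_set /=; first exact: flt.
    by rewrite in_itv/= ltW.
  - by move=> zE; rewrite zE eqxx in z0.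
have vp : 0 < v by rewrite lt_neqAle eq_sym vN0.
have s0 : 0 < Num.sqrt v by rewrite sqrtr_gt0.
have bf k : bounded_measurable (f k).
  split => //; exists 1 => t; have /andP[f0 f1] := f01 k t.
  by rewrite ger0_norm.
have E k : ((gauss_smooth (f k) (Num.sqrt v) 0)%:E =
    \int[normal_prob 0%R (Num.sqrt v)]_x (f k x)%:E)%E.
  rewrite EFin_expect; last exact: bounded_measurable_affine.
  rewrite (ge0_integral_normal_scale s0 (cf k)).
    by apply: eq_integral => x _; rewrite add0r.
  by move=> x; have /andP[] := f01 k x.
under eq_fun do rewrite E.
have -> : normal_prob 0 (Num.sqrt v) `]-oo, z] =
   (\int[normal_prob 0%R (Num.sqrt v)]_x (\1_(`]-oo, z]%classic : set R) x)%:E)%E.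
  by rewrite integral_indic// setIT.
pose N := normal_prob 0 (Num.sqrt v).
have mI : measurable (`]-oo, z]%classic : set R) by [].
have [| | | | |_ _ //] := (@dominated_convergence _ _ _ N setT measurableT
  (fun k x => (f k x)%:E) (fun x => (\1_(`]-oo, z]%classic : set R) x)%:E)
  (fun x => 1%E)).
- by move=> k; apply/measurable_EFinP; exact: mf.
- by apply/measurable_EFinP; exact: measurable_indic.
- exists [set z]; split => //.
    by have /null_content_dominatesP := normal_prob_dominates 0 (Num.sqrt v); apply => //; exact: lebesgue_measure_set1.
  move=> x /=; apply: contra_notP => xz _.
  apply: cvg_EFin; first exact: nearW.
  rewrite indicE; have [xltz|zltx|] := ltgtP x z; last by move/xz.
  - by rewrite mem_set /= ?in_itv/= ?ltW//; exact: flt.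
  - by rewrite memNset /= ?in_itv/= ?leNgt ?zltx//; exact: fgt.
- exact: (bounded_measurable_integrable N (bounded_measurable_cst _ 1)).
- apply: aeW => x k _ /=; have /andP[f0 f1] := f01 k x.
  by rewrite lee_fin ger0_norm.
Qed.

(** Slope [K^2] and shift [1 / K] are matched: at distance [1 / K] from its center the step has
    exponent [K] in absolute value, so it is within [exp (- K)] of its limit value. *)
Lemma logistic_step_upper (K : R) (z t : R) : 0 < K ->
  \1_`]-oo, z] t <= logistic_step (K ^+ 2) (z + K^-1) t + expR (- K).
Proof.
move=> K0; rewrite indicE.
have [|_] := boolP (t \in _); last by rewrite addr_ge0 ?expR_ge0 ?ltW ?logistic_step_gt0.
move=> /set_mem/=; rewrite in_itv/= => tz.
rewrite -lerBlDr; apply: le_trans (logistic_ge_expR _).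
rewrite lerD2l lerN2 ler_expR.
have -> : K ^+ 2 * (t - (z + K^-1)) = K ^+ 2 * (t - z) - K by field; rewrite gt_eqF.
by rewrite gerDr mulr_ge0_le0 ?sqr_ge0 ?subr_le0.
Qed.

Lemma logistic_step_lower (K : R) (z t : R) : 0 < K ->
  logistic_step (K ^+ 2) (z - K^-1) t - expR (- K) <= \1_`]-oo, z] t.
Proof.
move=> K0; rewrite indicE.
have [_|] := boolP (t \in _).
  have := logistic_step_lt1 (K ^+ 2) (z - K^-1) t; have := expR_gt0 (- K) => /=; lra.
move=> /negP tz; have {}tz : z < t.
  by rewrite ltNge; apply/negP => h; apply: tz; rewrite inE/= in_itv/=.
rewrite lerBlDr add0r; apply: le_trans (logistic_le_expR _) _.
rewrite ler_expR lerN2.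
have -> : K ^+ 2 * (t - (z - K^-1)) = K ^+ 2 * (t - z) + K by field; rewrite gt_eqF.
by rewrite lerDr mulr_ge0 ?sqr_ge0 ?subr_ge0 ?ltW.
Qed.

Lemma cvg_expRN_succ : expR (- (k.+1%:R : R)) @[k --> \oo] --> (0 : R).
Proof. by have := @cvgn_expR R; rewrite -cvg_shiftS. Qed.

Lemma near_succ_ge (c : R) : \forall k \near \oo, c <= k.+1%:R.
Proof.
near=> k; rewrite (@le_trans _ _ k%:R) ?ler_nat//.
by near: k; exact: nbhs_infty_ger.
Unshelve. all: end_near. Qed.

(* Both shifts [e = 1] and [e = -1] are covered. *)
Lemma cvg_logistic_step1 (e z t : R) : `|e| <= 1 -> t < z ->
  logistic_step (k.+1%:R ^+ 2) (z + e * k.+1%:R^-1) t @[k --> \oo] --> (1 : R).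
Proof.
move=> e1 tz.
apply: (@squeeze_cvgr _ _ _ _ (fun k => 1 - expR (- (k.+1%:R : R))) (fun=> 1)).
- near=> k; rewrite (ltW (logistic_step_lt1 _ _ _)) andbT.
  apply: le_trans (logistic_ge_expR _).
  rewrite lerD2l lerN2 ler_expR.
  have K0 : 0 < k.+1%:R :> R by [].
  (* From this rank on, the distance from [t] to [z] is at least twice the shift, and the exponent
     is at most [- k.+1]. *)
  have kh : 2 / (z - t) <= k.+1%:R by near: k; exact: near_succ_ge.
  rewrite ler_pdivrMr ?subr_gt0// in kh.
  have -> : k.+1%:R ^+ 2 * (t - (z + e * k.+1%:R^-1)) =
    k.+1%:R * (- (k.+1%:R * (z - t)) - e) :> R by field; rewrite gt_eqF.
  rewrite -[leRHS]mulrN1 ler_wpM2l//; move: e1; rewrite ler_norml => /andP[]; lra.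
- rewrite -[X in _ --> X]subr0; apply: cvgB; [exact: cvg_cst|exact: cvg_expRN_succ].
- exact: cvg_cst.
Unshelve. all: end_near. Qed.

Lemma cvg_logistic_step0 (e z t : R) : `|e| <= 1 -> z < t ->
  logistic_step (k.+1%:R ^+ 2) (z + e * k.+1%:R^-1) t @[k --> \oo] --> (0 : R).
Proof.
move=> e1 zt.
apply: (@squeeze_cvgr _ _ _ _ (fun=> 0) (fun k => expR (- (k.+1%:R : R)))).
- near=> k; rewrite (ltW (logistic_step_gt0 _ _ _)) /=.
  apply: le_trans (logistic_le_expR _) _.
  rewrite ler_expR lerN2.
  have K0 : 0 < k.+1%:R :> R by [].
  have kh : 2 / (t - z) <= k.+1%:R by near: k; exact: near_succ_ge.
  rewrite ler_pdivrMr ?subr_gt0// in kh.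
  have -> : k.+1%:R ^+ 2 * (t - (z + e * k.+1%:R^-1)) =
    k.+1%:R * (k.+1%:R * (t - z) - e) :> R by field; rewrite gt_eqF.
  rewrite -[leLHS]mulr1 ler_wpM2l//; move: e1; rewrite ler_norml => /andP[]; lra.
- exact: cvg_cst.
- exact: cvg_expRN_succ.
Unshelve. all: end_near. Qed.

Lemma cvg_gauss_smooth_logistic (e z v : R) : `|e| <= 1 -> 0 <= v ->
  v != 0 \/ z != 0 ->
  (gauss_smooth (logistic_step (k.+1%:R ^+ 2) (z + e * k.+1%:R^-1))
    (Num.sqrt v) 0)%:E @[k --> \oo] --> Phi z v.
Proof.
move=> e1 v0 vz; apply: cvg_gauss_smooth_Phi => //.
- by move=> k; exact: continuous_logistic_step.
- by move=> k t; rewrite !ltW ?logistic_step_gt0 ?logistic_step_lt1.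
- by move=> t tz; exact: cvg_logistic_step1.
- by move=> t tz; exact: cvg_logistic_step0.
Qed.

End LogisticLimit.

(** * Second moments of the edge noise *)

Section ProductBernoulli.
Context (R : realType) (I : finType) (p : I -> R).
Hypothesis p01 : forall i, 0 <= p i <= 1.
Local Notation config := {ffun I -> bool}.
Implicit Types (a : config) (phi psi : config -> R).

Definition bernoulli_weight a : R := \prod_i bernoulli_pmf (p i) (a i).

Definition bernoulli_expect phi : R := \sum_a bernoulli_weight a * phi a.

Local Notation E := bernoulli_expect.

Lemma bernoulli_weight_ge0 a : 0 <= bernoulli_weight a.
Proof. by apply: prodr_ge0 => i _; exact: bernoulli_pmf_ge0. Qed.

Lemma bernoulli_expectD phi psi :
  E (fun a => phi a + psi a) = E phi + E psi.
Proof. by rewrite -big_split; apply: eq_bigr => a _; rewrite mulrDr. Qed.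

Lemma bernoulli_expectZ c phi : E (fun a => c * phi a) = c * E phi.
Proof. by rewrite mulr_sumr; apply: eq_bigr => a _; rewrite mulrCA. Qed.

Lemma bernoulli_expectB phi psi :
  E (fun a => phi a - psi a) = E phi - E psi.
Proof.
rewrite (_ : E phi - _ = E phi + (-1) * E psi); last by ring.
by rewrite -bernoulli_expectZ -bernoulli_expectD; apply: eq_bigr => a _; ring.
Qed.

Lemma bernoulli_expect_sum (J : Type) (r : seq J) (Q : pred J)
    (f : J -> config -> R) :
  E (fun a => \sum_(j <- r | Q j) f j a) = \sum_(j <- r | Q j) E (f j).
Proof. by rewrite exchange_big; apply: eq_bigr => a _; rewrite mulr_sumr. Qed.

Lemma le_bernoulli_expect phi psi : (forall a, phi a <= psi a) -> E phi <= E psi.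
Proof.
by move=> le; apply: ler_sum => a _; rewrite ler_wpM2l ?bernoulli_weight_ge0.
Qed.

Lemma eq_bernoulli_expect phi psi : phi =1 psi -> E phi = E psi.
Proof. by move=> eq; apply: eq_bigr => a _; rewrite eq. Qed.

Lemma bernoulli_expect_cst c : E (fun=> c) = c.
Proof.
rewrite /E -mulr_suml -[RHS]mul1r; congr (_ * _).
rewrite -(bigA_distr_bigA (fun i b => bernoulli_pmf (p i) b)).
by apply: big1 => i _; rewrite big_bool /bernoulli_pmf/= subrKC.
Qed.

Lemma norm_bernoulli_expect phi : `|E phi| <= E (fun a => `|phi a|).
Proof.
rewrite (le_trans (ler_norm_sum _ _ _))//; apply: ler_sum => a _.
by rewrite normrM ger0_norm ?bernoulli_weight_ge0.
Qed.

Lemma norm_bernoulli_expect_le phi c : (forall a, `|phi a| <= c) -> `|E phi| <= c.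
Proof.
move=> h; rewrite (le_trans (norm_bernoulli_expect _))//.
by rewrite -[leRHS]bernoulli_expect_cst; exact: le_bernoulli_expect.
Qed.

Definition ffun_update a (e : I) (b : bool) : config :=
  [ffun i => if i == e then b else a i].

Lemma ffun_update_same a e : ffun_update a e (a e) = a.
Proof. by apply/ffunP => i; rewrite ffunE; case: eqP => [->|]. Qed.

(** Integrates the coordinate [e] alone. Each configuration is paired with its flip at [e]: both
    have the same weight outside [e], and the identity holds on every pair. *)
Lemma bernoulli_expect_coord e phi :
  E phi = E (fun a => p e * phi (ffun_update a e true) +
                      (1 - p e) * phi (ffun_update a e false)).
Proof.
pose flip a := ffun_update a e (~~ a e).
have flipK : involutive flip.
  by move=> a; apply/ffunP => i; rewrite !ffunE eqxx negbK; case: eqP => [->|].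
have Eflip phi' : E phi' = 2^-1 *
    \sum_a (bernoulli_weight a * phi' a +
            bernoulli_weight (flip a) * phi' (flip a)).
  rewrite big_split/= -(reindex_inj (inv_inj flipK) (P := predT)
    (F := fun a => bernoulli_weight a * phi' a))/= -/(E phi').
  by field.
rewrite Eflip [RHS]Eflip; congr (_ * _); apply: eq_bigr => a _.
pose r := \prod_(i | i != e) bernoulli_pmf (p i) (a i).
have wE b : bernoulli_weight (ffun_update a e b) = bernoulli_pmf (p e) b * r.
  rewrite /bernoulli_weight (bigD1 e)//= ffunE eqxx; congr (_ * _).
  by apply: eq_bigr => i ie; rewrite ffunE (negbTE ie).
have uu b b' : ffun_update (ffun_update a e b) e b' = ffun_update a e b'.
  by apply/ffunP => i; rewrite !ffunE; case: eqP.
rewrite -[in LHS](ffun_update_same a e) -[in RHS](ffun_update_same a e) /flip.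
rewrite !uu !wE !ffunE !eqxx /bernoulli_pmf; case: (a e) => /=; ring.
Qed.

(** The common source of the second moment bounds: only the diagonal terms of the square survive,
    each at most 1. What remains in each application is to find, in every cross term, an edge that
    occurs once. *)
Lemma bernoulli_expect_sqr_sum (J : finType) (f : J -> config -> R) :
  (forall j k, j != k -> E (fun a => f j a * f k a) = 0) ->
  (forall j a, `|f j a| <= 1) ->
  E (fun a => (\sum_j f j a) ^+ 2) <= #|J|%:R.
Proof.
move=> unc f1.
have -> : E (fun a => (\sum_j f j a) ^+ 2) =
    \sum_j \sum_k E (fun a => f j a * f k a).
  rewrite -[RHS](eq_bigr _ (fun j _ => bernoulli_expect_sum _ _ _)).
  rewrite -bernoulli_expect_sum; apply: eq_bernoulli_expect => a.
  by rewrite expr2 big_distrlr.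
rewrite -sum1_card natr_sum; apply: ler_sum => j _.
rewrite (bigD1 j)//= big1 ?addr0; last by move=> k kj; rewrite unc// eq_sym.
rewrite -[leRHS]bernoulli_expect_cst; apply: le_bernoulli_expect => a.
by rewrite (le_trans (ler_norm _))// normrM mulr_ile1.
Qed.

End ProductBernoulli.

(** * The centered adjacency matrix given the latent positions *)

Section EdgeNoise.
Context (R : realType) (n : nat) (x : 'I_n -> R).
Hypothesis x01 : forall i, 0 <= x i <= 1.
Local Notation pair_n := ('I_n * 'I_n)%type.
Local Notation config := {ffun pair_n -> bool}.
Implicit Types (a : config) (phi : config -> R).

(** A canonical key for an unordered pair, which makes the noise matrix symmetric by
    construction. *)
Definition edge (i j : 'I_n) : pair_n := if (i < j)%N then (i, j) else (j, i).

(* The entries outside the strict upper triangle are almost surely [false]. *)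
Definition edge_prob (e : pair_n) : R :=
  if (e.1 < e.2)%N then x e.1 * x e.2 else 0.

(** Agrees with [A - x x^T] off the diagonal. On the diagonal it is [0] instead of [- x_i^2], so
    that all entries are centered. *)
Definition edge_noise a (i j : 'I_n) : R :=
  if i == j then 0 else (a (edge i j))%:R - x i * x j.

Local Notation E := (bernoulli_expect edge_prob).
Local Notation h := edge_noise.

Lemma edge_prob01 e : 0 <= edge_prob e <= 1.
Proof.
rewrite /edge_prob; case: ifP => _; last by rewrite lexx ler01.
have /andP[a0 a1] := x01 e.1; have /andP[b0 b1] := x01 e.2.
by rewrite mulr_ge0// mulr_ile1.
Qed.

Lemma edgeC i j : edge i j = edge j i.
Proof.
rewrite /edge; case: (ltngtP i j) => // ij.
by have -> : i = j by exact/val_inj.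
Qed.

Lemma edge_prob_edge i j : i != j -> edge_prob (edge i j) = x i * x j.
Proof.
rewrite /edge /edge_prob; case: (ltngtP i j) => [ij|ji|ij] /=.
- by rewrite ij.
- by rewrite ji mulrC.
- by move/eqP; case; exact/val_inj.
Qed.

Lemma edge_noiseC a i j : h a i j = h a j i.
Proof. by rewrite /h eq_sym edgeC mulrC. Qed.

Lemma edge_noise_diag a i : h a i i = 0.
Proof. by rewrite /h eqxx. Qed.

Lemma edge_noise_le1 a i j : `|h a i j| <= 1.
Proof.
rewrite /h; case: ifP => _; first by rewrite normr0.
have /andP[a0 a1] := x01 i; have /andP[b0 b1] := x01 j.
have ab0 : 0 <= x i * x j by rewrite mulr_ge0.
have ab1 : x i * x j <= 1 by rewrite mulr_ile1.
by rewrite ler_norml; case: (a _) => /=; lra.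
Qed.

Lemma edge_inj i j k l : edge i j = edge k l ->
  (k == i) && (l == j) || (k == j) && (l == i).
Proof.
rewrite /edge; case: ifP => _; case: ifP => _ [-> ->]; by rewrite !eqxx ?orbT.
Qed.

Definition other_edge (i j k l : 'I_n) :=
  ~~ ((k == i) && (l == j) || (k == j) && (l == i)).

Lemma edge_noise_update a i j k l b : other_edge i j k l ->
  h (ffun_update a (edge i j) b) k l = h a k l.
Proof.
move=> ne; rewrite /h ffunE; case: (eqVneq (edge k l)) => // e.
by move: ne; rewrite /other_edge (edge_inj (esym e)).
Qed.

(** The invariance hypothesis expresses that [phi] is independent of the edge [i j]; averaging over
    that edge first gives zero. *)
Lemma edge_noise_center i j phi :
  (forall a b, phi (ffun_update a (edge i j) b) = phi a) ->
  E (fun a => h a i j * phi a) = 0.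
Proof.
move=> inv; have [->|ij] := eqVneq i j.
  rewrite -[RHS](mul0r (E (fun=> 0))) -bernoulli_expectZ.
  by apply: eq_bernoulli_expect => a; rewrite edge_noise_diag !mul0r.
rewrite (bernoulli_expect_coord _ (edge i j)) -[RHS](mul0r (E phi)).
rewrite -bernoulli_expectZ; apply: eq_bernoulli_expect => a.
rewrite !inv /h (negbTE ij) !ffunE !eqxx edge_prob_edge//=; ring.
Qed.

Lemma edge_noise_center3 i j k l k' l' k'' l'' (c : R) :
  other_edge i j k l -> other_edge i j k' l' -> other_edge i j k'' l'' ->
  E (fun a => h a i j * (h a k l * h a k' l' * h a k'' l'' * c)) = 0.
Proof.
by move=> *; apply: edge_noise_center => a b; rewrite !edge_noise_update.
Qed.

Lemma norm_x_le1 i : `|x i| <= 1.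
Proof. by have /andP[x0 x1] := x01 i; rewrite ger0_norm. Qed.

Lemma expect_noise_row i :
  E (fun a => (\sum_j h a i j * x j) ^+ 2) <= n%:R.
Proof.
rewrite -[X in _ <= X%:R]card_ord; apply: bernoulli_expect_sqr_sum.
- exact: edge_prob01.
- move=> j k jk.
  under eq_bernoulli_expect do rewrite -mulrA.
  have [->|ij] := eqVneq i j.
    under eq_bernoulli_expect do rewrite edge_noise_diag mul0r.
    by rewrite bernoulli_expect_cst//; exact: edge_prob01.
  apply: edge_noise_center => a b; rewrite edge_noise_update// /other_edge.
  by rewrite eqxx/= (negbTE ij)/= orbF eq_sym.
- by move=> j a; rewrite normrM mulr_ile1 ?edge_noise_le1 ?norm_x_le1.
Qed.

(** By symmetry every edge is counted twice. The sum over [i < j] has uncorrelated terms, and the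
    factor 2 becomes 4 after squaring. *)
Lemma expect_noise_quadratic :
  E (fun a => (\sum_i \sum_j x i * h a i j * x j) ^+ 2) <= 4 * n%:R ^+ 2.
Proof.
pose f (e : pair_n) a : R := if (e.1 < e.2)%N then h a e.1 e.2 * (x e.1 * x e.2) else 0.
have fE a : \sum_i \sum_j x i * h a i j * x j = 2 * \sum_e f e a.
  have -> : \sum_e f e a = \sum_i \sum_j f (i, j) a by rewrite pair_bigA; apply: eq_bigr => -[].
  rewrite mulr_natl mulr2n [X in _ = X + _]exchange_big -big_split/=.
  apply: eq_bigr => i _; rewrite -big_split/=; apply: eq_bigr => j _.
  rewrite /f/=; case: (ltngtP i j) => [ij|ij|ij].
  - by rewrite add0r; ring.
  - by rewrite addr0 edge_noiseC; ring.
  - by have -> : i = j by [exact/val_inj]; rewrite edge_noise_diag; ring.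
under eq_bernoulli_expect do rewrite fE exprMn.
have -> : n%:R ^+ 2 = #|{: pair_n}|%:R :> R.
  by rewrite card_prod !card_ord natrM expr2.
have -> : 2 ^+ 2 = 4 :> R by rewrite -natrX.
rewrite bernoulli_expectZ ler_wpM2l//.
apply: bernoulli_expect_sqr_sum; first exact: edge_prob01.
- move=> [i j] [k l] ne; rewrite /f/=.
  have [ij|ij] := ltnP i j; last first.
    under eq_bernoulli_expect do rewrite mul0r.
    by rewrite bernoulli_expect_cst//; exact: edge_prob01.
  have [kl|kl] := ltnP k l; last first.
    under eq_bernoulli_expect do rewrite mulr0.
    by rewrite bernoulli_expect_cst//; exact: edge_prob01.
  under eq_bernoulli_expect do rewrite -mulrA.
  apply: edge_noise_center => a b; rewrite edge_noise_update// /other_edge.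
  apply/negP => /orP[] /andP[/eqP ki /eqP lj].
    by move: ne; rewrite ki lj eqxx.
  by move: kl; rewrite ki lj ltnNge (ltnW ij).
- move=> [i j] a; rewrite /f/=; case: ifP => _; last by rewrite normr0.
  by rewrite !normrM mulr_ile1 ?mulr_ge0 ?mulr_ile1 ?edge_noise_le1 ?norm_x_le1.
Qed.

(** For two paths [i j k] and [i l k] with [j != l], the edge [i j] occurs only once in the product,
    because [i != k]. *)
Lemma expect_noise_sqr_entry i k : i != k ->
  E (fun a => (\sum_j h a i j * h a j k) ^+ 2) <= n%:R.
Proof.
move=> ik; rewrite -[X in _ <= X%:R]card_ord; apply: bernoulli_expect_sqr_sum.
- exact: edge_prob01.
- move=> j l jl.
  have [->|ij] := eqVneq i j.
    under eq_bernoulli_expect do rewrite edge_noise_diag !mul0r.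
    by rewrite bernoulli_expect_cst//; exact: edge_prob01.
  have [->|il] := eqVneq i l.
    under eq_bernoulli_expect do rewrite edge_noise_diag mul0r mulr0.
    by rewrite bernoulli_expect_cst//; exact: edge_prob01.
  under eq_bernoulli_expect do rewrite -mulrA.
  apply: edge_noise_center => a b.
  rewrite !edge_noise_update// /other_edge ?[k == i]eq_sym ?[l == i]eq_sym
    ?[j == i]eq_sym ?[l == j]eq_sym ?(negbTE ik) ?(negbTE ij) ?(negbTE il)
    ?(negbTE jl) ?andbF//=.
- by move=> j a; rewrite normrM mulr_ile1 ?edge_noise_le1.
Qed.

(** The terms are paths [i j k] with [k != i]; a closed path [i j i] would contribute a square,
    which is not centered. Of two distinct paths, the last edge [j k] occurs once if they share [j],
    and otherwise the first edge [i j] does. *)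
Lemma expect_noise_sqr_offdiag i :
  E (fun a => (\sum_(k | k != i) (\sum_j h a i j * h a j k) * x k) ^+ 2)
  <= n%:R ^+ 2.
Proof.
pose f (e : pair_n) a : R :=
  if e.2 == i then 0 else h a i e.1 * h a e.1 e.2 * x e.2.
have fE a : \sum_(k | k != i) (\sum_j h a i j * h a j k) * x k = \sum_e f e a.
  have -> : \sum_e f e a = \sum_j \sum_k f (j, k) a.
    by rewrite pair_bigA; apply: eq_bigr => -[].
  rewrite exchange_big/= big_mkcond; apply: eq_bigr => k _.
  rewrite /f/=; case: eqP => _ /=; first by rewrite big1.
  by rewrite mulr_suml.
under eq_bernoulli_expect do rewrite fE.
have -> : n%:R ^+ 2 = #|{: pair_n}|%:R :> R.
  by rewrite card_prod !card_ord natrM expr2.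
apply: bernoulli_expect_sqr_sum; first exact: edge_prob01.
- move=> [j k] [j' k'] ne; rewrite /f/=.
  have [ki|ki] := eqVneq k i.
    under eq_bernoulli_expect do rewrite mul0r.
    by rewrite bernoulli_expect_cst//; exact: edge_prob01.
  have [ki'|ki'] := eqVneq k' i.
    under eq_bernoulli_expect do rewrite mulr0.
    by rewrite bernoulli_expect_cst//; exact: edge_prob01.
  have [ij|ij] := eqVneq i j.
    under eq_bernoulli_expect do rewrite -ij edge_noise_diag !mul0r.
    by rewrite bernoulli_expect_cst//; exact: edge_prob01.
  have [ij'|ij'] := eqVneq i j'.
    under eq_bernoulli_expect do rewrite -ij' edge_noise_diag !mul0r mulr0.
    by rewrite bernoulli_expect_cst//; exact: edge_prob01.
  have [jj'|jj'] := eqVneq j j'.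
    rewrite -jj'; have kk' : k != k' by move: ne; rewrite jj' xpair_eqE eqxx.
    transitivity (E (fun a => h a j k * (h a i j * h a i j * h a j k' * (x k * x k')))).
      by apply: eq_bernoulli_expect => a; ring.
    apply: edge_noise_center3; rewrite /other_edge.
    + by rewrite (negbTE ij)/= [i == k]eq_sym (negbTE ki).
    + by rewrite (negbTE ij)/= [i == k]eq_sym (negbTE ki).
    + rewrite eqxx/= [k' == k]eq_sym (negbTE kk')/=.
      by apply/negP => /andP[/eqP jk /eqP kj]; move: kk'; rewrite -jk kj eqxx.
  transitivity (E (fun a => h a i j * (h a j k * h a i j' * h a j' k' * (x k * x k')))).
    by apply: eq_bernoulli_expect => a; ring.
  apply: edge_noise_center3; rewrite /other_edge.
  + by rewrite (negbTE ki) andbF orbF [j == i]eq_sym (negbTE ij).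
  + by rewrite eqxx/= [j' == j]eq_sym (negbTE jj')/= (negbTE ij).
  + by rewrite (negbTE ki') andbF orbF [j' == i]eq_sym (negbTE ij').
- move=> [j k] a; rewrite /f/=; case: ifP => _; first by rewrite normr0.
  by rewrite !normrM !mulr_ile1 ?mulr_ge0 ?mulr_ile1 ?edge_noise_le1 ?norm_x_le1.
Qed.

(** The [n] diagonal entries of the squared noise are not centered, but are at most [n] each; the
    off-diagonal ones have second moment at most [n]. Both groups contribute [n^3]. *)
Lemma expect_noise_sqr_frobenius :
  E (fun a => \sum_i \sum_k (\sum_j h a i j * h a j k) ^+ 2) <= 2 * n%:R ^+ 3.
Proof.
rewrite bernoulli_expect_sum.
have row i : E (fun a => \sum_k (\sum_j h a i j * h a j k) ^+ 2) <= 2 * n%:R ^+ 2.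
  rewrite bernoulli_expect_sum (bigD1 i)//= mulr_natl mulr2n lerD//.
    apply: le_trans (ler_norm _) _; apply: norm_bernoulli_expect_le.
      exact: edge_prob01.
    move=> a; rewrite normrX lerXn2r ?nnegrE//.
    rewrite (le_trans (ler_norm_sum _ _ _))// -[X in _ <= X%:R]card_ord -sum1_card natr_sum.
    by apply: ler_sum => j _; rewrite normrM mulr_ile1 ?edge_noise_le1.
  apply: (@le_trans _ _ (\sum_(k | k != i) n%:R)).
    by apply: ler_sum => k ki; apply: expect_noise_sqr_entry; rewrite eq_sym.
  have -> : n%:R ^+ 2 = \sum_(k < n) n%:R :> R.
    by rewrite expr2 sumr_const card_ord mulr_natr.
  by rewrite [leRHS](bigD1 i)//= lerDr.
apply: le_trans (ler_sum _ (fun i _ => row i)) _.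
by rewrite sumr_const card_ord -[leLHS]mulr_natr [in leRHS](exprSr _ 2) mulrA.
Qed.

End EdgeNoise.

(** * Lindeberg replacement *)

Section Lindeberg.
Context (R : realType).
Local Notation gauss := (@normal_prob R 0 1).

Lemma gauss_moment3_ge0 : 0 <= gauss_moment3 R.
Proof. by apply: Rintegral_ge0 => z _; rewrite exprn_ge0. Qed.

Lemma bounded_measurable_gauss_smooth (g : R -> R) (s : R) :
  bounded_measurable g -> (forall y, 0 <= g y) ->
  bounded_measurable (gauss_smooth g s).
Proof.
move=> bg g0; have [mg [M gM]] := bg; split.
  apply/measurable_EFinP.
  rewrite (_ : EFin \o _ = fun y => \int[gauss]_z (g (y + s * z)%R)%:E)%E; last first.
    by apply/funext => y /=; rewrite EFin_expect//; exact: bounded_measurable_affine.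
  apply: (@measurable_fun_fubini_tonelli_F _ _ _ _ _ gauss
    (fun q : R * R => (g (q.1 + s * q.2))%:E)).
    apply/measurable_EFinP/measurableT_comp => //.
    apply: (eq_measurable_fun (fun q : R * R => 1 * q.1 + s * q.2 + 0)).
      by move=> q _; rewrite mul1r addr0.
    exact: measurable_affine2.
  by move=> q; rewrite lee_fin.
by exists M => y; apply: norm_expect_le => //; exact: bounded_measurable_affine.
Qed.

(** The expansion holds with the same constant at every base point [y + s z], and is integrated in
    [z]. *)
Lemma taylor3_gauss_smooth (g a b : R -> R) (K s : R) : bounded_measurable g ->
  bounded_measurable a -> bounded_measurable b -> taylor3 g a b K ->
  taylor3 (gauss_smooth g s) (gauss_smooth a s) (gauss_smooth b s) K.
Proof.
move=> bg ba bb T y h.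
have bG c := bounded_measurable_affine s c bg.
have bA := bounded_measurable_affine s y ba.
have bB := bounded_measurable_affine s y bb.
have bc c := @bounded_measurable_cst _ R R c.
have -> : gauss_smooth g s (y + h) - gauss_smooth g s y -
    gauss_smooth a s y * h - gauss_smooth b s y * (h ^+ 2 / 2) =
    \int[gauss]_z (g (y + h + s * z) - g (y + s * z) -
      h * a (y + s * z) - h ^+ 2 / 2 * b (y + s * z)).
  have b1 := bounded_measurableB (bG (y + h)) (bG y).
  have b2 := bounded_measurableM (bc h) bA.
  have b3 := bounded_measurableM (bc (h ^+ 2 / 2)) bB.
  rewrite (expectB gauss (bounded_measurableB b1 b2) b3) (expectB gauss b1 b2).
  rewrite (expectB gauss (bG _) (bG _)) !expectZ// /gauss_smooth.
  by rewrite ![_ * h]mulrC [_ * (h ^+ 2 / 2)]mulrC.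
apply: norm_expect_le.
  apply: bounded_measurableB; last exact: (bounded_measurableM (bc _) bB).
  apply: bounded_measurableB; last exact: (bounded_measurableM (bc _) bA).
  exact: bounded_measurableB (bG _) (bG _).
move=> z; have := T (y + s * z) h.
rewrite (addrAC y); apply: le_trans; rewrite le_eqVlt; apply/orP; left; apply/eqP.
by congr `|_|; ring.
Qed.

(** The linear term integrates to zero and the quadratic one to [s^2 / 2], by the first two Gaussian
    moments. *)
Lemma taylor3_gauss (g a b : R -> R) (K s y : R) : 0 <= s ->
  bounded_measurable g -> taylor3 g a b K ->
  `|\int[gauss]_z g (y + s * z) - g y - b y * (s ^+ 2 / 2)| <=
  K * s ^+ 3 * gauss_moment3 R.
Proof.
move=> s0 bg T.
have bG := bounded_measurable_affine s y bg.
have iG := bounded_measurable_integrable gauss bG.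
have ic := bounded_measurable_integrable gauss (@bounded_measurable_cst _ R R (g y)).
have iz := integrableZl measurableT (a y * s) (@gauss_integrable_id R).
have iz2 := integrableZl measurableT (b y * (s ^+ 2 / 2)) (@gauss_integrable_sqr R).
have i1 := integrableB measurableT iG ic.
have i2 := integrableB measurableT i1 iz.
have i3 := integrableB measurableT i2 iz2.
have -> : \int[gauss]_z g (y + s * z) - g y - b y * (s ^+ 2 / 2) =
  \int[gauss]_z (g (y + s * z) - g y - a y * s * z - b y * (s ^+ 2 / 2) * z ^+ 2).
  rewrite (RintegralB measurableT i2 iz2) (RintegralB measurableT i1 iz).
  rewrite (RintegralB measurableT iG ic) expect_cst.
  rewrite (RintegralZl _ measurableT (@gauss_integrable_id R)).
  rewrite (RintegralZl _ measurableT (@gauss_integrable_sqr R)).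
  by rewrite gauss_expect_id gauss_expect_sqr mulr0 subr0 mulr1.
apply: le_trans (le_normr_Rintegral measurableT i3) _.
rewrite /gauss_moment3 -RintegralZl//; last exact: gauss_integrableX.
apply: le_Rintegral => //.
- exact: integrable_norm.
- exact: (integrableZl measurableT _ (gauss_integrableX R 3)).
move=> z _; have := T y (s * z).
rewrite normrM (ger0_norm s0).
rewrite [X in _ <= X -> _](_ : _ = K * s ^+ 3 * `|z| ^+ 3); last by ring.
apply: le_trans; rewrite le_eqVlt; apply/orP; left; apply/eqP; congr `|_|; ring.
Qed.

(* One Lindeberg replacement: a centered two-valued step against a Gaussian
   step of the same variance. *)
Lemma bernoulli_gauss_step (g a b : R -> R) (K p c y : R) : 0 <= p <= 1 ->
  0 <= K -> bounded_measurable g -> taylor3 g a b K ->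
  `|p * g (y + c * (1 - p)) + (1 - p) * g (y + c * (0 - p)) -
    \int[gauss]_z g (y + Num.sqrt (c ^+ 2 * (p * (1 - p))) * z)| <=
  K * (1 + gauss_moment3 R) * `|c| ^+ 3.
Proof.
move=> /andP[p0 p1] K0 bg T; set v := c ^+ 2 * _; set s := Num.sqrt v.
have v0 : 0 <= v by rewrite /v mulr_ge0 ?sqr_ge0// mulr_ge0 ?subr_ge0.
have s0 : 0 <= s by exact: sqrtr_ge0.
have s2 : s ^+ 2 = v by rewrite sqr_sqrtr.
have sc : s <= `|c|.
  rewrite -sqrtr_sqr ler_sqrt ?sqr_ge0// /v -[leRHS]mulr1 ler_wpM2l ?sqr_ge0//; nra.
have m0 := gauss_moment3_ge0.
have G := taylor3_gauss y s0 bg T.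
have T1 := T y (c * (1 - p)); have T2 := T y (c * (0 - p)).
set t1 := g (y + c * (1 - p)) in T1 *; set t2 := g (y + c * (0 - p)) in T2 *.
set I := Rintegral _ _ _ in G *.
have c30 : 0 <= `|c| ^+ 3 by rewrite exprn_ge0.
have n1 : `|c * (1 - p)| ^+ 3 <= `|c| ^+ 3.
  rewrite lerXn2r ?nnegrE// normrM ler_piMr// ger0_norm; lra.
have n2 : `|c * (0 - p)| ^+ 3 <= `|c| ^+ 3.
  by rewrite lerXn2r ?nnegrE// normrM ler_piMr// sub0r normrN ger0_norm.
have Gb : K * s ^+ 3 * gauss_moment3 R <= K * `|c| ^+ 3 * gauss_moment3 R.
  by rewrite ler_wpM2r// ler_wpM2l// lerXn2r ?nnegrE.
rewrite s2 in G.
have -> : p * t1 + (1 - p) * t2 - I =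
  p * (t1 - g y - a y * (c * (1 - p)) - b y * ((c * (1 - p)) ^+ 2 / 2)) +
  (1 - p) * (t2 - g y - a y * (c * (0 - p)) - b y * ((c * (0 - p)) ^+ 2 / 2)) -
  (I - g y - b y * (v / 2)) by rewrite /v; field.
apply: le_trans (ler_normB _ _) _; apply: (@le_trans _ _
  (p * (K * `|c| ^+ 3) + (1 - p) * (K * `|c| ^+ 3) + K * `|c| ^+ 3 * gauss_moment3 R)).
  rewrite lerD ?(le_trans G)//.
  apply: le_trans (ler_normD _ _) _.
  rewrite !normrM (ger0_norm p0) (@ger0_norm _ (1 - p)) ?subr_ge0//.
  rewrite lerD// ler_wpM2l ?subr_ge0//.
    by rewrite (le_trans T1)// ler_wpM2l.
  by rewrite (le_trans T2)// ler_wpM2l.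
by rewrite le_eqVlt; apply/orP; left; apply/eqP; ring.
Qed.

(** The terms of the row are replaced one at a time by Gaussian steps of the same variance, each at
    the cost [K (1 + gauss_moment3 R) |c j|^3]. *)
Lemma lindeberg_row (n : nat) (x : 'I_n -> R) (i : 'I_n) (c : 'I_n -> R)
    (g a b : R -> R) (K : R) : (forall j, 0 <= x j <= 1) -> 0 <= K ->
  continuous g -> (forall y, 0 <= g y) ->
  bounded_measurable g -> bounded_measurable a -> bounded_measurable b ->
  taylor3 g a b K ->
  `|bernoulli_expect (edge_prob x)
      (fun e => g (\sum_(j | j != i) c j * edge_noise x e i j)) -
    gauss_smooth g (Num.sqrt
      (\sum_(j | j != i) c j ^+ 2 * (x i * x j * (1 - x i * x j)))) 0| <=
  K * (1 + gauss_moment3 R) * \sum_(j | j != i) `|c j| ^+ 3.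
Proof.
move=> x01 K0 cg g0 bg ba bb T.
pose v j := c j ^+ 2 * (x i * x j * (1 - x i * x j)).
have xx j : 0 <= x i * x j <= 1.
  have /andP[a0 a1] := x01 i; have /andP[b0 b1] := x01 j.
  by rewrite mulr_ge0// mulr_ile1.
have v0 j : 0 <= v j.
  by have /andP[h0 h1] := xx j; rewrite /v mulr_ge0 ?sqr_ge0// mulr_ge0 ?subr_ge0.
(* Induction on the list [s] of terms still to be replaced; [u] is the variance already accumulated
   in Gaussian form and [y] a fixed offset. *)
suff gen (s : seq 'I_n) u y : 0 <= u -> uniq s -> i \notin s ->
  `|bernoulli_expect (edge_prob x)
      (fun e => gauss_smooth g (Num.sqrt u) (y + \sum_(j <- s) c j * edge_noise x e i j)) -
    gauss_smooth g (Num.sqrt (u + \sum_(j <- s) v j)) y| <=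
  K * (1 + gauss_moment3 R) * \sum_(j <- s) `|c j| ^+ 3.
  have := gen [seq j <- index_enum 'I_n | j != i] 0 0 (lexx 0).
  rewrite filter_uniq ?index_enum_uniq// mem_filter eqxx => /(_ isT isT).
  rewrite !big_filter add0r sqrtr0; apply: le_trans.
  rewrite le_eqVlt; apply/orP; left; apply/eqP; congr `|_ - _|.
  by apply: eq_bernoulli_expect => e; rewrite gauss_smooth0 add0r big_filter.
elim: s u y => [|j s IH] u y u0 /=.
  move=> _ _; rewrite !big_nil addr0 mulr0.
  rewrite (eq_bernoulli_expect _ (psi := fun=> gauss_smooth g (Num.sqrt u) y)).
    by rewrite bernoulli_expect_cst subrr normr0.
  by move=> e; rewrite big_nil addr0.
move=> /andP[js us]; rewrite inE negb_or => /andP[ij is_].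
rewrite !big_cons.
have G1 := IH (u + v j) y (addr_ge0 u0 (v0 j)) us is_.
rewrite -addrA in G1; rewrite mulrDr.
set A := bernoulli_expect _ _; set B := gauss_smooth g _ y in G1 *.
set A' := bernoulli_expect _ _ in G1.
rewrite (_ : A - B = (A - A') + (A' - B)); last by ring.
apply: le_trans (ler_normD _ _) _; rewrite lerD//.
rewrite /A /A' (bernoulli_expect_coord _ (edge i j)) -bernoulli_expectB.
apply: norm_bernoulli_expect_le => [|e]; first exact: edge_prob01.
rewrite !big_cons edge_prob_edge// /edge_noise (negbTE ij) !ffunE eqxx /=.
(* The edge [i j] occurs in no later term, since neither [i] nor [j] belongs to [s]; averaging over
   it leaves the rest of the sum unchanged. *)
have inv bo : \sum_(k <- s) c k * (if i == k then 0 else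
      (ffun_update e (edge i j) bo (edge i k))%:R - x i * x k) =
    \sum_(k <- s) c k * (if i == k then 0 else (e (edge i k))%:R - x i * x k).
  apply: eq_big_seq => k ks; congr (_ * _); case: eqP => // /eqP ik.
  rewrite ffunE; case: eqP => // /edge_inj /orP[] /andP[/eqP h1 /eqP h2].
    by move: js; rewrite h2 ks.
  by move: ij; rewrite h2 eqxx.
rewrite !inv; set S := \sum_(k <- s) _.
have -> w : y + (c j * w + S) = y + S + c j * w by ring.
have -> w : y + (c j * w + S) = y + S + c j * w by ring.
have u2 : Num.sqrt u ^+ 2 = u by rewrite sqr_sqrtr.
have v2 : Num.sqrt (v j) ^+ 2 = v j by rewrite sqr_sqrtr.
(* Splits the smoothing of variance [u + v j] into one of variance [u], kept inside the test
   function, and the single Gaussian step to be compared with the edge. *)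
have := gauss_smooth_comp (y + S) (sqrtr_ge0 (v j)) (sqrtr_ge0 u) cg bg g0.
rewrite u2 v2 [v j + u]addrC => <-.
apply: bernoulli_gauss_step => //.
- exact: bounded_measurable_gauss_smooth.
- exact: (taylor3_gauss_smooth _ bg ba bb T).
Qed.

End Lindeberg.

(** * Perturbation of the leading eigenvector *)

Section EuclideanNorm.
Context (R : realType) (n : nat).
Implicit Types (u v w : 'cV[R]_n) (M : 'M[R]_n).

Definition dot u v : R := (u^T *m v) 0 0.
Definition l2norm u : R := Num.sqrt (dot u u).

Lemma dotE u v : dot u v = \sum_i u i 0 * v i 0.
Proof. by rewrite /dot mxE; apply: eq_bigr => i _; rewrite mxE. Qed.

Lemma dotC u v : dot u v = dot v u.
Proof. by rewrite !dotE; apply: eq_bigr => i _; rewrite mulrC. Qed.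

Lemma dotDr u v w : dot u (v + w) = dot u v + dot u w.
Proof. by rewrite /dot mulmxDr mxE. Qed.

Lemma dotDl u v w : dot (v + w) u = dot v u + dot w u.
Proof. by rewrite dotC dotDr !(dotC u). Qed.

Lemma dotZr u (c : R) v : dot u (c *: v) = c * dot u v.
Proof. by rewrite /dot -scalemxAr mxE. Qed.

Lemma dotZl u (c : R) v : dot (c *: v) u = c * dot v u.
Proof. by rewrite dotC dotZr dotC. Qed.

Lemma dot_ge0 u : 0 <= dot u u.
Proof. by rewrite dotE sumr_ge0// => i _; rewrite -expr2 sqr_ge0. Qed.

Lemma dot_eq0 u : dot u u = 0 -> u = 0.
Proof.
move/eqP; rewrite dotE psumr_eq0 => [/allP h|i _]; last by rewrite -expr2 sqr_ge0.
apply/matrixP => i j; rewrite ord1 mxE.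
have /implyP/(_ isT) := h i (mem_index_enum _).
by rewrite mulf_eq0 orbb => /eqP.
Qed.

Lemma dot_mulmxC M u v : dot u (M *m v) = dot (M^T *m u) v.
Proof. by rewrite /dot trmx_mul trmxK mulmxA. Qed.

Lemma discriminant_le0 (a b c : R) : (forall t, 0 <= a + 2 * b * t + c * t ^+ 2) ->
  b ^+ 2 <= a * c.
Proof.
move=> h; have [c0|c0|c0] := ltgtP c 0.
(* At this point, which is at least 1, the negative quadratic term outweighs [|a| + 2 |b| T]. *)
- have := h ((`|a| + 2 * `|b| + 1) / (- c) + 1).
  set T := _ / _ + 1.
  have Tc : - c * T = `|a| + 2 * `|b| + 1 - c by rewrite /T; field; lra.
  have T1 : 1 <= T by rewrite /T lerDr divr_ge0 ?addr_ge0 ?mulr_ge0//; lra.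
  have ha := ler_norm a; have hb := ler_norm b.
  have na := normr_ge0 a; have nb := normr_ge0 b.
  have : b * T <= `|b| * T by rewrite ler_wpM2r//; lra.
  nra.
- have := h (- b / c).
  have -> : a + 2 * b * (- b / c) + c * (- b / c) ^+ 2 = (a * c - b ^+ 2) / c.
    by field; lra.
  by rewrite pmulr_lge0 ?invr_gt0// subr_ge0.
- rewrite c0 mulr0; have [->|b0] := eqVneq b 0; first by rewrite expr0n.
  have := h (- (a + 1) / (2 * b)); rewrite c0 mul0r addr0.
  have -> : a + 2 * b * (- (a + 1) / (2 * b)) = -1 by field.
  lra.
Qed.

(* For a positive semidefinite [M]. *)
Lemma cauchy_schwarz_psd M u v : M^T = M -> (forall w, 0 <= dot w (M *m w)) ->
  dot u (M *m v) ^+ 2 <= dot u (M *m u) * dot v (M *m v).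
Proof.
move=> sM psd; apply: discriminant_le0 => t.
have := psd (u + t *: v).
rewrite mulmxDr -scalemxAr !dotDr !dotDl !dotZr !dotZl.
by rewrite [dot v (M *m u)]dot_mulmxC sM (dotC (M *m v)); congr (_ <= _); ring.
Qed.

Lemma cauchy_schwarz u v : dot u v ^+ 2 <= dot u u * dot v v.
Proof.
have := @cauchy_schwarz_psd 1%:M u v (trmx1 _ _).
by rewrite !mul1mx; apply => w; rewrite mul1mx dot_ge0.
Qed.

Lemma l2norm_ge0 u : 0 <= l2norm u. Proof. exact: sqrtr_ge0. Qed.

Lemma sqr_l2norm u : l2norm u ^+ 2 = dot u u.
Proof. by rewrite sqr_sqrtr ?dot_ge0. Qed.

Lemma norm_dot u v : `|dot u v| <= l2norm u * l2norm v.
Proof.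
by rewrite -sqrtr_sqr -sqrtrM ?dot_ge0// ler_sqrt ?mulr_ge0 ?dot_ge0// cauchy_schwarz.
Qed.

Lemma l2normZ (c : R) u : l2norm (c *: u) = `|c| * l2norm u.
Proof. by rewrite /l2norm dotZl dotZr mulrA -expr2 sqrtrM ?sqr_ge0// sqrtr_sqr. Qed.

Lemma l2normD u v : l2norm (u + v) <= l2norm u + l2norm v.
Proof.
rewrite -ler_sqr ?nnegrE ?addr_ge0 ?l2norm_ge0// sqrrD !sqr_l2norm.
rewrite !dotDr !dotDl (dotC v u).
have := norm_dot u v; have := ler_norm (dot u v); lra.
Qed.

Lemma l2norm_mulmx_frobenius M u :
  dot (M *m u) (M *m u) <= (\sum_i \sum_j M i j ^+ 2) * dot u u.
Proof.
rewrite [leLHS]dotE mulr_suml; apply: ler_sum => i _.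
have -> : (M *m u) i 0 = dot (row i M)^T u.
  by rewrite dotE mxE; apply: eq_bigr => j _; rewrite !mxE.
rewrite -expr2; apply: le_trans (cauchy_schwarz _ _) _.
by rewrite ler_wpM2r ?dot_ge0// dotE; under eq_bigr do rewrite !mxE -expr2.
Qed.

(** Crude, from [2 <u, M u> <= |u|^2 + |M u|^2]; it serves where some finite bound on the quadratic
    form is enough. *)
Lemma dot_mulmx_le M u : dot u (M *m u) <= (1 + \sum_i \sum_j M i j ^+ 2) * dot u u.
Proof.
have := l2norm_mulmx_frobenius M u; set F := \sum_i _ => h.
have := dot_ge0 (u + (-1) *: (M *m u)).
rewrite !dotDr !dotDl !dotZr !dotZl (dotC (M *m u) u).
have F0 : 0 <= F by rewrite sumr_ge0// => i _; rewrite sumr_ge0// => j _; rewrite sqr_ge0.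
have := dot_ge0 u; have := mulr_ge0 F0 (dot_ge0 u); lra.
Qed.

Lemma nonunit_eigenvalue M (a : R) : a%:M - M \notin unitmx -> eigenvalue M a.
Proof.
move=> nu; rewrite /eigenvalue /eigenspace kermx_eq0 row_free_unit.
have -> : M - a%:M = (-1) *: (a%:M - M) by rewrite scaleN1r opprB.
by rewrite unitmxZ ?unitrN1.
Qed.

(* The supremum of the quadratic form on the unit sphere is an eigenvalue:
   otherwise the positive semidefinite matrix [mu - M] would be invertible,
   hence bounded below, and the supremum could be lowered. *)
Lemma rayleigh_le M (l : R) u : M^T = M -> largest_eigenvalue M l ->
  dot u (M *m u) <= l * dot u u.
Proof.
move=> sM [_ lmax].
have [u0|u0] := eqVneq (dot u u) 0.
  by rewrite (dot_eq0 u0) mulmx0 /dot !mulmx0 mxE mulr0.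
pose S := [set r | exists2 v, dot v v = 1 & r = dot v (M *m v)].
have scaled v : dot v v != 0 -> exists2 w, dot w w = 1 &
    dot v (M *m v) = dot v v * dot w (M *m w).
  move=> v0; pose c := (l2norm v)^-1.
  have c2 : c ^+ 2 * dot v v = 1 by rewrite exprVn sqr_l2norm mulVf.
  exists (c *: v); first by rewrite dotZl dotZr mulrA -expr2.
  rewrite -scalemxAr dotZl dotZr.
  move: (dot v (M *m v)) (dot v v) c c2 => D N c c2.
  by rewrite -[LHS]mul1r -c2; ring.
have S0 : S !=set0.
  by have [w w1 _] := scaled u u0; exists (dot w (M *m w)); exists w.
have Sub : has_ubound S.
  exists (1 + \sum_i \sum_j M i j ^+ 2) => _ [v v1 ->].
  by have := dot_mulmx_le M v; rewrite v1 mulr1.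
have supS : has_sup S by [].
pose mu := sup S; pose B := mu%:M - M.
have BE v : dot v (B *m v) = mu * dot v v - dot v (M *m v).
  rewrite mulmxBl mul_scalar_mx dotDr dotZr; congr (_ + _).
  by rewrite -scaleN1r dotZr mulN1r.
have psd v : 0 <= dot v (B *m v).
  rewrite BE; have [v0|v0] := eqVneq (dot v v) 0.
    by rewrite (dot_eq0 v0) mulmx0 /dot !mulmx0 mxE mulr0 subr0.
  have [w w1 ->] := scaled v v0; rewrite mulrC -mulrBr mulr_ge0 ?dot_ge0// subr_ge0.
  by apply: ub_le_sup => //; exists w.
have sB : B^T = B by rewrite linearB/= tr_scalar_mx sM.
have eig : eigenvalue M mu.
  apply: nonunit_eigenvalue; apply/negP; rewrite -/B => uB.
  pose F (N : 'M[R]_n) : R := 1 + \sum_i \sum_j N i j ^+ 2.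
  have F1 N : 1 <= F N.
    by rewrite lerDl sumr_ge0// => i _; rewrite sumr_ge0// => j _; rewrite sqr_ge0.
  (* An invertible positive semidefinite [B] is bounded below: [|v|^2] is at most a multiple of
     [|B v|^2] by invertibility, and [|B v|^2] a multiple of [<v, B v>] by Cauchy-Schwarz for the
     form of [B]. *)
  have low v : dot v v <= F (invmx B) * F B * dot v (B *m v).
    set w := B *m v; have vE : v = invmx B *m w by rewrite mulmxA mulVmx// mul1mx.
    have h1 : dot v v <= F (invmx B) * dot w w.
      rewrite [in leLHS]vE; apply: le_trans (l2norm_mulmx_frobenius _ _) _.
      by rewrite ler_wpM2r ?dot_ge0// lerDr.
    have h2 : dot w w <= F B * dot v w.
      have := cauchy_schwarz_psd v w sB psd.
      rewrite dot_mulmxC sB -/w => h.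
      have h3 := dot_mulmx_le B w; rewrite -/(F B) in h3.
      have vw0 : 0 <= dot v w by exact: psd.
      have : dot w w ^+ 2 <= dot w w * (F B * dot v w).
        by apply: le_trans h _; have := ler_wpM2l vw0 h3; lra.
      have [->|w0] := eqVneq (dot w w) 0.
        by move=> _; rewrite mulr_ge0// (le_trans ler01)//.
      by rewrite expr2 ler_pM2l// lt_neqAle eq_sym w0 dot_ge0.
    rewrite -mulrA; apply: le_trans h1 _; rewrite ler_wpM2l//.
    exact: le_trans (F1 _).
  pose C := F (invmx B) * F B.
  have C0 : 0 < C by rewrite mulr_gt0// (lt_le_trans ltr01).
  have : mu <= mu - C^-1.
    apply: ge_sup => // _ [v v1 ->].
    have := low v; rewrite BE v1 mulr1 -/C => hv.
    rewrite lerBrDr -lerBrDl -(ler_pM2l C0) mulfV ?gt_eqF//; lra.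
  by rewrite lerDl oppr_ge0 leNgt invr_gt0 C0.
apply: (@le_trans _ _ (mu * dot u u)).
  by have := psd u; rewrite BE subr_ge0.
by rewrite ler_wpM2r ?dot_ge0// lmax.
Qed.

End EuclideanNorm.

Lemma sqr_le_self (R : realType) (a b : R) :
  0 <= a -> 1 <= b -> a ^+ 2 <= b -> a <= b.
Proof. by move=> a0 b1 ab; have [//|ba] := leP a b; nra. Qed.

(** In the expansion of [xh_i], [c] bounds [N / l] and [s], [B] bounds the norm of [Y], and
    [C1 c^2 / N] bounds [|s - 1|]. The five summands are the coefficients of [k], [e] and [1 / r] in
    the bounds [T1], [T2] and [T3] below. *)
Definition remainder_const (R : realType) (d K : R) : R :=
  let c := 4 / d in let B := 2 * c ^+ 2 * K in
  let C1 := c * K + 2 * c * B * K + B ^+ 2 in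
  C1 * c ^+ 2 + c ^+ 3 * K + B * c ^+ 2 + K * c * (C1 * c ^+ 2) + K * c ^+ 2.

(** * Scalar inequalities behind the eigenvector expansion *)

Section ExpansionArithmetic.
Context (R : realType).
(** Dictionary: [N] is the number of vertices and [r] its square root, [L = <x, x>], [l] the largest
    eigenvalue, [xh = s x + Y] the estimate, [m] the norm of [Y]; [k * N] bounds the operator norm
    of [H] and [e * N] bounds [|L - d * N|]. Further down, [q1], [q2], [q3] are the values of the
    form of [H] at [(x, x)], [(Y, x)], [(Y, Y)], and [a], [b], [g] are the entries [i] of [H x],
    [H^2 x], [H^2 Y]. *)
Variables (d K k e N L l s m : R).
Hypotheses (d0 : 0 < d) (d1 : d <= 1) (K1 : 1 <= K) (k0 : 0 <= k)
  (kd : k <= d / 8) (N0 : 0 < N) (lb : d * N / 2 <= L) (ub : L <= N)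
  (l_lb : L - k * N <= l) (s0 : 0 <= s) (s2l : s ^+ 2 * l <= L) (m0 : 0 <= m)
  (lm : l * m <= s * (K * N) + k * N * m).
Let c := 4 / d.
Let B := 2 * c ^+ 2 * K.
Let C1 := c * K + 2 * c * B * K + B ^+ 2.

Let K0 : 0 < K. Proof. by move: K1; lra. Qed.

Let c4 : 4 <= c. Proof. by rewrite /c ler_pdivlMr//; move: d1; lra. Qed.

Let c0 : 0 < c. Proof. by move: c4; lra. Qed.

Let cd : c * d = 4. Proof. by rewrite /c divfK// gt_eqF. Qed.

Let kN : k * N <= d * N / 8.
Proof. by rewrite mulrAC ler_wpM2r// ltW. Qed.

Let dN0 : 0 < d * N. Proof. by rewrite mulr_gt0. Qed.

Let l4 : d * N / 4 <= l. Proof. by move: kN lb l_lb dN0; lra. Qed.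

Let l0 : 0 < l. Proof. by move: l4 dN0; lra. Qed.

Let Ncl : N <= c * l.
Proof.
rewrite -(ler_pM2l d0) (_ : d * (c * l) = c * d * l); last by ring.
by rewrite cd; move: l4; lra.
Qed.

Let s2c : s ^+ 2 <= c.
Proof. by rewrite -(ler_pM2r l0); move: s2l ub Ncl; lra. Qed.

Let sc : s <= c.
Proof. by apply: sqr_le_self => //; move: c4; lra. Qed.

Let B0 : 0 <= B.
Proof. by rewrite /B mulr_ge0 ?(ltW K0)// mulr_ge0 ?exprn_ge0 ?(ltW c0). Qed.

Let KN0 : 0 <= K * N. Proof. by rewrite mulr_ge0 ?(ltW K0) ?(ltW N0). Qed.

(** In [lm] the term [k * N * m] is absorbed on the left, since [k * N] is at most half the lower
    bound [d * N / 4] of [l]. *)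
Let mB : m <= B.
Proof.
have h2 : d * N / 8 * m <= c * (K * N).
  have h3 : s * (K * N) <= c * (K * N) by rewrite ler_wpM2r.
  have h4 : (d * N / 8) * m <= (l - k * N) * m.
    by rewrite ler_wpM2r//; move: l4 kN; lra.
  by move: h3 h4 lm; lra.
rewrite -(ler_pM2l dN0) /B.
have -> : d * N * (2 * c ^+ 2 * K) = (c * d) * 2 * c * (K * N) by ring.
by rewrite cd; move: h2; lra.
Qed.

Variables (q1 q2 q3 : R).
Hypotheses (q1b : `|q1| <= K * N) (q2b : `|q2| <= m * (K * N))
  (q3b : `|q3| <= k * N * m ^+ 2)
  (qE : l ^+ 2 * (1 - s ^+ 2) = s ^+ 2 * q1 + 2 * (s * q2) + q3).

Let C10 : 0 <= C1.
Proof.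
have cK0 : 0 <= c * K by rewrite mulr_ge0// ltW.
rewrite /C1 addr_ge0 ?sqr_ge0// addr_ge0// mulr_ge0 ?(ltW K0)// mulr_ge0//.
by rewrite mulr_ge0// ltW.
Qed.

(** By [qE], [l^2 |1 - s^2|] is of order [N] while [l] is itself of order [N]; then
    [|1 - s| <= |1 - s^2|] because [s >= 0]. *)
Let s1 : `|s - 1| <= C1 * c ^+ 2 / N.
Proof.
have qb : `|s ^+ 2 * q1 + 2 * (s * q2) + q3| <= C1 * N.
  have h1 : `|s ^+ 2 * q1| <= c * (K * N).
    by rewrite normrM (ger0_norm (exprn_ge0 2 s0)) ler_pM ?exprn_ge0.
  have h2 : `|2 * (s * q2)| <= 2 * (c * (B * (K * N))).
    rewrite normrM ger0_norm// ler_wpM2l// normrM (ger0_norm s0) ler_pM//.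
    by rewrite (le_trans q2b)// ler_wpM2r.
  have h3 : `|q3| <= B ^+ 2 * N.
    rewrite (le_trans q3b)// [leRHS]mulrC ler_pM ?exprn_ge0//.
    - by rewrite mulr_ge0// ltW.
    - by rewrite ler_piMl ?(ltW N0)//; move: kd d1; lra.
    - by rewrite ler_sqr ?nnegrE.
  apply: le_trans (ler_normD _ _) _; apply: le_trans (lerD (ler_normD _ _) (lexx _)) _.
  by rewrite /C1; move: h1 h2 h3; lra.
have lc : N ^+ 2 <= c ^+ 2 * l ^+ 2.
  by rewrite -exprMn ler_sqr ?nnegrE ?(ltW N0)// ltW// mulr_gt0.
have h1 : `|1 - s ^+ 2| <= C1 * c ^+ 2 / N.
  rewrite ler_pdivlMr// -(ler_pM2r N0).
  have h : l ^+ 2 * `|1 - s ^+ 2| <= C1 * N.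
    by rewrite -[l ^+ 2]ger0_norm ?sqr_ge0// -normrM qE.
  have h1 := ler_wpM2l (normr_ge0 (1 - s ^+ 2)) lc.
  by have h2 := ler_wpM2l (sqr_ge0 c) h; move: h1 h2; lra.
apply: le_trans h1.
have -> : 1 - s ^+ 2 = (1 + s) * (1 - s) by ring.
by rewrite normrM (distrC 1) ler_peMl// ger0_norm; move: s0; lra.
Qed.

Variables (r a b g xi xhi : R).
Hypotheses (e0 : 0 <= e) (r1 : 1 <= r) (NE : N = r ^+ 2)
  (dl : `|L - d * N| <= e * N) (l_ub : l <= L + k * N)
  (xi1 : `|xi| <= 1) (aK : `|a| <= K * r) (bK : `|b| <= K * N)
  (gK : `|g| <= r * (k * N * m))
  (xhiE : xhi = s * xi + (s * a + (s * b + g) / l) / l).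

Let r0 : 0 < r. Proof. by move: r1; lra. Qed.

Let T1 : `|r * ((s - 1) * xi)| <= C1 * c ^+ 2 * r^-1.
Proof.
rewrite !normrM (gtr0_norm r0).
have -> : C1 * c ^+ 2 * r^-1 = r * (C1 * c ^+ 2 / N * 1).
  by rewrite NE; field; rewrite gt_eqF.
by rewrite ler_wpM2l ?(ltW r0)// ler_pM.
Qed.

Let s1r : `|s - 1| <= C1 * c ^+ 2 * r^-1.
Proof.
have Cc0 : 0 <= C1 * c ^+ 2 by rewrite mulr_ge0// exprn_ge0// ltW.
apply: le_trans s1 _; apply: ler_wpM2l => //; rewrite lef_pV2 ?posrE//.
by rewrite NE expr2 ler_peMr// ltW.
Qed.

(** The cost of replacing [s / l] by [1 / (d N)] in the linear term. The difference [d N s - l] is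
    split into the errors of [s], of [L] against [d N], and of [l] against [L]. *)
Let T2 : `|a * ((d * N * s - l) / (d * r * l))| <=
  K * c * (C1 * c ^+ 2 * r^-1) + K * c ^+ 2 * (e + k).
Proof.
have h1 : `|d * N * s - l| <= d * N * `|s - 1| + (e * N + k * N).
  have -> : d * N * s - l = d * N * (s - 1) - (L - d * N) - (l - L) by ring.
  apply: le_trans (ler_normB _ _) _; rewrite addrA lerD//; last first.
    by rewrite ler_norml; move: l_lb l_ub; lra.
  apply: le_trans (ler_normB _ _) _; rewrite lerD//.
  by rewrite normrM gtr0_norm.
have drl : 0 < d * r * l by rewrite !mulr_gt0.
rewrite normrM normrM normfV (gtr0_norm drl).
have h2 : `|a| * (`|d * N * s - l| / (d * r * l)) <=
    K * r * ((d * N * `|s - 1| + (e * N + k * N)) / (d * r * l)).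
  apply: ler_pM => //; first by rewrite divr_ge0// ltW.
  by rewrite ler_wpM2r// invr_ge0 ltW.
apply: le_trans h2 _.
have -> : K * r * ((d * N * `|s - 1| + (e * N + k * N)) / (d * r * l)) =
  K * (N / l) * `|s - 1| + K * (N / l) * (e + k) / d.
  by field; rewrite !gt_eqF.
have Nl : N / l <= c by rewrite ler_pdivrMr.
have Nl0 : 0 <= N / l by rewrite divr_ge0// ltW.
rewrite lerD//.
  apply: ler_pM => //; first by rewrite mulr_ge0// ltW.
  by rewrite ler_wpM2l// ltW.
have dc : d^-1 <= c by rewrite /c ler_peMl ?invr_ge0 ?(ltW d0)// (ler_nat _ 1 4).
have ql : N / l * d^-1 <= c ^+ 2.
  by rewrite expr2; apply: ler_pM => //; rewrite invr_ge0 ltW.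
have Ke : 0 <= K * (e + k) by rewrite mulr_ge0 ?addr_ge0// ltW.
by have := ler_wpM2l Ke ql; lra.
Qed.

Let T3 : `|r * ((s * b + g) / l ^+ 2)| <= c ^+ 3 * K * r^-1 + B * c ^+ 2 * k.
Proof.
have l20 : 0 < l ^+ 2 by rewrite exprn_gt0.
rewrite !normrM (gtr0_norm r0) normfV (gtr0_norm l20).
have sb : `|s * b + g| <= c * (K * N) + r * (k * N * B).
  apply: le_trans (ler_normD _ _) _; rewrite lerD//.
    by rewrite normrM ger0_norm// ler_pM.
  rewrite (le_trans gK)// ler_wpM2l ?(ltW r0)// ler_wpM2l// mulr_ge0// ltW//.
have h : `|s * b + g| / l ^+ 2 <= (c * (K * N) + r * (k * N * B)) * (c ^+ 2 / N ^+ 2).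
  apply: ler_pM => //; first by rewrite invr_ge0 ltW.
  rewrite ler_pdivlMr ?exprn_gt0// mulrC ler_pdivrMr//.
  by rewrite -exprMn ler_sqr ?nnegrE ?(ltW N0)// ltW// mulr_gt0.
apply: (@le_trans _ _ (r * ((c * (K * N) + r * (k * N * B)) * (c ^+ 2 / N ^+ 2)))).
  by rewrite ler_wpM2l ?(ltW r0).
by rewrite le_eqVlt; apply/orP; left; apply/eqP; rewrite NE; field; rewrite gt_eqF.
Qed.

(** Three errors add up: the factor [s] in front of [x_i], the coefficient of the linear term, and
    the second order terms divided by [l^2]. *)
Lemma expansion_arithmetic :
  `|r * (xhi - xi) - a / (d * r)| <= remainder_const d K * (k + e + r^-1).
Proof.
have -> : r * (xhi - xi) - a / (d * r) = r * ((s - 1) * xi) +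
  a * ((d * N * s - l) / (d * r * l)) + r * ((s * b + g) / l ^+ 2).
  by rewrite xhiE NE; field; rewrite !gt_eqF.
have ri0 : 0 <= r^-1 by rewrite invr_ge0 ltW.
have c2 : 0 <= c ^+ 2 by rewrite exprn_ge0// ltW.
have p1 : 0 <= C1 * c ^+ 2 by rewrite mulr_ge0.
have p2 : 0 <= c ^+ 3 * K by rewrite mulr_ge0 ?exprn_ge0// ltW.
have p3 : 0 <= B * c ^+ 2 by rewrite mulr_ge0.
have p4 : 0 <= K * c * (C1 * c ^+ 2) by rewrite mulr_ge0// mulr_ge0// ltW.
have p5 : 0 <= K * c ^+ 2 by rewrite mulr_ge0// ltW.
apply: le_trans (ler_normD _ _) _.
apply: le_trans (lerD (le_trans (ler_normD _ _) (lerD T1 T2)) T3) _.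
rewrite /remainder_const -/c -/B -/C1.
have -> : K * c * (C1 * c ^+ 2 * r^-1) = K * c * (C1 * c ^+ 2) * r^-1 by ring.
move: (C1 * c ^+ 2) (c ^+ 3 * K) (B * c ^+ 2) (K * c * (C1 * c ^+ 2))
  (K * c ^+ 2) (r^-1) p1 p2 p3 p4 p5 ri0 => D1 D2 D3 D4 D5 t p1 p2 p3 p4 p5 t0.
move: (mulr_ge0 p1 k0) (mulr_ge0 p1 e0) (mulr_ge0 p2 k0) (mulr_ge0 p2 e0).
move: (mulr_ge0 p3 t0) (mulr_ge0 p3 e0) (mulr_ge0 p4 k0) (mulr_ge0 p4 e0).
move: (mulr_ge0 p5 t0); lra.
Qed.

End ExpansionArithmetic.

(** * Expansion of one coordinate of the estimate *)

Section EstimateExpansion.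
Context (R : realType) (n : nat).
Implicit Types (u v w x xh : 'cV[R]_n) (A H : 'M[R]_n).

Lemma mulmx_outer x v : (x *m x^T) *m v = dot x v *: x.
Proof.
rewrite -mulmxA; apply/matrixP => i j; rewrite !ord1 !mxE big_ord1 mulrC.
by rewrite /dot mxE.
Qed.

(* With [t = <x, xh>], [s = t / l] and [Y = xh - s x], the eigenvector equation
   reads [l Y = H xh], and iterating it once gives the expansion
   [xh = s x + s H x / l + s H^2 x / l^2 + H^2 Y / l^2]. *)
Lemma estimate_expansion x A xh (d K k e r : R) (i : 'I_n) :
  let H := A - x *m x^T in let N := r ^+ 2 in
  A^T = A -> is_estimate x A xh -> `|x i 0| <= 1 ->
  0 < d <= 1 -> 1 <= K -> 0 <= k -> k <= d / 8 -> 0 <= e -> 1 <= r ->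
  d * N / 2 <= dot x x <= N -> `|dot x x - d * N| <= e * N ->
  l2norm (H *m x) <= K * N -> `|dot x (H *m x)| <= K * N ->
  `|(H *m (H *m x)) i 0| <= K * N -> `|(H *m x) i 0| <= K * r ->
  (forall v, l2norm (H *m v) <= k * N * l2norm v) ->
  (forall v, `|(H *m v) i 0| <= r * l2norm v) ->
  `|r * (xh i 0 - x i 0) - (H *m x) i 0 / (d * r)| <=
    remainder_const d K * (k + e + r^-1).
Proof.
move=> H N sA [l [V [lA AV V1 Vx xhE]]] xi /andP[d0 d1] K1 k0 kd e0 r1.
move=> /andP[lb ub] dl hHx hxHx hHHx hHx_i hop hrow.
have r0 : 0 < r by exact: lt_le_trans r1.
have N0 : 0 < N by rewrite exprn_gt0.
have dN0 : 0 < d * N by rewrite mulr_gt0.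
have L0 : 0 < dot x x by rewrite (lt_le_trans _ lb)// divr_gt0.
have AE v : A *m v = dot x v *: x + H *m v.
  by rewrite /H mulmxBl mulmx_outer addrC subrK.
have kN : k * N <= d * N / 8 by rewrite mulrAC ler_wpM2r// ltW.
have kN0 : 0 <= k * N by rewrite mulr_ge0// ltW.
have quad v : `|dot v (H *m v)| <= k * N * dot v v.
  apply: le_trans (norm_dot _ _) _; rewrite -sqr_l2norm expr2 mulrCA.
  by rewrite ler_wpM2l ?l2norm_ge0.
(* Rayleigh's bound at [x], where [<x, A x> = <x, x>^2 + <x, H x>]. *)
have l_lb : dot x x - k * N <= l.
  have := rayleigh_le x sA lA; rewrite AE dotDr dotZr => h.
  have := quad x; rewrite ler_norml => /andP[h1 _].
  by rewrite -(ler_pM2r L0); clear -h h1; lra.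
have V1' : dot V V = 1 by [].
(* [l = <V, A V>] is [<x, V>^2 + <V, H V>], and Cauchy-Schwarz bounds the first term by [<x, x>]. *)
have l_ub : l <= dot x x + k * N.
  have : dot V (A *m V) = l by rewrite AV dotZr V1' mulr1.
  rewrite AE dotDr dotZr (dotC V x) -expr2 => lE.
  have := cauchy_schwarz x V; rewrite V1' mulr1 => h1.
  have := quad V; rewrite V1' mulr1 ler_norml => /andP[_ h2].
  by clear -lE h1 h2; lra.
have l0 : 0 < l by clear -l_lb lb kN dN0; lra.
have xhl : dot xh xh = l.
  by rewrite xhE dotZl dotZr V1' mulr1 -expr2 sqr_sqrtr// ltW.
have Axh : A *m xh = l *: xh by rewrite xhE -scalemxAr AV !scalerA mulrC.
have [s tE] : exists s, dot x xh = s * l.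
  by exists (dot x xh / l); rewrite divfK// gt_eqF.
have s0 : 0 <= s.
  rewrite -(pmulr_lge0 _ l0) -tE xhE dotZr mulr_ge0 ?sqrtr_ge0// dotC.
  exact: Vx.
have s2l : s ^+ 2 * l <= dot x x.
  have h := cauchy_schwarz x xh; rewrite xhl tE in h.
  by rewrite -(ler_pM2r l0); move: h; rewrite exprMn; clear; lra.
have [Y YE] : exists Y, Y = xh - s *: x by eexists.
have xhY : xh = s *: x + Y by rewrite YE addrC subrK.
have lY : l *: Y = H *m xh.
  by rewrite YE scalerBr -Axh AE tE scalerA (mulrC l) addrC addKr.
have lY' : l *: Y = s *: (H *m x) + H *m Y.
  by rewrite lY {1}xhY mulmxDr -scalemxAr.
have lm : l * l2norm Y <= s * (K * N) + k * N * l2norm Y.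
  rewrite -{1}(gtr0_norm l0) -l2normZ lY'; apply: le_trans (l2normD _ _) _.
  by rewrite lerD// l2normZ ger0_norm// ler_wpM2l.
(* From [<xh, A xh> = l^2]: the part [x x^T] of [A] contributes [s^2 l^2], and the form of [H] at
   [xh = s x + Y] is expanded. *)
have qE : l ^+ 2 * (1 - s ^+ 2) = s ^+ 2 * dot x (H *m x) +
    2 * (s * dot Y (H *m x)) + dot Y (H *m Y).
  have <- : dot xh (H *m xh) = s ^+ 2 * dot x (H *m x) +
      2 * (s * dot Y (H *m x)) + dot Y (H *m Y).
    have sH : H^T = H by rewrite /H linearB/= trmx_mul trmxK sA.
    rewrite xhY mulmxDr -scalemxAr !dotDr !dotDl !dotZr !dotZl.
    by rewrite [dot x (H *m Y)]dot_mulmxC sH (dotC (H *m x)); ring.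
  have : dot xh (A *m xh) = l ^+ 2 by rewrite Axh dotZr xhl -expr2.
  by rewrite AE dotDr dotZr (dotC xh x) tE; clear; lra.
(* The single iteration: applying [H] to [lY'] expresses [H Y] with an additional factor [1 / l]. *)
have HY : H *m Y = l^-1 *: (s *: (H *m (H *m x)) + H *m (H *m Y)).
  have -> : s *: (H *m (H *m x)) + H *m (H *m Y) = l *: (H *m Y).
    by rewrite [RHS]scalemxAr lY' mulmxDr -scalemxAr.
  by rewrite scalerA mulVf ?scale1r// gt_eqF.
have addE u v : (u + v) i 0 = u i 0 + v i 0 by rewrite mxE.
have scaleE q u : (q *: u) i 0 = q * u i 0 by rewrite mxE.
have Yi : Y i 0 = (s * (H *m x) i 0 +
    (s * (H *m (H *m x)) i 0 + (H *m (H *m Y)) i 0) / l) / l.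
  have : (l *: Y) i 0 = s * (H *m x) i 0 +
      (s * (H *m (H *m x)) i 0 + (H *m (H *m Y)) i 0) / l.
    by rewrite lY' [in LHS]HY !(addE, scaleE) (mulrC l^-1).
  by rewrite scaleE => <-; rewrite mulrC mulKf// gt_eqF.
apply: (@expansion_arithmetic R d K k e N (dot x x) l s (l2norm Y) d0 d1 K1 k0
  kd N0 lb ub l_lb s0 s2l (l2norm_ge0 Y) lm (dot x (H *m x)) (dot Y (H *m x))
  (dot Y (H *m Y)) hxHx _ _ qE r ((H *m x) i 0) ((H *m (H *m x)) i 0)
  ((H *m (H *m Y)) i 0) (x i 0)) => //.
- by apply: le_trans (norm_dot _ _) _; rewrite ler_wpM2l ?l2norm_ge0.
- by rewrite sqr_l2norm; exact: quad.
- by apply: le_trans (hrow _) _; rewrite ler_wpM2l ?(ltW r0)//; exact: hop.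
- by rewrite {1}xhY addE scaleE Yi.
Qed.

End EstimateExpansion.

(** * Isolated vertices and cliques *)

Section DegenerateEstimate.
Context (R : realType) (n : nat) (x xh : 'cV[R]_n) (A : 'M[R]_n).
Hypothesis est : is_estimate x A xh.

(** The equation of row [i] is [l V_i = 0], and either factor being zero kills [sqrt l V_i]. *)
Lemma estimate_zero_row i : (forall j, A i j = 0) -> xh i 0 = 0.
Proof.
case: est => l [V [_ AV _ _ ->]] Ai; rewrite mxE.
have : (A *m V) i 0 = 0 by rewrite mxE big1// => j _; rewrite Ai mul0r.
rewrite AV mxE => /eqP; rewrite mulf_eq0 => /orP[/eqP ->|/eqP ->].
  by rewrite sqrtr0 mul0r.
by rewrite mulr0.
Qed.

(* The graph is then a clique on the vertices [k] with [x k = 1]: with [m] such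
   vertices, either [V] vanishes on them or [l = m - 1]. *)
Lemma estimate_clique_le1 i : (forall k, x k 0 = 0 \/ x k 0 = 1) ->
  (forall k l, k != l -> A k l = x k 0 * x l 0) -> (forall k, A k k = 0) ->
  x i 0 = 1 -> xh i 0 <= 1.
Proof.
case: est => l [V [_ AV V1 _ ->]] x01 Akl Akk xi1; rewrite mxE.
have [l0|l0] := leP l 0; first by rewrite ler0_sqrtr// mul0r.
have V1' : dot V V = 1 by [].
set t := dot x V; set m := dot x x.
have xx k : x k 0 * x k 0 = x k 0 by case: (x01 k) => ->; rewrite ?mul0r ?mul1r.
have Vk k : x k 0 * (l * V k 0) = x k 0 * (t - V k 0).
  have <- : (A *m V) k 0 = l * V k 0 by rewrite AV mxE.
  have -> : (A *m V) k 0 = x k 0 * t - x k 0 * V k 0.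
    rewrite mxE /t dotE mulr_sumr [in RHS](bigD1 k)//= [LHS](bigD1 k)//= Akk mul0r.
    rewrite add0r mulrA xx addrC addrK; apply: eq_bigr => j jk.
    by rewrite Akl 1?eq_sym// mulrA.
  by rewrite mulrBr !mulrA xx -mulrBr.
have lt : l * t = m * t - t.
  rewrite {1 3}/t /m !dotE mulr_sumr mulr_suml -sumrB; apply: eq_bigr => k _.
  by rewrite mulrCA Vk xx mulrBr.
have m1 : 1 <= m.
  rewrite /m dotE (bigD1 i)//= xi1 mulr1 lerDl sumr_ge0// => k _.
  by rewrite -expr2 sqr_ge0.
have Vi : V i 0 * (l + 1) = t.
  by have := Vk i; rewrite xi1 !mul1r; lra.
have [t0|t0] := eqVneq t 0.
  have : V i 0 * (l + 1) = 0 by rewrite Vi.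
  move/eqP; rewrite mulf_eq0 => /orP[/eqP ->|]; first by rewrite mulr0.
  by rewrite gt_eqF// addr_gt0.
have lm : l + 1 = m.
  by apply: (mulIf t0); rewrite mulrDl lt mul1r subrK.
(* Cauchy-Schwarz for [t = V_i m] gives [V_i^2 m^2 <= m]; since [l <= m], this bounds [l V_i^2], the
   square of the estimate. *)
have Vi2 : V i 0 ^+ 2 * m <= 1.
  have := cauchy_schwarz x V; rewrite V1' mulr1 -/t -/m -Vi lm exprMn.
  rewrite [m ^+ 2]expr2 mulrA -[leRHS]mul1r ler_pM2r//; lra.
apply: le_trans (ler_norm _) _; rewrite -(@expr_le1 _ 2)// normrM exprMn.
rewrite (real_normK (num_real (V i 0))) (real_normK (num_real (Num.sqrt l))).
rewrite sqr_sqrtr ?(ltW l0)//; apply: le_trans Vi2; rewrite mulrC ler_wpM2l ?sqr_ge0//.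
by rewrite -lm lerDl.
Qed.

End DegenerateEstimate.

(** * Conditioning on the latent positions *)

Section ConditionalTransfer.
Context (R : realType) (d d' : measure_display) (T : measurableType d)
  (S : measurableType d') (P : probability T R) (Z : {mfun T >-> S}).

(** The hypothesis makes [w (Z x)] a version of the probability of [E] given [Z]. For nonnegative
    [f], [w] is the density, with respect to the law of [Z], of the image by [Z] of [P] restricted
    to [E]. A bounded [f] is first made nonnegative by adding its bound. *)
Lemma expect_conditional (E : set T) (w f : S -> R) : measurable E ->
  bounded_measurable w -> (forall y, 0 <= w y) ->
  (forall B, measurable B ->
    P (E `&` Z @^-1` B) = \int[P]_(x in Z @^-1` B) (w (Z x))%:E)%E ->
  bounded_measurable f ->
  \int[P]_x (\1_E x * f (Z x)) = \int[P]_x (w (Z x) * f (Z x)).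
Proof.
move=> mE bw w0 PE.
have mZ : measurable_fun setT Z by [].
have pos g : bounded_measurable g -> (forall y, 0 <= g y) ->
    \int[P]_x (\1_E x * g (Z x)) = \int[P]_x (w (Z x) * g (Z x)).
  move=> [mg bg] g0; congr fine; have [mw _] := bw.
  pose nu := mrestr P mE.
  have -> : (\int[P]_x (\1_E x * g (Z x))%:E = \int[nu]_x (g (Z x))%:E)%E.
    rewrite (@ge0_integral_density _ _ _ P nu (fun x => (\1_E x)%:E)).
    - by apply: eq_integral => x _; rewrite -EFinM mulrC.
    - exact: (bounded_measurable_integrable P (bounded_measurable_indic R mE)).
    - by move=> A mA; rewrite integral_indic// setIC.
    - by apply/measurable_EFinP; exact: measurableT_comp.
    - by move=> x; rewrite lee_fin.
  have -> : (\int[nu]_x (g (Z x))%:E = \int[pushforward nu Z]_y (g y)%:E)%E.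
    rewrite ge0_integral_pushforward ?preimage_setT//; first exact/measurable_EFinP.
    by move=> y _; rewrite lee_fin.
  rewrite (@ge0_integral_density _ _ _ (distribution P Z) (pushforward nu Z)
    (fun y => (w y)%:E)).
  - rewrite ge0_integral_distribution//=.
    + by apply: eq_integral => x _; rewrite /= -EFinM mulrC.
    + by apply/measurable_EFinP; exact: measurable_funM.
    + by move=> y; rewrite lee_fin mulr_ge0.
  - exact: (bounded_measurable_integrable (distribution P Z) bw).
  - move=> B mB; rewrite ge0_integral_pushforward//=.
    + by rewrite -PE// /pushforward /nu /mrestr setIC.
    + by apply/measurable_EFinP/measurable_funTS.
    + by move=> y _; rewrite lee_fin.
  - exact/measurable_EFinP.
  - by move=> y; rewrite lee_fin.
move=> bf; have [mf [M fM]] := bf.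
have bM := @bounded_measurable_cst _ T R M.
have bwZ : bounded_measurable (fun x => w (Z x)) by exact: bounded_measurable_comp.
have bfZ : bounded_measurable (fun x => f (Z x)) by exact: bounded_measurable_comp.
have bE := bounded_measurable_indic R mE.
have h1 := pos _ (bounded_measurableD bf (@bounded_measurable_cst _ S R M)).
have h2 := pos _ (@bounded_measurable_cst _ S R M).
have M0 : 0 <= M by have := fM (Z point); apply: le_trans.
have {}h1 := h1 (fun y => _); have {}h2 := h2 (fun=> M0).
have -> : \int[P]_x (\1_E x * f (Z x)) =
    \int[P]_x (\1_E x * (f (Z x) + M)) - \int[P]_x (\1_E x * M).
  rewrite -expectB; [|exact: bounded_measurableM (bounded_measurableD _ _)|exact: bounded_measurableM].
  by apply: eq_Rintegral => x _; ring.
rewrite h1 ?h2; last by move=> y; have := fM y; rewrite ler_norml; lra.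
rewrite -expectB; [|exact: bounded_measurableM (bounded_measurableD _ _)|exact: bounded_measurableM].
by apply: eq_Rintegral => x _; ring.
Qed.

End ConditionalTransfer.

Section UnitClamp.
Context (R : realType).

(** The latent positions lie in [[0, 1]] almost surely only; after clamping they do so everywhere,
    and bounds on products and powers need no exceptional set. *)
Definition unit_clamp (r : R) : R := Num.max 0 (Num.min 1 r).

Lemma unit_clamp01 r : 0 <= unit_clamp r <= 1.
Proof. by rewrite /unit_clamp le_max lexx /= ge_max ler01 ge_min lexx. Qed.

Lemma unit_clamp_id r : 0 <= r <= 1 -> unit_clamp r = r.
Proof. by move=> /andP[r0 r1]; rewrite /unit_clamp (min_idPr r1) (max_idPr r0). Qed.

Lemma bounded_measurable_unit_clamp : bounded_measurable unit_clamp.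
Proof.
split.
  by apply: measurable_maxr => //; apply: measurable_minr.
by exists 1 => r; have /andP[r0 r1] := unit_clamp01 r; rewrite ger0_norm.
Qed.

End UnitClamp.

(** * Disintegration of the graph given the latent positions *)

Section GraphTransfer.
Context (R : realType) (F : probability R R) (n : nat) (d : measure_display)
  (T : measurableType d) (P : probability T R) (X : 'I_n -> {RV P >-> R})
  (A : 'I_n -> 'I_n -> {RV P >-> bool}).
Hypotheses (F01 : F `[0, 1]%classic = 1%E) (XA : RDPG F X A).

Definition latent (w : T) (k : 'I_n) : R := unit_clamp (X k w).

Definition edge_config (w : T) : {ffun 'I_n * 'I_n -> bool} :=
  [ffun e : 'I_n * 'I_n => (e.1 < e.2)%N && A e.1 e.2 w].

Lemma latent01 w k : 0 <= latent w k <= 1.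
Proof. exact: unit_clamp01. Qed.

Lemma bounded_measurable_latent k : bounded_measurable (latent ^~ k).
Proof.
by apply: (bounded_measurable_comp _ (bounded_measurable_unit_clamp R)).
Qed.

Lemma latent_eq_ae : exists2 O, measurable O & P O = 1%E /\
  forall w k, O w -> latent w k = X k w.
Proof.
exists (\bigcap_k (X k @^-1` `[0, 1]%classic)).
  by apply: fin_bigcap_measurable => // k _; exact: measurable_funPTI.
split; last first.
  by move=> w k /(_ k Logic.I) /=; rewrite in_itv/= => h; exact: unit_clamp_id.
have -> := RDPG_indep XA (B := fun=> `[0, 1]%classic) (fun=> measurable_itv _).
rewrite big1// => k _.
by rewrite -F01 -(RDPG_law XA k).
Qed.

Lemma edge_config_sym w k l : k != l -> edge_config w (edge k l) = A k l w.
Proof.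
rewrite /edge ffunE; case: (ltngtP k l) => [kl|lk|kl] /=.
- by rewrite kl.
- by rewrite lk (RDPG_sym XA).
- by move/eqP; case; exact/val_inj.
Qed.

(** Deliberately not clamped: conditional independence is stated for the sigma-algebra generated by
    [X] itself. Clamping comes afterwards, through [clamp_tuple]. *)
Definition latent_tuple (w : T) : n.-tuple R := [tuple X k w | k < n].

Lemma measurable_latent_tuple : measurable_fun setT latent_tuple.
Proof.
apply/measurable_fun_tnthP => k.
rewrite (_ : _ \o _ = X k)//; apply/funext => w /=; exact: tnth_mktuple.
Qed.

Lemma bounded_measurable_coord (k : 'I_n) :
  bounded_measurable (fun y : n.-tuple R => unit_clamp (tnth y k)).
Proof.
apply: (bounded_measurable_comp _ (bounded_measurable_unit_clamp R)).
exact: measurable_tnth.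
Qed.

Lemma g_sigma_preimage_latent (B : set (n.-tuple R)) : measurable B ->
  g_sigma_preimage X (latent_tuple @^-1` B).
Proof.
move=> mB.
have -> : (X : 'I_n -> T -> R) =
    (fun i : 'I_n => (fun y : n.-tuple R => tnth y i) \o latent_tuple).
  by apply/funext => k; apply/funext => w /=; rewrite tnth_mktuple.
rewrite g_sigma_preimage_comp; exists B => //; exact: setTI.
Qed.

Lemma bernoulli_prob_set1 (p : R) b : 0 <= p <= 1 ->
  fine (bernoulli_prob p [set b]) = bernoulli_pmf p b.
Proof. by move=> p01; rewrite /bernoulli_prob p01 fsbig_set1. Qed.

Local Notation config := {ffun 'I_n * 'I_n -> bool}.

Definition clamp_tuple (y : n.-tuple R) (k : 'I_n) : R := unit_clamp (tnth y k).

Lemma clamp_latent_tuple w : clamp_tuple (latent_tuple w) = latent w.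
Proof. by apply/funext => k; rewrite /clamp_tuple tnth_mktuple. Qed.

Lemma bounded_measurable_edge_prob e :
  bounded_measurable (fun y => edge_prob (clamp_tuple y) e).
Proof.
rewrite /edge_prob; have [_|_] := boolP (e.1 < e.2)%N; last first.
  exact: bounded_measurable_cst.
by apply: bounded_measurableM; exact: bounded_measurable_coord.
Qed.

Lemma bounded_measurable_bernoulli_weight (a : config) :
  bounded_measurable (fun y => bernoulli_weight (edge_prob (clamp_tuple y)) a).
Proof.
apply: bounded_measurable_prod => e _; rewrite /bernoulli_pmf.
case: (a e); first exact: bounded_measurable_edge_prob.
apply: bounded_measurableB; last exact: bounded_measurable_edge_prob.
exact: bounded_measurable_cst.
Qed.

Lemma clamp_tuple01 y k : 0 <= clamp_tuple y k <= 1.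
Proof. exact: unit_clamp01. Qed.

Lemma measurable_edge_config (a : config) : measurable (edge_config @^-1` [set a]).
Proof.
have -> : edge_config @^-1` [set a] = \bigcap_(e in [set: 'I_n * 'I_n])
    ((fun w => edge_config w e) @^-1` [set a e]).
  apply/seteqP; split => [w /= <- e _ //|w h].
  by apply/ffunP => e; exact: (h e Logic.I).
apply: fin_bigcap_measurable => // e _.
rewrite (_ : _ @^-1` _ = if (e.1 < e.2)%N then A e.1 e.2 @^-1` [set a e]
    else if a e then set0 else setT).
  case: ifP => _; first exact: measurable_funPTI.
  by case: ifP.
apply/seteqP; split => w /=; rewrite ffunE; case: ifP => //= _; by case: (a e).
Qed.

(** Conditional independence makes the product of the conditional edge laws a version of the
    conditional probability of [a], and where the positions lie in [[0, 1]] this product is the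
    Bernoulli weight. *)
Lemma prob_edge_config (a : config) (B : set (n.-tuple R)) : measurable B ->
  (P (edge_config @^-1` [set a] `&` latent_tuple @^-1` B) =
   \int[P]_(w in latent_tuple @^-1` B)
     (bernoulli_weight (edge_prob (clamp_tuple (latent_tuple w))) a)%:E)%E.
Proof.
move=> mB.
have mXB : measurable (latent_tuple @^-1` B).
  by rewrite -[X in measurable X]setTI; exact: measurable_latent_tuple.
(* A configuration with an edge outside the strict upper triangle is never attained, and its weight
   vanishes because [edge_prob] is [0] there. *)
have [/existsP[e /andP[ne ae]]|na] :=
    boolP [exists e : 'I_n * 'I_n, ~~ (e.1 < e.2)%N && a e].
  rewrite (_ : _ `&` _ = set0) ?measure0; last first.
    apply/seteqP; split => // w [/= aw _].
    by move: ae; rewrite -aw ffunE (negbTE ne).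
  rewrite integral0_eq// => w _; congr EFin; rewrite /bernoulli_weight.
  by rewrite (bigD1 e)//= /edge_prob (negbTE ne) ae mul0r.
have low (e : 'I_n * 'I_n) : ~~ (e.1 < e.2)%N -> a e = false.
  by move=> ne; move: na; rewrite negb_exists => /forallP/(_ e); rewrite ne /= => /negbTE.
have [_ iw h] := RDPG_cond_indep XA (B := fun e => [set a e])
  (p := fun (e : 'I_n * 'I_n) w => fine (bernoulli_prob (X e.1 w * X e.2 w) [set a e]))
  (fun _ _ => Logic.I) (fun e lt => RDPG_cond_law XA _ lt).
have {h} := h _ (g_sigma_preimage_latent mB).
rewrite (_ : \bigcap_(k in _) _ = edge_config @^-1` [set a]); last first.
  apply/seteqP; split => w.
    move=> h; apply/ffunP => e; rewrite ffunE; have [lt|ge] := ltnP e.1 e.2.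
      exact: (h e lt).
    by rewrite low// -leqNgt.
  by move=> /= <- e /= lt; rewrite ffunE lt.
move=> <-.
have [ Om mO [PO OE]] := latent_eq_ae.
have Xok w k : Om w -> 0 <= X k w <= 1.
  by move=> Ow; rewrite -OE//; exact: latent01.
have E w : Om w ->
  \prod_(k : 'I_n * 'I_n | (k.1 < k.2)%N)
    fine (bernoulli_prob (X k.1 w * X k.2 w) [set a k]) =
  bernoulli_weight (edge_prob (clamp_tuple (latent_tuple w))) a.
  move=> Ow; rewrite clamp_latent_tuple /bernoulli_weight.
  rewrite [RHS](bigID (fun e : 'I_n * 'I_n => (e.1 < e.2)%N))/=.
  rewrite [X in _ = _ * X]big1 ?mulr1; last first.
    by move=> e ne; rewrite /edge_prob (negbTE ne) low// /bernoulli_pmf subr0.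
  apply: eq_bigr => e lt; rewrite /edge_prob lt !OE// bernoulli_prob_set1//.
  by have /andP[a0 a1] := Xok w e.1 Ow; have /andP[b0 b1] := Xok w e.2 Ow;
    rewrite mulr_ge0// mulr_ile1.
apply: ae_eq_integral => //.
- by apply: measurable_funTS; exact: measurable_int iw.
- apply: measurable_funTS; apply/measurable_EFinP.
  exact: (measurableT_comp (bounded_measurable_bernoulli_weight a).1
    measurable_latent_tuple).
exists (~` Om); split; first exact: measurableC.
- by rewrite /= probability_setC// PO subee.
by move=> w /= nE Ow; apply: nE => _; rewrite /= E.
Qed.

HB.instance Definition _ :=
  isMeasurableFun.Build _ _ _ _ latent_tuple measurable_latent_tuple.

(** Splitting along the finitely many configurations reduces the claim to [expect_conditional]. This
    is how bounds for deterministic positions become bounds for the random graph. *)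
Lemma expect_transfer (Phi : n.-tuple R -> config -> R) :
  (forall a, bounded_measurable (Phi ^~ a)) ->
  \int[P]_w Phi (latent_tuple w) (edge_config w) =
  \int[P]_w bernoulli_expect (edge_prob (latent w)) (Phi (latent_tuple w)).
Proof.
move=> bPhi.
have bPhi' a : bounded_measurable (fun w => Phi (latent_tuple w) a).
  exact: (bounded_measurable_comp measurable_latent_tuple (bPhi a)).
have bI a : bounded_measurable (\1_(edge_config @^-1` [set a]) : T -> R).
  by apply: bounded_measurable_indic; exact: measurable_edge_config.
have -> : \int[P]_w Phi (latent_tuple w) (edge_config w) =
    \int[P]_w \sum_a (\1_(edge_config @^-1` [set a]) w * Phi (latent_tuple w) a).
  apply: eq_Rintegral => w _; rewrite (bigD1 (edge_config w))//= indicE mem_set//.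
  rewrite mul1r big1 ?addr0// => a ne; rewrite indicE memNset ?mul0r// => /= E.
  by rewrite E eqxx in ne.
rewrite expect_sum; last by move=> a _; exact: bounded_measurableM.
rewrite /bernoulli_expect expect_sum; last first.
  move=> a _; apply: bounded_measurableM => //.
  under eq_fun do rewrite -clamp_latent_tuple.
  exact: (bounded_measurable_comp measurable_latent_tuple
    (bounded_measurable_bernoulli_weight a)).
apply: eq_bigr => a _.
rewrite (@expect_conditional _ _ _ _ _ _ latent_tuple (edge_config @^-1` [set a])
  (fun y => bernoulli_weight (edge_prob (clamp_tuple y)) a) (Phi ^~ a)).
- by under eq_Rintegral do rewrite clamp_latent_tuple.
- exact: measurable_edge_config.
- exact: bounded_measurable_bernoulli_weight.
- move=> y; apply: bernoulli_weight_ge0; apply: edge_prob01.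
  by move=> k; exact: clamp_tuple01.
- by move=> B mB; exact: prob_edge_config.
- exact: bPhi.
Qed.

End GraphTransfer.

(** * Law of large numbers *)

Section LawOfLargeNumbers.
Context (R : realType) (F : probability R R) (n : nat) (d : measure_display)
  (T : measurableType d) (P : probability T R) (X : 'I_n -> {RV P >-> R}).
Hypotheses (F01 : F `[0, 1]%classic = 1%E) (indepX : mutually_independent X)
  (lawX : forall (k : 'I_n) (B : set R), measurable B ->
    distribution P (X k) B = F B).

Lemma expect_vertex k (g : R -> R) : bounded_measurable g ->
  \int[P]_w g (X k w) = \int[F]_x g x.
Proof.
move=> bg; congr fine; have [mg _] := bg.
rewrite -(@integral_distribution _ _ _ _ _ P (X k) (fun x => (g x)%:E)).
- by apply: eq_measure_integral => B mB _; exact: lawX.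
- exact/measurable_EFinP.
- exact: (bounded_measurable_integrable P (bounded_measurable_comp _ bg)).
Qed.

(** Mutual independence with [setT] for the other vertices gives the product rule on rectangles,
    which determines the joint law of the pair; Tonelli then factors the integral. *)
Lemma expect_vertex_pair j l (g h : R -> R) : j != l ->
  bounded_measurable g -> bounded_measurable h ->
  (forall x, 0 <= g x) -> (forall x, 0 <= h x) ->
  \int[P]_w (g (X j w) * h (X l w)) = (\int[F]_x g x) * (\int[F]_x h x).
Proof.
move=> jl bg bh g0 h0; have [mg _] := bg; have [mh _] := bh.
pose Z (w : T) := (X j w, X l w).
have mZ : measurable_fun setT Z by exact: measurable_fun_pair.
pose Zm : {mfun T >-> (R * R)%type} := HB.pack Z (isMeasurableFun.Build _ _ _ _ Z mZ).
have law B : measurable B -> ((F \x F) B = distribution P Zm B)%E.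
  apply: product_measure_unique => A1 A2 mA1 mA2.
  pose C k : set R := if k == j then A1 else if k == l then A2 else setT.
  have mC k : measurable (C k) by rewrite /C; case: eqP => // _; case: eqP.
  have := indepX mC.
  rewrite (_ : \bigcap_k _ = Z @^-1` (A1 `*` A2)); last first.
    apply/seteqP; split => w.
      move=> h'; split.
        by have := h' j Logic.I; rewrite /C eqxx.
      by have := h' l Logic.I; rewrite /C /= eq_sym (negbTE jl) eqxx.
    move=> [/= a1 a2] k _; rewrite /= /C; case: eqP => [->//|_].
    by case: eqP => [->|].
  move=> E; apply: (etrans E).
  rewrite (bigD1 j)//= (bigD1 l) 1?eq_sym//= big1 ?mule1.
    rewrite /C eqxx [l == j]eq_sym (negbTE jl) eqxx.
    by rewrite -(lawX j mA1) -(lawX l mA2).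
  move=> k /andP[kj kl]; rewrite /C (negbTE kj) (negbTE kl) preimage_setT.
  exact: probability_setT.
have mgh : measurable_fun setT (fun q : R * R => g q.1 * h q.2).
  apply: measurable_funM.
    by apply: measurableT_comp => //; exact: measurable_fst.
  by apply: measurableT_comp => //; exact: measurable_snd.
apply: EFin_inj; rewrite EFinM !EFin_expect//; last first.
  by apply: bounded_measurableM; exact: bounded_measurable_comp.
transitivity (\int[distribution P Zm]_q (g q.1 * h q.2)%:E)%E.
  rewrite ge0_integral_distribution//; first exact/measurable_EFinP.
  by move=> q; rewrite lee_fin mulr_ge0.
transitivity (\int[F \x F]_q (g q.1 * h q.2)%:E)%E.
  by apply: eq_measure_integral => B mB _; exact/esym/law.
rewrite fubini_tonelli1//=; last 2 first.
- exact/measurable_EFinP.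
- by move=> q; rewrite lee_fin mulr_ge0.
transitivity (\int[F]_x ((g x)%:E * \int[F]_y (h y)%:E))%E.
  apply: eq_integral => x _; rewrite /fubini_F/= -ge0_integralZl//=.
  - exact/measurable_EFinP.
  - by move=> y _; rewrite lee_fin.
  - by rewrite lee_fin.
rewrite ge0_integralZr//.
- exact/measurable_EFinP.
- by move=> x _; rewrite lee_fin.
- by apply: integral_ge0 => y _; rewrite lee_fin.
Qed.

Lemma bounded_measurable_clamp_pow k :
  bounded_measurable (fun x : R => unit_clamp x ^+ k).
Proof. exact: (bounded_measurableX k (bounded_measurable_unit_clamp R)). Qed.

Lemma moment_clamp k : moment F k = \int[F]_x (unit_clamp x ^+ k).
Proof.
rewrite /moment unlock; congr fine; apply: ae_eq_integral => //.
- by apply/measurable_EFinP; exact: measurable_funX.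
- by apply/measurable_EFinP; have [] := bounded_measurable_clamp_pow k.
exists (~` `[0, 1]%classic); split; first exact: measurableC.
- by rewrite /= probability_setC// F01 subee.
move=> x /= nE; rewrite in_itv/= => x01; apply: nE => _.
by rewrite unit_clamp_id.
Qed.

Lemma clamp_pow01 k (x : R) : 0 <= unit_clamp x ^+ k <= 1.
Proof.
have /andP[x0 x1] := unit_clamp01 x.
by rewrite exprn_ge0// exprn_ile1.
Qed.

Lemma moment01 k : 0 <= moment F k <= 1.
Proof.
have bk := bounded_measurable_clamp_pow k.
rewrite moment_clamp; apply/andP; split.
  rewrite -[leLHS](expect_cst F 0); apply: le_expect => // [|x].
    exact: bounded_measurable_cst.
  by have /andP[] := clamp_pow01 k x.
rewrite -[leRHS](expect_cst F 1); apply: le_expect => // [|x].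
  exact: bounded_measurable_cst.
by have /andP[] := clamp_pow01 k x.
Qed.

Lemma expect_sqr_sum_uncorrelated (I : finType) (f : I -> T -> R) :
  (forall j, bounded_measurable (f j)) -> (forall j w, `|f j w| <= 1) ->
  (forall j l, j != l -> \int[P]_w (f j w * f l w) = 0) ->
  \int[P]_w ((\sum_j f j w) ^+ 2) <= #|I|%:R.
Proof.
move=> bf f1 unc.
have bff j l := bounded_measurableM (bf j) (bf l).
under eq_Rintegral do rewrite expr2 big_distrlr/=.
rewrite expect_sum; last by move=> j _; apply: bounded_measurable_sum.
rewrite -sum1_card natr_sum; apply: ler_sum => j _.
rewrite expect_sum// (bigD1 j)//= big1 ?addr0; last by move=> l lj; rewrite unc// eq_sym.
rewrite -[leRHS](expect_cst P 1); apply: le_expect => //.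
  exact: bounded_measurable_cst.
by move=> w; rewrite (le_trans (ler_norm _))// normrM mulr_ile1.
Qed.

Lemma expect_moment_deviation k : (0 < n)%N ->
  \int[P]_w ((n%:R^-1 * (\sum_j unit_clamp (X j w) ^+ k) - moment F k) ^+ 2)
  <= n%:R^-1.
Proof.
move=> n0; set m := moment F k.
have nR : 0 < n%:R :> R by rewrite ltr0n.
have bk := bounded_measurable_clamp_pow k.
have bX j : bounded_measurable (fun w => unit_clamp (X j w) ^+ k).
  exact: (bounded_measurable_comp _ bk).
have bm := @bounded_measurable_cst _ T R m.
pose f j w := unit_clamp (X j w) ^+ k - m.
have bf j : bounded_measurable (f j) by exact: bounded_measurableB.
have mE j : \int[P]_w (unit_clamp (X j w) ^+ k) = m.
  by rewrite (expect_vertex j bk) -moment_clamp.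
have S : \int[P]_w ((\sum_j f j w) ^+ 2) <= n%:R.
  rewrite -[X in _ <= X%:R]card_ord; apply: expect_sqr_sum_uncorrelated => //.
    move=> j w; have /andP[a0 a1] := clamp_pow01 k (X j w).
    have /andP[] := moment01 k; rewrite -/m ler_norml /f => b0 b1; lra.
  move=> j l jl.
  have bXX := bounded_measurableM (bX j) (bX l).
  have bmX i := bounded_measurableM bm (bX i).
  transitivity (\int[P]_w (unit_clamp (X j w) ^+ k * unit_clamp (X l w) ^+ k -
      m * unit_clamp (X j w) ^+ k - m * unit_clamp (X l w) ^+ k + m * m)).
    by apply: eq_Rintegral => w _; rewrite /f; ring.
  rewrite expectD; [|exact: bounded_measurableB (bounded_measurableB _ _) _|exact: bounded_measurable_cst].
  rewrite expectB//; last exact: bounded_measurableB.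
  rewrite expectB// !expectZ// expect_cst !mE.
  rewrite (expect_vertex_pair jl bk bk); last 2 first.
  - by move=> x; have /andP[] := clamp_pow01 k x.
  - by move=> x; have /andP[] := clamp_pow01 k x.
  by rewrite -moment_clamp -/m; ring.
have -> : \int[P]_w ((n%:R^-1 * (\sum_j unit_clamp (X j w) ^+ k) - m) ^+ 2) =
    \int[P]_w (n%:R^-1 ^+ 2 * (\sum_j f j w) ^+ 2).
  apply: eq_Rintegral => w _; rewrite -exprMn; congr (_ ^+ 2).
  rewrite /f sumrB mulrBr sumr_const card_ord -[m *+ n]mulr_natr.
  by congr (_ - _); rewrite mulrCA mulVf ?mulr1// gt_eqF.
rewrite expectZ; last by apply: bounded_measurableX; apply: bounded_measurable_sum.
rewrite expr2 -mulrA -[leRHS]mulr1 ler_wpM2l ?invr_ge0 ?(ltW nR)//.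
by rewrite ler_pdivrMl// mulr1.
Qed.

End LawOfLargeNumbers.

(** * Linearization of the estimate *)

Section GoodEvent.
Context (R : realType) (n : nat) (x : 'I_n -> R) (a : {ffun 'I_n * 'I_n -> bool}).
Hypothesis x01 : forall k, 0 <= x k <= 1.
Local Notation h := (edge_noise x a).
Local Notation N := (n%:R : R).
Local Notation xc := (\col_k x k).
Local Notation H0 := (\matrix_(k, l) h k l).
Local Notation Dg := (diag_mx (\row_k (x k ^+ 2))).
Local Notation adj := (\matrix_(k, l) ((k != l) && a (edge k l))%:R : 'M[R]_n).

(** Restores the diagonal left out of [edge_noise]: it is [- Dg], of operator norm at most 1. *)
Lemma adj_noiseE : adj - xc *m xc^T = H0 - Dg.
Proof.
apply/matrixP => k l; rewrite !mxE big_ord1 !mxE /edge_noise.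
case: (eqVneq k l) => [->|kl] /=; first by rewrite mulr1n expr2.
by rewrite mulr0n subr0.
Qed.

Lemma adj_sym : adj^T = adj.
Proof. by apply/matrixP => k l; rewrite !mxE eq_sym edgeC. Qed.

Lemma mul_diag_entry (v : 'cV[R]_n) k : (Dg *m v) k 0 = x k ^+ 2 * v k 0.
Proof. by rewrite mul_diag_mx !mxE. Qed.

Lemma mul_noise_entry (v : 'cV[R]_n) k : (H0 *m v) k 0 = \sum_j h k j * v j 0.
Proof. by rewrite mxE; apply: eq_bigr => j _; rewrite mxE. Qed.

Lemma x2_le1 k : 0 <= x k ^+ 2 <= 1.
Proof. by have /andP[a0 a1] := x01 k; rewrite exprn_ge0// exprn_ile1. Qed.

Lemma l2norm_diag (v : 'cV[R]_n) : l2norm (Dg *m v) <= l2norm v.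
Proof.
rewrite /l2norm ler_sqrt ?dot_ge0// !dotE; apply: ler_sum => k _.
rewrite mul_diag_entry -!expr2 exprMn ler_piMl ?sqr_ge0//.
by have /andP[a0 a1] := x2_le1 k; rewrite exprn_ile1.
Qed.

Lemma dot_xc : dot xc xc = \sum_k x k ^+ 2.
Proof. by rewrite dotE; apply: eq_bigr => k _; rewrite mxE expr2. Qed.

Lemma dot_xc_le : dot xc xc <= N.
Proof.
rewrite dot_xc -[X in _ <= X%:R]card_ord -sum1_card natr_sum.
by apply: ler_sum => k _; have /andP[] := x2_le1 k.
Qed.

Lemma sum_norm_le (f : 'I_n -> R) : (forall k, `|f k| <= 1) -> `|\sum_k f k| <= N.
Proof.
move=> f1; rewrite (le_trans (ler_norm_sum _ _ _))//.
rewrite -[X in _ <= X%:R]card_ord -sum1_card natr_sum.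
exact: ler_sum.
Qed.

Lemma norm_vertex_le1 k : `|x k| <= 1.
Proof. by have /andP[a0 a1] := x01 k; rewrite ger0_norm. Qed.

(** By symmetry [|H0 v|^2 = <v, H0^2 v>], so the operator norm of [H0] is at most the square root of
    the Frobenius norm of [H0^2]; hence the fourth power of [c]. *)
Lemma frobenius_opnorm (v : 'cV[R]_n) (c : R) : 0 <= c ->
  \sum_i \sum_k (\sum_j h i j * h j k) ^+ 2 <= c ^+ 4 ->
  l2norm (H0 *m v) <= c * l2norm v.
Proof.
move=> c0 hc; have symH : H0^T = H0.
  by apply/matrixP => k l; rewrite !mxE edge_noiseC.
have E : dot (H0 *m v) (H0 *m v) = dot v ((H0 *m H0) *m v).
  by rewrite [LHS]dot_mulmxC symH mulmxA dotC.
have F : l2norm ((H0 *m H0) *m v) <= c ^+ 2 * l2norm v.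
  rewrite -ler_sqr ?nnegrE ?mulr_ge0 ?sqr_ge0 ?l2norm_ge0// exprMn !sqr_l2norm.
  apply: le_trans (l2norm_mulmx_frobenius _ _) _; rewrite ler_wpM2r ?dot_ge0//.
  rewrite -exprM; apply: le_trans hc; rewrite le_eqVlt; apply/orP; left; apply/eqP.
  apply: eq_bigr => i _; apply: eq_bigr => k _; congr (_ ^+ 2).
  by rewrite mxE; apply: eq_bigr => j _; rewrite !mxE.
rewrite -ler_sqr ?nnegrE ?mulr_ge0 ?l2norm_ge0// exprMn !sqr_l2norm E.
apply: le_trans (ler_norm _) _; apply: le_trans (norm_dot _ _) _.
rewrite -sqr_l2norm expr2 [leRHS]mulrCA.
by rewrite -mulrA in F *; rewrite ler_wpM2l ?l2norm_ge0.
Qed.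


(** The constant [2 K + 3] is dictated by the row [i] of [H^2 x]: [K N] from open paths, [N] from
    closed ones, [N] from [H0 Dg] and [K r + 1] from [Dg H]. The last summand of the bound is the
    share [x_i^3 / (dl r)] of the diagonal in the linear term. *)
Lemma estimate_on_good_event (xh : 'cV[R]_n) (i : 'I_n) (dl K : R) :
  let r := Num.sqrt N in
  let kappa := Num.sqrt ((4 * K + 2) / r) in
  is_estimate xc adj xh -> 0 < dl <= 1 -> 1 <= K ->
  kappa <= dl / 8 -> K / r <= dl / 2 ->
  (\sum_j h i j * x j) ^+ 2 <= K ^+ 2 * N ->
  \sum_k (\sum_j h k j * x j) ^+ 2 <= K ^+ 2 * N ^+ 2 ->
  (\sum_k \sum_j x k * h k j * x j) ^+ 2 <= 4 * K ^+ 2 * N ^+ 2 ->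
  (\sum_(k | k != i) (\sum_j h i j * h j k) * x k) ^+ 2 <= K ^+ 2 * N ^+ 2 ->
  \sum_k \sum_l (\sum_j h k j * h j l) ^+ 2 <= 2 * K ^+ 2 * N ^+ 3 ->
  (N^-1 * (\sum_k x k ^+ 2) - dl) ^+ 2 <= K ^+ 2 / N ->
  `|r * (xh i 0 - x i) - (\sum_j h i j * x j) / (dl * r)| <=
    remainder_const dl (2 * K + 3) * (kappa + K / r + r^-1) + (dl * r)^-1.
Proof.
move=> r kappa est /andP[d0 d1] K1 kd ed S1 S2 S3 S4 S5 S6.
have N1 : 1 <= N by rewrite ler1n (leq_ltn_trans _ (ltn_ord i)).
have r1 : 1 <= r by rewrite -sqrtr1 ler_sqrt// ltW// (lt_le_trans ltr01).
have NE : N = r ^+ 2 by rewrite sqr_sqrtr.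
have r0 : 0 < r by exact: lt_le_trans r1.
have N0 : 0 < N by exact: lt_le_trans N1.
have rN : r <= N by rewrite NE expr2 ler_peMr// ltW.
have K0 : 0 < K by exact: lt_le_trans K1.
have sqr_bound (y z : R) : 0 <= z -> y ^+ 2 <= z ^+ 2 -> `|y| <= z.
  by move=> z0; rewrite -[y ^+ 2]real_normK ?num_real// ler_sqr ?nnegrE.
pose H := adj - xc *m xc^T.
have HE v : H *m v = H0 *m v - Dg *m v by rewrite /H adj_noiseE mulmxBl.
have subE (u v : 'cV[R]_n) k : (u - v) k 0 = u k 0 - v k 0 by rewrite !mxE.
have H0x k : (H0 *m xc) k 0 = \sum_j h k j * x j.
  by rewrite mul_noise_entry; apply: eq_bigr => j _; rewrite mxE.
have xck k : xc k 0 = x k by rewrite mxE.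
have b1 : `|\sum_j h i j * x j| <= K * r.
  by apply: sqr_bound; [rewrite mulr_ge0 ?(ltW r0) ?(ltW K0)|rewrite exprMn -NE].
have x3 k : `|x k ^+ 2 * x k| <= 1.
  by rewrite normrM mulr_ile1 ?norm_vertex_le1// ger0_norm; have /andP[] := x2_le1 k.
have Hxi : `|(H *m xc) i 0| <= K * r + 1.
  rewrite HE subE H0x mul_diag_entry xck.
  by apply: le_trans (ler_normB _ _) _; rewrite lerD.
have nxc : l2norm xc <= r by rewrite /l2norm ler_sqrt ?dot_xc_le ?(ltW N0).
have nH0x : l2norm (H0 *m xc) <= K * N.
  rewrite -ler_sqr ?nnegrE ?l2norm_ge0 ?mulr_ge0 ?(ltW K0)// sqr_l2norm exprMn.
  apply: le_trans S2; rewrite dotE le_eqVlt; apply/orP; left; apply/eqP.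
  by apply: eq_bigr => k _; rewrite H0x expr2.
have nHx : l2norm (H *m xc) <= (2 * K + 3) * N.
  rewrite HE -scaleN1r; apply: le_trans (l2normD _ _) _.
  rewrite l2normZ normrN1 mul1r.
  have h1 := le_trans (l2norm_diag xc) nxc.
  have := mulr_gt0 K0 N0; clear -h1 nH0x rN N0; lra.
have xHx : `|dot xc (H *m xc)| <= (2 * K + 3) * N.
  have -> : dot xc (H *m xc) =
      \sum_k \sum_j x k * h k j * x j - \sum_k x k * (x k ^+ 2 * x k).
    rewrite dotE -sumrB; apply: eq_bigr => k _.
    rewrite HE subE H0x mul_diag_entry xck mulrBr; congr (_ - _).
    by rewrite mulr_sumr; apply: eq_bigr => j _; rewrite mulrA.
  have h1 : `|\sum_k \sum_j x k * h k j * x j| <= 2 * K * N.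
    apply: sqr_bound; first by rewrite mulr_ge0// mulr_ge0// ltW.
    by apply: le_trans S3 _; rewrite le_eqVlt; apply/orP; left; apply/eqP; ring.
  have h2 : `|\sum_k x k * (x k ^+ 2 * x k)| <= N.
    by apply: sum_norm_le => k; rewrite normrM mulr_ile1 ?norm_vertex_le1.
  apply: le_trans (ler_normB _ _) _.
  by have := mulr_gt0 K0 N0; clear -h1 h2 N0; lra.
have HHx : `|(H *m (H *m xc)) i 0| <= (2 * K + 3) * N.
  have -> : (H *m (H *m xc)) i 0 =
     (H0 *m (H0 *m xc)) i 0 - (H0 *m (Dg *m xc)) i 0 - x i ^+ 2 * (H *m xc) i 0.
    by rewrite HE subE mul_diag_entry HE mulmxBr subE.
  have h1 : `|(H0 *m (H0 *m xc)) i 0| <= K * N + N.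
    (* The index [k = i] is isolated: its coefficient is the sum of the squared noise of row [i],
       bounded by [N] outright instead of by a second moment. *)
    have -> : (H0 *m (H0 *m xc)) i 0 = \sum_(k | k != i)
        (\sum_j h i j * h j k) * x k + (\sum_j h i j * h j i) * x i.
      rewrite mul_noise_entry [RHS]addrC.
      rewrite -(bigD1 i (P := predT) (F := fun k => (\sum_j h i j * h j k) * x k))//=.
      under [RHS]eq_bigr do rewrite mulr_suml.
      rewrite [RHS]exchange_big/=; apply: eq_bigr => j _.
      by rewrite H0x mulr_sumr; apply: eq_bigr => k _; rewrite mulrA.
    apply: le_trans (ler_normD _ _) _; apply: lerD.
      by apply: sqr_bound; [rewrite mulr_ge0// ltW|rewrite exprMn].
    rewrite normrM -[leRHS]mulr1 ler_pM ?norm_vertex_le1//.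
    by apply: sum_norm_le => j; rewrite normrM mulr_ile1 ?edge_noise_le1.
  have h2 : `|(H0 *m (Dg *m xc)) i 0| <= N.
    rewrite mul_noise_entry; apply: sum_norm_le => j.
    by rewrite mul_diag_entry xck normrM mulr_ile1 ?edge_noise_le1.
  have h3 : `|x i ^+ 2 * (H *m xc) i 0| <= K * r + 1.
    rewrite normrM -[leRHS]mul1r ler_pM//.
    by have /andP[a0 a1] := x2_le1 i; rewrite ger0_norm.
  have h4 : K * r <= K * N by rewrite ler_pM2l.
  apply: le_trans (ler_normB _ _) _.
  apply: le_trans (lerD (ler_normB _ _) (lexx _)) _.
  by clear -h1 h2 h3 h4 N1; lra.
(* [c^4 = 4 K^2 N^3] dominates the Frobenius bound [2 K^2 N^3], and [c^2] is a polynomial in [r]. *)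
pose c := Num.sqrt (2 * K * r ^+ 3).
have c0 : 0 <= c by exact: sqrtr_ge0.
have c2 : c ^+ 2 = 2 * K * r ^+ 3.
  by rewrite sqr_sqrtr// mulr_ge0 ?exprn_ge0 ?(ltW r0)// mulr_ge0// ltW.
have k0 : 0 <= kappa by exact: sqrtr_ge0.
have k2 : kappa ^+ 2 = (4 * K + 2) / r.
  by rewrite sqr_sqrtr// divr_ge0 ?(ltW r0)// addr_ge0// mulr_ge0// ltW.
have cop v : l2norm (H0 *m v) <= c * l2norm v.
  apply: frobenius_opnorm => //; apply: le_trans S5 _.
  have -> : c ^+ 4 = 4 * K ^+ 2 * N ^+ 3.
    by rewrite (exprM c 2 2) c2 NE; ring.
  rewrite ler_wpM2r ?exprn_ge0 ?(ltW N0)// ler_wpM2r ?sqr_ge0// (ler_nat _ 2 4)//.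
(* [(c + 1)^2 <= 2 c^2 + 2 <= (4 K + 2) r^3], whence the form of [kappa]; the [+ 1] accounts for the
   diagonal part. *)
have ck : c + 1 <= kappa * N.
  rewrite -ler_sqr ?nnegrE ?addr_ge0 ?mulr_ge0 ?(ltW N0)//.
  apply: (@le_trans _ _ (2 * c ^+ 2 + 2)).
    by have := sqr_ge0 (c - 1); clear -a x01; lra.
  rewrite exprMn k2 c2 NE.
  have -> : (4 * K + 2) / r * (r ^+ 2) ^+ 2 = (4 * K + 2) * r ^+ 3.
    by field; rewrite gt_eqF.
  by have : 1 <= r ^+ 3 by [exact: exprn_ege1]; clear -a x01; lra.
have op v : l2norm (H *m v) <= kappa * N * l2norm v.
  apply: (@le_trans _ _ ((c + 1) * l2norm v)); last by rewrite ler_wpM2r ?l2norm_ge0.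
  rewrite HE -scaleN1r; apply: le_trans (l2normD _ _) _.
  by rewrite l2normZ normrN1 mul1r mulrDl mul1r lerD ?cop ?l2norm_diag.
have row v : `|(H *m v) i 0| <= r * l2norm v.
  have -> : (H *m v) i 0 = dot (row i H)^T v.
    by rewrite dotE mxE; apply: eq_bigr => j _; rewrite !mxE.
  apply: le_trans (norm_dot _ _) _; rewrite ler_wpM2r ?l2norm_ge0//.
  rewrite /r /l2norm ler_sqrt ?(ltW N0)// dotE.
  rewrite (le_trans (ler_norm _))//; apply: sum_norm_le => j.
  have -> : (row i H)^T j 0 = h i j - x i ^+ 2 *+ (i == j).
    by rewrite [LHS]mxE [LHS]mxE /H adj_noiseE !mxE.
  rewrite normrM; case: (eqVneq i j) => [<-|ij].
    rewrite edge_noise_diag mulr1n sub0r normrN; have /andP[a0 a1] := x2_le1 i.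
    by rewrite mulr_ile1// ger0_norm.
  by rewrite mulr0n subr0 mulr_ile1 ?edge_noise_le1.
have dE : `|dot xc xc - dl * N| <= K / r * N.
  have h1 : `|N^-1 * (\sum_k x k ^+ 2) - dl| <= K / r.
    apply: sqr_bound; first by rewrite divr_ge0// ltW.
    by rewrite expr_div_n -NE.
  have -> : dot xc xc - dl * N = (N^-1 * (\sum_k x k ^+ 2) - dl) * N.
    by rewrite dot_xc mulrBl mulrAC mulVf ?mul1r// gt_eqF.
  by rewrite normrM (gtr0_norm N0) ler_wpM2r// ltW.
have lam : dl * r ^+ 2 / 2 <= dot xc xc <= r ^+ 2.
  rewrite -NE dot_xc_le andbT; move: dE; rewrite ler_norml => /andP[h1 _].
  have : K / r * N <= dl / 2 * N by rewrite ler_wpM2r// ltW.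
  by clear -h1; lra.
have := @estimate_expansion R n xc adj xh dl (2 * K + 3) kappa (K / r) r i.
rewrite -/H -NE xck => /(_ adj_sym est (norm_vertex_le1 i)).
rewrite d0 d1 => /(_ isT).
have -> : 1 <= 2 * K + 3 by clear -K0 a x01; lra.
move=> /(_ isT k0 kd) /(_ (divr_ge0 (ltW K0) (ltW r0)) r1).
rewrite NE in dE xHx HHx nHx op; rewrite NE => /(_ lam dE nHx xHx HHx).
have Hxi' : `|(H *m xc) i 0| <= (2 * K + 3) * r.
  apply: le_trans Hxi _; have := mulr_gt0 K0 r0; clear -r1 a x01; lra.
move=> /(_ Hxi' op row) main.
have -> : r * (xh i 0 - x i) - (\sum_j h i j * x j) / (dl * r) =
   r * (xh i 0 - x i) - (H *m xc) i 0 / (dl * r) - x i ^+ 2 * x i / (dl * r).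
  rewrite HE subE H0x mul_diag_entry xck mulrBl; ring.
apply: le_trans (ler_normB _ _) _; apply: lerD => //.
have dr0 : 0 < dl * r by rewrite mulr_gt0.
by rewrite normrM normfV (gtr0_norm dr0) ler_piMl ?invr_ge0 ?(ltW dr0).
Qed.

End GoodEvent.

(** * Probability of the good event *)

Section GoodEventProbability.
Context (R : realType) (F : probability R R) (n : nat) (d : measure_display)
  (T : measurableType d) (P : probability T R) (X : 'I_n -> {RV P >-> R})
  (A : 'I_n -> 'I_n -> {RV P >-> bool}).
Hypotheses (F01 : F `[0, 1]%classic = 1%E) (XA : RDPG F X A).
Local Notation config := {ffun 'I_n * 'I_n -> bool}.
Local Notation conf := (edge_config A).
Local Notation lat := (latent X).

Lemma bounded_measurable_graph (Q : n.-tuple R -> config -> R) :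
  (forall a, bounded_measurable (Q ^~ a)) ->
  bounded_measurable (fun w => Q (latent_tuple X w) (conf w)).
Proof.
move=> bQ.
have -> : (fun w => Q (latent_tuple X w) (conf w)) = fun w =>
    \sum_a (\1_(conf @^-1` [set a]) w * Q (latent_tuple X w) a).
  apply/funext => w; rewrite (bigD1 (conf w))//= indicE mem_set//.
  rewrite mul1r big1 ?addr0// => a ne; rewrite indicE memNset ?mul0r// => /= E.
  by rewrite E eqxx in ne.
apply: bounded_measurable_sum => a _; apply: bounded_measurableM.
  by apply: bounded_measurable_indic; exact: measurable_edge_config.
exact: (bounded_measurable_comp (@measurable_latent_tuple _ _ _ _ _ X) (bQ a)).
Qed.

Lemma expect_graph (Q : ('I_n -> R) -> config -> R) :
  (forall a, bounded_measurable (fun y : n.-tuple R => Q (clamp_tuple y) a)) ->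
  \int[P]_w Q (lat w) (conf w) =
  \int[P]_w bernoulli_expect (edge_prob (lat w)) (Q (lat w)).
Proof.
move=> bQ; have := expect_transfer F01 XA bQ.
by under eq_Rintegral do rewrite clamp_latent_tuple;
  under [in RHS]eq_Rintegral do rewrite clamp_latent_tuple.
Qed.

Lemma bounded_measurable_graph_clamp (Q : ('I_n -> R) -> config -> R) :
  (forall a, bounded_measurable (fun y : n.-tuple R => Q (clamp_tuple y) a)) ->
  bounded_measurable (fun w => Q (lat w) (conf w)).
Proof.
move=> bQ; have := bounded_measurable_graph bQ.
by under eq_fun do rewrite clamp_latent_tuple.
Qed.

Lemma bounded_measurable_bernoulli_expect (Q : ('I_n -> R) -> config -> R) :
  (forall a, bounded_measurable (fun y : n.-tuple R => Q (clamp_tuple y) a)) ->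
  bounded_measurable (fun w => bernoulli_expect (edge_prob (lat w)) (Q (lat w))).
Proof.
move=> bQ; apply: bounded_measurable_sum => a _.
under eq_fun do rewrite -clamp_latent_tuple.
have mL := @measurable_latent_tuple _ _ _ _ _ X.
have b1 := bounded_measurable_comp mL (@bounded_measurable_bernoulli_weight R n a).
exact: (bounded_measurableM b1 (bounded_measurable_comp mL (bQ a))).
Qed.

(** Markov's inequality, where the expectation is bounded for each fixed [x] in the unit cube and
    then integrated over the latent positions. *)
Lemma graph_tail (Q : ('I_n -> R) -> config -> R) (c e : R) : 0 < c ->
  (forall a, bounded_measurable (fun y : n.-tuple R => Q (clamp_tuple y) a)) ->
  (forall x a, 0 <= Q x a) ->
  (forall x, (forall k, 0 <= x k <= 1) -> bernoulli_expect (edge_prob x) (Q x) <= e * c) ->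
  let B := [set w | c < Q (lat w) (conf w)] in
  measurable B /\ (P B <= e%:E)%E.
Proof.
move=> c0 bQ Q0 EQ B; have bf := bounded_measurable_graph_clamp bQ.
split.
  rewrite (_ : B = setT `&` (fun w => Q (lat w) (conf w)) @^-1` `]c, +oo[%classic).
    by have [mf _] := bf; exact: mf.
  by rewrite setTI; apply/seteqP; split => w /=; rewrite in_itv/= andbT.
apply: markov_expect => //; rewrite (expect_graph bQ) -[leRHS](expect_cst P).
apply: le_expect; first exact: bounded_measurable_bernoulli_expect.
  exact: bounded_measurable_cst.
by move=> w; apply: EQ => k; exact: latent01.
Qed.

Lemma bounded_measurable_edge_noise (a : config) i j :
  bounded_measurable (fun y : n.-tuple R => edge_noise (clamp_tuple y) a i j).
Proof.
rewrite /edge_noise; have [_|_] := boolP (i == j).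
  exact: bounded_measurable_cst.
apply: bounded_measurableB; first exact: bounded_measurable_cst.
by apply: bounded_measurableM; exact: bounded_measurable_coord.
Qed.

Lemma probability_setU_le (B C : set T) (b c : R) : measurable B -> measurable C ->
  (P B <= b%:E)%E -> (P C <= c%:E)%E -> (P (B `|` C) <= (b + c)%:E)%E.
Proof.
move=> mB mC Pb Pc; rewrite EFinD; apply: le_trans (leeD Pb Pc).
exact: measureU2.
Qed.

(** Each threshold is [K^2] times a bound on the corresponding expectation, so each of the six
    events fails with probability at most [1 / K^2], whatever [n]. The clamped positions differ from
    [X] on a null set only. *)
Lemma good_event (i : 'I_n) (K : R) : 0 < K -> exists Gd, [/\ measurable Gd,
  (P (~` Gd) <= (6 / K ^+ 2)%:E)%E,
  (forall w, Gd w -> forall k, lat w k = X k w) &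
  forall w, Gd w -> let h := edge_noise (lat w) (conf w) in
   let x := lat w in let N : R := n%:R in
  [/\ (\sum_j h i j * x j) ^+ 2 <= K ^+ 2 * N,
  \sum_k (\sum_j h k j * x j) ^+ 2 <= K ^+ 2 * N ^+ 2,
  (\sum_k \sum_j x k * h k j * x j) ^+ 2 <= 4 * K ^+ 2 * N ^+ 2 &
  [/\ (\sum_(k | k != i) (\sum_j h i j * h j k) * x k) ^+ 2 <= K ^+ 2 * N ^+ 2,
  \sum_k \sum_l (\sum_j h k j * h j l) ^+ 2 <= 2 * K ^+ 2 * N ^+ 3 &
  (N^-1 * (\sum_k x k ^+ 2) - moment F 2) ^+ 2 <= K ^+ 2 / N] ] ].
Proof.
move=> K0; set N : R := n%:R.
have n0 : (0 < n)%N by exact: leq_ltn_trans (ltn_ord i).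
have N0 : 0 < N by rewrite ltr0n.
have K20 : 0 < K ^+ 2 by rewrite exprn_gt0.
have [ Om mO [PO OE]] := latent_eq_ae F01 XA.
have bn a k j := bounded_measurable_edge_noise a k j.
have bx k : bounded_measurable (fun y : n.-tuple R => clamp_tuple y k).
  exact: bounded_measurable_coord.
pose Q1 x a : R := (\sum_j edge_noise x a i j * x j) ^+ 2.
pose Q2 x a : R := \sum_(k < n) (\sum_j edge_noise x a k j * x j) ^+ 2.
pose Q3 x a : R := (\sum_(k < n) \sum_j x k * edge_noise x a k j * x j) ^+ 2.
pose Q4 x a : R := (\sum_(k | k != i)
  (\sum_j edge_noise x a i j * edge_noise x a j k) * x k) ^+ 2.
pose Q5 x a : R := \sum_(k < n) \sum_(l < n)
  (\sum_j edge_noise x a k j * edge_noise x a j l) ^+ 2.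
pose Q6 (x : 'I_n -> R) : R := (N^-1 * (\sum_k x k ^+ 2) - moment F 2) ^+ 2.
have [||||m1 P1] := @graph_tail Q1 (K ^+ 2 * N) (K ^+ 2)^-1.
- by rewrite mulr_gt0.
- move=> a; apply: bounded_measurableX; apply: bounded_measurable_sum => j _.
  exact: bounded_measurableM.
- by move=> x a; exact: sqr_ge0.
- by move=> x x01; rewrite mulKf ?gt_eqF//; exact: expect_noise_row.
have [||||m2 P2] := @graph_tail Q2 (K ^+ 2 * N ^+ 2) (K ^+ 2)^-1.
- by rewrite mulr_gt0 ?exprn_gt0.
- move=> a; apply: bounded_measurable_sum => k _; apply: bounded_measurableX.
  by apply: bounded_measurable_sum => j _; exact: bounded_measurableM.
- by move=> x a; apply: sumr_ge0 => k _; exact: sqr_ge0.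
- move=> x x01; rewrite mulKf ?gt_eqF// /Q2 bernoulli_expect_sum.
  apply: (@le_trans _ _ (\sum_(k < n) N)).
    by apply: ler_sum => k _; exact: expect_noise_row.
  by rewrite sumr_const card_ord expr2 mulr_natr.
have [||||m3 P3] := @graph_tail Q3 (4 * K ^+ 2 * N ^+ 2) (K ^+ 2)^-1.
- by rewrite !mulr_gt0 ?exprn_gt0.
- move=> a; apply: bounded_measurableX; apply: bounded_measurable_sum => k _.
  apply: bounded_measurable_sum => j _; apply: bounded_measurableM => //.
  exact: bounded_measurableM.
- by move=> x a; exact: sqr_ge0.
- move=> x x01; rewrite -mulrA mulrCA mulKf ?gt_eqF//.
  exact: expect_noise_quadratic.
have [||||m4 P4] := @graph_tail Q4 (K ^+ 2 * N ^+ 2) (K ^+ 2)^-1.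
- by rewrite mulr_gt0 ?exprn_gt0.
- move=> a; apply: bounded_measurableX; apply: bounded_measurable_sum => k _.
  apply: bounded_measurableM => //; apply: bounded_measurable_sum => j _.
  exact: bounded_measurableM.
- by move=> x a; exact: sqr_ge0.
- by move=> x x01; rewrite mulKf ?gt_eqF//; exact: expect_noise_sqr_offdiag.
have [||||m5 P5] := @graph_tail Q5 (2 * K ^+ 2 * N ^+ 3) (K ^+ 2)^-1.
- by rewrite !mulr_gt0 ?exprn_gt0.
- move=> a; apply: bounded_measurable_sum => k _; apply: bounded_measurable_sum => l _.
  apply: bounded_measurableX; apply: bounded_measurable_sum => j _.
  exact: bounded_measurableM.
- by move=> x a; apply: sumr_ge0 => k _; apply: sumr_ge0 => l _; exact: sqr_ge0.
- move=> x x01; rewrite -mulrA mulrCA mulKf ?gt_eqF//.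
  exact: expect_noise_sqr_frobenius.
pose B6 := [set w | K ^+ 2 / N < Q6 (lat w)].
have b6 : bounded_measurable (fun w => Q6 (lat w)).
  apply: bounded_measurableX; apply: bounded_measurableB; last first.
    exact: bounded_measurable_cst.
  apply: bounded_measurableM; first exact: bounded_measurable_cst.
  apply: bounded_measurable_sum => k _; apply: bounded_measurableX.
  exact: bounded_measurable_latent.
have mB6 : measurable B6.
  rewrite (_ : B6 = setT `&` (fun w => Q6 (lat w)) @^-1` `](K ^+ 2 / N), +oo[%classic).
    by have [mf _] := b6; exact: mf.
  by rewrite setTI; apply/seteqP; split => w /=; rewrite in_itv/= andbT.
have P6 : (P B6 <= ((K ^+ 2)^-1)%:E)%E.
  apply: (@markov_expect _ _ _ P (fun w => Q6 (lat w))) => //.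
  - by move=> w; exact: sqr_ge0.
  - by rewrite divr_gt0.
  - rewrite mulKf ?gt_eqF//.
    exact: (expect_moment_deviation F01 (RDPG_indep XA) (RDPG_law XA) 2 n0).
have mC : measurable (~` Om) by exact: measurableC.
have PC : (P (~` Om) <= 0%:E)%E by rewrite probability_setC// PO subee.
set B1 := mkset _ in m1 P1; set B2 := mkset _ in m2 P2; set B3 := mkset _ in m3 P3.
set B4 := mkset _ in m4 P4; set B5 := mkset _ in m5 P5.
pose Bad := B1 `|` (B2 `|` (B3 `|` (B4 `|` (B5 `|` (B6 `|` ~` Om))))).
have U6 := probability_setU_le mB6 mC P6 PC.
have M6 := measurableU _ _ mB6 mC.
have U5 := probability_setU_le m5 M6 P5 U6; have M5 := measurableU _ _ m5 M6.
have U4 := probability_setU_le m4 M5 P4 U5; have M4 := measurableU _ _ m4 M5.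
have U3 := probability_setU_le m3 M4 P3 U4; have M3 := measurableU _ _ m3 M4.
have U2 := probability_setU_le m2 M3 P2 U3; have M2 := measurableU _ _ m2 M3.
have U1 := probability_setU_le m1 M2 P1 U2; have M1 := measurableU _ _ m1 M2.
exists (~` Bad); split.
- exact: measurableC.
- rewrite setCK (_ : 6 / K ^+ 2 = (K ^+ 2)^-1 + ((K ^+ 2)^-1 + ((K ^+ 2)^-1 +
    ((K ^+ 2)^-1 + ((K ^+ 2)^-1 + ((K ^+ 2)^-1 + 0)))))) //; last by ring.
- move=> w nB k; apply: OE; apply: contrapT => nO; apply: nB.
  by right; right; right; right; right; right.
move=> w nB; split; [| | |split].
- by rewrite leNgt; apply/negP => b; apply: nB; left.
- by rewrite leNgt; apply/negP => b; apply: nB; right; left.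
- by rewrite leNgt; apply/negP => b; apply: nB; right; right; left.
- by rewrite leNgt; apply/negP => b; apply: nB; right; right; right; left.
- by rewrite leNgt; apply/negP => b; apply: nB; right; right; right; right; left.
- rewrite leNgt; apply/negP => b; apply: nB.
  by right; right; right; right; right; left.
Qed.

End GoodEventProbability.

(** * Gaussian approximation *)

Section SmoothScale.
Context (R : realType).
Local Notation gauss := (@normal_prob R 0 1).

(** Integrates [|z| <= (1 + z^2) / 2]. *)
Lemma gauss_expect_norm_le1 : \int[gauss]_z `|z| <= 1.
Proof.
have i1 : gauss.-integrable setT (EFin \o (fun z : R => `|z|)).
  exact: (gauss_integrableX R 1).
have ic := bounded_measurable_integrable gauss (@bounded_measurable_cst _ R R 2^-1).
have i2 := integrableZl measurableT 2^-1 (@gauss_integrable_sqr R).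
have iD : gauss.-integrable setT (EFin \o (fun z : R => 2^-1 + 2^-1 * z ^+ 2)).
  exact: (integrableD measurableT ic i2).
apply: (@le_trans _ _ (\int[gauss]_z (2^-1 + 2^-1 * z ^+ 2))); last first.
  rewrite (RintegralD measurableT ic i2) expect_cst.
  by rewrite (RintegralZl _ measurableT (@gauss_integrable_sqr R)) gauss_expect_sqr; lra.
apply: (le_Rintegral measurableT i1 iD) => z _.
rewrite -(real_normK (num_real z)); have := sqr_ge0 (`|z| - 1); lra.
Qed.

(** Both smoothings are coupled through the same standard normal variable. *)
Lemma gauss_smooth_lipschitz (g : R -> R) (M s s' : R) : 0 <= M ->
  bounded_measurable g -> (forall u v, `|g u - g v| <= M * `|u - v|) ->
  `|gauss_smooth g s 0 - gauss_smooth g s' 0| <= M * `|s - s'|.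
Proof.
move=> M0 bg lip.
have b1 := bounded_measurable_affine s 0 bg.
have b2 := bounded_measurable_affine s' 0 bg.
rewrite /gauss_smooth -(expectB gauss b1 b2); apply: le_trans (norm_expect gauss (bounded_measurableB b1 b2)) _.
have i1 := bounded_measurable_integrable gauss
  (bounded_measurable_norm (bounded_measurableB b1 b2)).
have iz : gauss.-integrable setT (EFin \o (fun z : R => `|z|)).
  exact: (gauss_integrableX R 1).
have i2 := integrableZl measurableT (M * `|s - s'|) iz.
apply: (@le_trans _ _ (\int[gauss]_z (M * `|s - s'| * `|z|))).
  refine (@le_Rintegral _ _ _ gauss setT _
    (fun z => M * `|s - s'| * `|z|) measurableT i1 i2 _) => z _.
  apply: le_trans (lip _ _) _; rewrite -mulrA ler_wpM2l// -normrM.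
  by rewrite [X in `|X|](_ : _ = (s - s') * z)//; ring.
rewrite (RintegralZl _ measurableT iz) -[leRHS]mulr1 ler_wpM2l ?mulr_ge0//.
exact: gauss_expect_norm_le1.
Qed.

(** The square root is not Lipschitz at zero, and the limit variance may vanish; Hoelder continuity
    compares standard deviations without a lower bound on variances. *)
Lemma sqrt_holder (a b : R) : 0 <= a -> 0 <= b ->
  `|Num.sqrt a - Num.sqrt b| <= Num.sqrt `|a - b|.
Proof.
wlog ab : a b / b <= a.
  move=> W a0 b0; have [ba|/ltW ab] := leP b a; first exact: W.
  by rewrite distrC [in leRHS]distrC; exact: W.
move=> a0 b0.
have sab : Num.sqrt b <= Num.sqrt a by rewrite ler_sqrt.
rewrite !ger0_norm ?subr_ge0// -ler_sqr ?nnegrE ?subr_ge0 ?sqrtr_ge0//.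
rewrite sqr_sqrtr ?subr_ge0//.
have := sqr_sqrtr a0; have := sqr_sqrtr b0; have := sqrtr_ge0 b.
by move: (Num.sqrt a) (Num.sqrt b) sab => u v uv v0 <- <-; nra.
Qed.

(** Makes the square root linear in [a], so that bounds on expectations of [a] suffice; [q] is free,
    to be balanced later. *)
Lemma sqrt_young (a q : R) : 0 <= a -> 0 < q ->
  Num.sqrt a <= 2^-1 * (q * a) + 2^-1 * q^-1.
Proof.
move=> a0 q0; have := sqr_sqrtr a0; move: (Num.sqrt a) => u <-.
rewrite -(ler_pM2r q0) !mulrDl -!mulrA mulVf ?gt_eqF//.
have := sqr_ge0 (q * u - 1); lra.
Qed.

Lemma bounded_measurable_gauss_smooth_sqrt (M c : R) : 0 <= M ->
  bounded_measurable (fun v : R => gauss_smooth (logistic_step M c) (Num.sqrt v) 0).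
Proof.
move=> M0; have bl := bounded_measurable_logistic_step M c; split.
  have cg : continuous (fun s => gauss_smooth (logistic_step M c) s 0).
    move=> s; apply/cvgrPdist_le => e e0; near=> t.
    apply: le_trans (gauss_smooth_lipschitz s t M0 bl _) _.
      by move=> u v; exact: logistic_step_lipschitz.
    have h : `|s - t| <= e / (M + 1).
      by near: t; apply: cvgr_dist_le => //; rewrite divr_gt0// ltr_wpDl.
    apply: (@le_trans _ _ ((M + 1) * `|s - t|)).
      by rewrite ler_wpM2r// lerDl.
    by rewrite mulrC -ler_pdivlMr// ltr_wpDl.
  apply: (measurableT_comp (continuous_measurable_fun cg)).
  by apply: continuous_measurable_fun; exact: sqrt_continuous.
exists 1 => v; apply: norm_expect_le; first exact: bounded_measurable_affine.
move=> z; rewrite gtr0_norm ?logistic_step_gt0//; exact/ltW/logistic_step_lt1.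
Unshelve. all: end_near. Qed.

End SmoothScale.

(** * Error bounds for a fixed number of vertices *)

Section LimitBound.
Context (R : realType) (F : probability R R) (n : nat) (d : measure_display)
  (T : measurableType d) (P : probability T R) (X : 'I_n -> {RV P >-> R})
  (A : 'I_n -> 'I_n -> {RV P >-> bool}) (Xhat : 'I_n -> {RV P >-> R}) (i : 'I_n).
Hypotheses (F01 : F `[0, 1]%classic = 1%E) (XA : RDPG F X A)
  (est : forall w, is_estimate (\col_k X k w) (\matrix_(k, l) (A k l w)%:R)
        (\col_k Xhat k w)) (delta_gt0 : 0 < moment F 2).
Local Notation config := {ffun 'I_n * 'I_n -> bool}.
Local Notation conf := (edge_config A).
Local Notation lat := (latent X).
Local Notation delta := (moment F 2).
Local Notation r := (Num.sqrt (n%:R : R)).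
Local Notation gauss := (@normal_prob R 0 1).

Definition limit_variance (x : R) : R := delta ^- 2 * sigma2 F x.

Definition scaled_error (w : T) : R := r * (Xhat i w - X i w).

Definition linear_error (x : 'I_n -> R) (a : config) : R :=
  (\sum_j edge_noise x a i j * x j) / (delta * r).

Definition remainder_bound (K : R) : R :=
  remainder_const delta (2 * K + 3) * (Num.sqrt ((4 * K + 2) / r) + K / r + r^-1) +
  (delta * r)^-1.

Lemma moment2_le1 : delta <= 1.
Proof. by have /andP[] := moment01 F01 2. Qed.

Lemma sqrt_size_ge1 : 1 <= r.
Proof.
have n0 : (0 < n)%N by exact: leq_ltn_trans (ltn_ord i).
by rewrite -[leLHS]sqrtr1 ler_sqrt ?ler1n.
Qed.

Lemma sqr_sqrt_size : r ^+ 2 = n%:R.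
Proof. by rewrite sqr_sqrtr. Qed.

Lemma adj_estimate w : (forall k, lat w k = X k w) ->
  is_estimate (\col_k lat w k)
   (\matrix_(k, l) ((k != l) && conf w (edge k l))%:R) (\col_k Xhat k w).
Proof.
move=> E; have := est w.
have -> : \col_k X k w = \col_k lat w k by apply/matrixP => k l; rewrite !mxE E.
congr is_estimate; apply/matrixP => k l; rewrite !mxE.
have [->|kl] := eqVneq k l; first by rewrite (RDPG_diag XA).
by rewrite (edge_config_sym XA).
Qed.

Lemma scaled_error_approx (K : R) (w : T) : 1 <= K ->
  Num.sqrt ((4 * K + 2) / r) <= delta / 8 -> K / r <= delta / 2 ->
  (forall k, lat w k = X k w) ->
  let h := edge_noise (lat w) (conf w) in
   let x := lat w in let N : R := n%:R in
  [/\ (\sum_j h i j * x j) ^+ 2 <= K ^+ 2 * N,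
  \sum_k (\sum_j h k j * x j) ^+ 2 <= K ^+ 2 * N ^+ 2,
  (\sum_k \sum_j x k * h k j * x j) ^+ 2 <= 4 * K ^+ 2 * N ^+ 2 &
  [/\ (\sum_(k | k != i) (\sum_j h i j * h j k) * x k) ^+ 2 <= K ^+ 2 * N ^+ 2,
  \sum_k \sum_l (\sum_j h k j * h j l) ^+ 2 <= 2 * K ^+ 2 * N ^+ 3 &
  (N^-1 * (\sum_k x k ^+ 2) - delta) ^+ 2 <= K ^+ 2 / N] ] ->
  `|scaled_error w - linear_error (lat w) (conf w)| <= remainder_bound K.
Proof.
move=> K1 hk he E h x N [S1 S2 S3 [S4 S5 S6]].
have d01 : 0 < delta <= 1 by rewrite delta_gt0 moment2_le1.
have := estimate_on_good_event (latent01 X w) (adj_estimate E) d01 K1 hk he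
  S1 S2 S3 S4 S5 S6.
by rewrite mxE /scaled_error /linear_error -E.
Qed.

(** [D] will be the set of positions [x_i] for which the logistic squeeze is sharp in the limit; its
    indicator is carried through all comparisons. *)
Variables (M c : R) (D : set R).
Hypotheses (M0 : 0 <= M) (mD : measurable D).
Local Notation f := (logistic_step M c).

Lemma bounded_measurable_indic_clamp :
  bounded_measurable (fun x : R => \1_D (unit_clamp x) : R).
Proof.
have [mc _] := bounded_measurable_unit_clamp R.
exact: (bounded_measurable_comp mc (bounded_measurable_indic R mD)).
Qed.

Lemma indic01 (x : R) : 0 <= (\1_D x : R) <= 1.
Proof. by rewrite indicE; case: (_ \in _); rewrite /= ?lexx ?ler01. Qed.

Lemma bounded_measurable_scaled_error :
  bounded_measurable (fun w => \1_D (lat w i) * f (scaled_error w)).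
Proof.
apply: bounded_measurableM.
  exact: (bounded_measurable_comp _ bounded_measurable_indic_clamp).
apply: (bounded_measurable_comp _ (bounded_measurable_logistic_step M c)).
by apply: measurable_funM => //; exact: measurable_funB.
Qed.

Let Qlin (x : 'I_n -> R) (a : config) : R := \1_D (x i) * f (linear_error x a).

Let bQlin a : bounded_measurable (fun y : n.-tuple R => Qlin (clamp_tuple y) a).
Proof.
have bx k : bounded_measurable (fun y : n.-tuple R => clamp_tuple y k).
  exact: bounded_measurable_coord.
apply: bounded_measurableM.
  exact: (bounded_measurable_comp (bx i).1 (bounded_measurable_indic R mD)).
have [ml _] : bounded_measurable (fun y : n.-tuple R => linear_error (clamp_tuple y) a).
  apply: bounded_measurableM; last exact: bounded_measurable_cst.
  apply: bounded_measurable_sum => j _; apply: bounded_measurableM => //.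
  exact: bounded_measurable_edge_noise.
exact: (bounded_measurable_comp ml (bounded_measurable_logistic_step M c)).
Qed.

Let bQ : bounded_measurable (fun w => Qlin (lat w) (conf w)).
Proof. by apply: bounded_measurable_graph_clamp; exact: bQlin. Qed.

(** On the good event the test function is [M]-Lipschitz and the arguments are close; off it the
    difference is at most 1, at a cost of [6 / K^2]. *)
Lemma expect_linearize (K : R) : 1 <= K ->
  Num.sqrt ((4 * K + 2) / r) <= delta / 8 -> K / r <= delta / 2 ->
  `|\int[P]_w (\1_D (lat w i) * f (scaled_error w)) -
    \int[P]_w Qlin (lat w) (conf w)| <= M * remainder_bound K + 6 / K ^+ 2.
Proof.
move=> K1 hk he; have K0 : 0 < K by exact: lt_le_trans K1.
have [Gd [mG PG latX good]] := good_event F01 XA i K0.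
have bT := bounded_measurable_scaled_error.
rewrite -expectB//; apply: le_trans (norm_expect _ (bounded_measurableB bT bQ)) _.
have rho0 : 0 <= remainder_bound K.
  have d01 : 0 <= (delta * r)^-1.
    by rewrite invr_ge0 mulr_ge0 ?sqrtr_ge0// ltW.
  have ri : 0 <= r^-1 by rewrite invr_ge0 sqrtr_ge0.
  have c0 : 0 <= 4 / delta by rewrite divr_ge0// ltW.
  have K3 : 0 <= 2 * K + 3 by rewrite addr_ge0// mulr_ge0// ltW.
  rewrite /remainder_bound addr_ge0// mulr_ge0//.
    rewrite /remainder_const; move: (4 / delta) (2 * K + 3) c0 K3 => q p q0 p0.
    by rewrite !(addr_ge0, mulr_ge0, exprn_ge0).
  by rewrite !addr_ge0 ?sqrtr_ge0// divr_ge0 ?sqrtr_ge0// ltW.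
have mC : measurable (~` Gd) by exact: measurableC.
have bI := bounded_measurable_indic R mC.
have bc := @bounded_measurable_cst _ T R (M * remainder_bound K).
apply: (@le_trans _ _ (\int[P]_w (M * remainder_bound K + \1_(~` Gd) w))).
  apply: le_expect => [||w]; first exact/bounded_measurable_norm/bounded_measurableB.
    exact: bounded_measurableD.
  have [Gw|nG] := pselect (Gd w).
    have -> : \1_(~` Gd) w = 0 :> R by rewrite indicE memNset// => nG; exact: (nG Gw).
    rewrite addr0.
    rewrite /Qlin -mulrBr normrM.
    have /andP[i0 i1] := indic01 (lat w i).
    rewrite (ger0_norm i0) -[leRHS]mul1r ler_pM//.
    apply: le_trans (logistic_step_lipschitz _ _ _ M0) _.
    rewrite ler_wpM2l//; apply: scaled_error_approx => //; first exact: latX.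
    exact: good.
  have -> : \1_(~` Gd) w = 1 :> R by rewrite indicE mem_set.
  rewrite -[leLHS]add0r lerD ?mulr_ge0//.
  rewrite /Qlin -mulrBr normrM; have /andP[i0 i1] := indic01 (lat w i).
  rewrite (ger0_norm i0) -[leRHS]mul1r ler_pM//.
  have := logistic_step_gt0 M c (scaled_error w).
  have := logistic_step_lt1 M c (scaled_error w).
  have := logistic_step_gt0 M c (linear_error (lat w) (conf w)).
  have := logistic_step_lt1 M c (linear_error (lat w) (conf w)).
  by rewrite ler_norml; lra.
rewrite expectD// expect_cst lerD2l -lee_fin expect_prob//.
Qed.

(** The conditional variance of [linear_error] given the latent positions. *)
Let vrow (x : 'I_n -> R) : R := \sum_(j | j != i)
  (x j / (delta * r)) ^+ 2 * (x i * x j * (1 - x i * x j)).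

(** [lindeberg_row] with weights [x_j / (delta r)]: there are [n = r^2] of them, each at most
    [1 / (delta r)], so their cubes sum to at most [1 / (delta^3 r)]. *)
Lemma expect_row_gauss :
  `|\int[P]_w Qlin (lat w) (conf w) -
    \int[P]_w (\1_D (lat w i) * gauss_smooth f (Num.sqrt (vrow (lat w))) 0)| <=
  M ^+ 3 * (1 + gauss_moment3 R) / (delta ^+ 3 * r).
Proof.
have r1 := sqrt_size_ge1; have r0 : 0 < r by exact: lt_le_trans r1.
have dr0 : 0 < delta * r by rewrite mulr_gt0.
have bl k : bounded_measurable (fun w => lat w k) by exact: bounded_measurable_latent.
have bv : bounded_measurable (fun w => vrow (lat w)).
  apply: bounded_measurable_sum => j _; apply: bounded_measurableM.
    apply: bounded_measurableX; apply: bounded_measurableM => //.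
    exact: bounded_measurable_cst.
  have bb := bounded_measurableM (bl i) (bl j).
  apply: bounded_measurableM => //; apply: bounded_measurableB => //.
  exact: bounded_measurable_cst.
have bD : bounded_measurable (fun w => \1_D (lat w i) : R).
  exact: (bounded_measurable_comp _ bounded_measurable_indic_clamp).
have bG : bounded_measurable (fun w => gauss_smooth f (Num.sqrt (vrow (lat w))) 0).
  exact: (bounded_measurable_comp bv.1 (bounded_measurable_gauss_smooth_sqrt c M0)).
have bE := bounded_measurable_bernoulli_expect X bQlin.
rewrite (expect_graph F01 XA bQlin) -expectB//; last exact: bounded_measurableM.
apply: norm_expect_le.
  by apply: bounded_measurableB => //; exact: bounded_measurableM.
move=> w; set x := lat w.
have x01 k : 0 <= x k <= 1 by exact: latent01.
have -> : bernoulli_expect (edge_prob x) (Qlin x) = \1_D (x i) *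
    bernoulli_expect (edge_prob x)
      (fun a => f (\sum_(j | j != i) (x j / (delta * r)) * edge_noise x a i j)).
  rewrite -bernoulli_expectZ; apply: eq_bernoulli_expect => a; rewrite /Qlin /linear_error.
  congr (_ * f _); rewrite (bigD1 i)//= edge_noise_diag mul0r add0r mulr_suml.
  by apply: eq_bigr => j _; ring.
rewrite -mulrBr normrM; have /andP[i0 i1] := indic01 (x i).
rewrite (ger0_norm i0); apply: (@le_trans _ _ (1 * (M ^+ 3 * (1 + gauss_moment3 R) *
  \sum_(j < n | j != i) `|x j / (delta * r)| ^+ 3))).
  have [a' [b' [ba bb T3]]] := logistic_step_taylor3 c M0.
  apply: ler_pM => //.
  exact: (lindeberg_row i (fun j => x j / (delta * r)) x01 (exprn_ge0 3 M0)
    (@continuous_logistic_step R M c) (fun y => ltW (logistic_step_gt0 M c y))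
    (bounded_measurable_logistic_step M c) ba bb T3).
rewrite mul1r ler_wpM2l ?mulr_ge0 ?exprn_ge0 ?addr_ge0 ?gauss_moment3_ge0//.
apply: (@le_trans _ _ (\sum_(j < n) ((delta * r)^-1) ^+ 3)).
  rewrite [leRHS](bigD1 i)//= ler_wpDl ?exprn_ge0 ?invr_ge0 ?(ltW dr0)//.
  apply: ler_sum => j _; rewrite lerXn2r ?nnegrE ?invr_ge0 ?(ltW dr0)//.
  rewrite normrM normfV (gtr0_norm dr0) ler_piMl ?invr_ge0 ?(ltW dr0)//.
  by have /andP[x0 x1] := x01 j; rewrite ger0_norm.
rewrite sumr_const card_ord -[X in X <= _]mulr_natr -[X in _ * X <= _]sqr_sqrt_size le_eqVlt; apply/orP; left.
by apply/eqP; field; rewrite !gt_eqF.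
Qed.

(** From [|u| <= (r u^2 + 1 / r) / 2] and the bound [1 / r^2] on the second moment of [u]. *)
Lemma moment_deviation_norm k :
  \int[P]_w `|n%:R^-1 * (\sum_j lat w j ^+ k) - moment F k| <= r^-1.
Proof.
have r1 := sqrt_size_ge1; have r0 : 0 < r by exact: lt_le_trans r1.
have n0 : (0 < n)%N by exact: leq_ltn_trans (ltn_ord i).
set f' := fun w => n%:R^-1 * (\sum_j lat w j ^+ k) - moment F k.
have bf : bounded_measurable f'.
  apply: bounded_measurableB; last exact: bounded_measurable_cst.
  apply: bounded_measurableM; first exact: bounded_measurable_cst.
  apply: bounded_measurable_sum => j _; apply: bounded_measurableX.
  exact: bounded_measurable_latent.
have bf2 := bounded_measurableX 2 bf.
have bc a := @bounded_measurable_cst _ T R a.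
apply: (@le_trans _ _ (\int[P]_w (r / 2 * f' w ^+ 2 + (2 * r)^-1))).
  apply: le_expect => [||w]; first exact: bounded_measurable_norm.
    exact: bounded_measurableD (bounded_measurableM (bc _) bf2) (bc _).
  rewrite -(real_normK (num_real (f' w))) -(ler_pM2r r0).
  have -> : (r / 2 * `|f' w| ^+ 2 + (2 * r)^-1) * r = (r * `|f' w|) ^+ 2 / 2 + 1 / 2.
    by field; rewrite gt_eqF.
  have := sqr_ge0 (r * `|f' w| - 1); lra.
rewrite expectD//; last exact: (bounded_measurableM (bc _) bf2).
rewrite expectZ// expect_cst.
have := expect_moment_deviation F01 (RDPG_indep XA) (RDPG_law XA) k n0.
rewrite -/(latent X) => h.
apply: (@le_trans _ _ (r / 2 * n%:R^-1 + (2 * r)^-1)).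
  by rewrite lerD2r ler_wpM2l// divr_ge0// ltW.
have -> : n%:R^-1 = (r ^+ 2)^-1 :> R by rewrite sqr_sqrt_size.
by rewrite le_eqVlt; apply/orP; left; apply/eqP; field; rewrite gt_eqF.
Qed.

(** [vrow] differs from the limit variance by errors of empirical moments, of order [1 / r] on
    average. Passing to standard deviations takes a square root, which leaves the rate
    [1 / sqrt r]. *)
Lemma expect_variance_limit :
  (forall x, 0 <= x <= 1 -> 0 <= limit_variance x) ->
  `|\int[P]_w (\1_D (lat w i) * gauss_smooth f (Num.sqrt (vrow (lat w))) 0) -
    \int[P]_w (\1_D (lat w i) *
      gauss_smooth f (Num.sqrt (limit_variance (lat w i))) 0)| <=
  M * (3 * delta ^- 2 + 1) / Num.sqrt r.
Proof.
move=> v0.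
have r1 := sqrt_size_ge1; have r0 : 0 < r by exact: lt_le_trans r1.
have dr0 : 0 < delta * r by rewrite mulr_gt0.
have d2 : 0 < delta ^- 2 by rewrite invr_gt0 exprn_gt0.
(* Balances the two terms of [sqrt_young]: with a variance error of order [1 / r = 1 / q^2], both
   are of order [1 / q]. *)
set q := Num.sqrt r; have q0 : 0 < q by rewrite sqrtr_gt0.
have q2 : q ^+ 2 = r by rewrite sqr_sqrtr// ltW.
have n0 : 0 < n%:R :> R by rewrite -sqr_sqrt_size exprn_gt0.
have nE : n%:R^-1 = (r ^+ 2)^-1 :> R by rewrite sqr_sqrt_size.
have bl k : bounded_measurable (fun w => lat w k) by exact: bounded_measurable_latent.
have bc a := @bounded_measurable_cst _ T R a.
pose Dk k w := n%:R^-1 * (\sum_j lat w j ^+ k) - moment F k.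
have bDk k : bounded_measurable (Dk k).
  apply: bounded_measurableB => //; apply: bounded_measurableM => //.
  by apply: bounded_measurable_sum => j _; exact: bounded_measurableX.
have bv : bounded_measurable (fun w => vrow (lat w)).
  apply: bounded_measurable_sum => j _; apply: bounded_measurableM.
    by apply: bounded_measurableX; exact: bounded_measurableM.
  have bb := bounded_measurableM (bl i) (bl j).
  by apply: bounded_measurableM => //; exact: bounded_measurableB.
have bw : bounded_measurable (fun w => limit_variance (lat w i)).
  apply: bounded_measurableM => //; apply: bounded_measurableB.
    exact: bounded_measurableM.
  by apply: bounded_measurableM => //; exact: bounded_measurableX.
have bD : bounded_measurable (fun w => \1_D (lat w i) : R).
  exact: (bounded_measurable_comp _ bounded_measurable_indic_clamp).
have bS := bounded_measurable_gauss_smooth_sqrt c M0.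
have bG1 := bounded_measurableM bD (bounded_measurable_comp bv.1 bS).
have bG2 := bounded_measurableM bD (bounded_measurable_comp bw.1 bS).
rewrite -(expectB P bG1 bG2).
apply: le_trans (norm_expect _ (bounded_measurableB bG1 bG2)) _.
have bN k := bounded_measurable_norm (bDk k).
have diff w : `|vrow (lat w) - limit_variance (lat w i)| <=
    delta ^- 2 * (`|Dk 3%N w| + `|Dk 4%N w| + n%:R^-1).
  set x := lat w.
  have /andP[x0 x1] : 0 <= x i <= 1 by exact: latent01.
  (* [x_i^4 - x_i^6] is the term [j = i], present in the empirical moments but absent from
     [vrow]. *)
  have -> : vrow x - limit_variance (x i) = delta ^- 2 *
      (x i * Dk 3%N w - x i ^+ 2 * Dk 4%N w - n%:R^-1 * (x i ^+ 4 - x i ^+ 6)).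
    rewrite /limit_variance /sigma2 /Dk.
    have -> : vrow x = delta ^- 2 * n%:R^-1 *
        (x i * (\sum_j x j ^+ 3) - x i ^+ 2 * (\sum_j x j ^+ 4) - (x i ^+ 4 - x i ^+ 6)).
      have sE k : \sum_j x j ^+ k = x i ^+ k + \sum_(j | j != i) x j ^+ k.
        by rewrite (bigD1 i).
      rewrite !sE.
      have -> : x i * (x i ^+ 3 + \sum_(j | j != i) x j ^+ 3) -
        x i ^+ 2 * (x i ^+ 4 + \sum_(j | j != i) x j ^+ 4) - (x i ^+ 4 - x i ^+ 6) =
        x i * (\sum_(j | j != i) x j ^+ 3) - x i ^+ 2 * (\sum_(j | j != i) x j ^+ 4).
        by ring.
      rewrite !mulr_sumr -sumrB mulr_sumr; apply: eq_bigr => j _.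
      by rewrite nE; field; rewrite !gt_eqF.
    by rewrite -/x; ring.
  rewrite normrM (gtr0_norm d2) ler_pM2l//.
  apply: le_trans (ler_normB _ _) _; apply: lerD.
    apply: le_trans (ler_normB _ _) _; apply: lerD.
      by rewrite normrM ler_piMl// ger0_norm.
    by rewrite normrM ler_piMl// ger0_norm ?exprn_ge0// exprn_ile1.
  rewrite normrM ger0_norm ?invr_ge0 ?(ltW n0)// ler_piMr ?invr_ge0 ?(ltW n0)//.
  have h4 : 0 <= x i ^+ 4 <= 1 by rewrite exprn_ge0// exprn_ile1.
  have h6 : 0 <= x i ^+ 6 <= 1 by rewrite exprn_ge0// exprn_ile1.
  by rewrite ler_norml; move: h4 h6 => /andP[? ?] /andP[? ?]; apply/andP; split; lra.
pose E w := M * (2^-1 * (q * (delta ^- 2 * (`|Dk 3%N w| + `|Dk 4%N w| + n%:R^-1))) +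
  2^-1 * q^-1).
have bsum := bounded_measurableD (bounded_measurableD (bN 3%N) (bN 4%N)) (bc n%:R^-1).
have bE : bounded_measurable E.
  exact: (bounded_measurableM (bc M) (bounded_measurableD (bounded_measurableM (bc _)
    (bounded_measurableM (bc q) (bounded_measurableM (bc _) bsum))) (bc _))).
apply: (@le_trans _ _ (\int[P]_w E w)).
  apply: le_expect => //; first exact: (bounded_measurable_norm (bounded_measurableB bG1 bG2)).
  move=> w; rewrite -mulrBr normrM; have /andP[i0 i1] := indic01 (lat w i).
  rewrite (ger0_norm i0) -[leRHS]mul1r ler_pM//.
  apply: le_trans (gauss_smooth_lipschitz _ _ M0 _ _) _.
  - exact: bounded_measurable_logistic_step.
  - by move=> u v; exact: logistic_step_lipschitz.
  rewrite ler_wpM2l//.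
  have vr0 : 0 <= vrow (lat w).
    apply: sumr_ge0 => j _.
    have /andP[a0 a1] := latent01 X w i; have /andP[b0 b1] := latent01 X w j.
    by rewrite mulr_ge0 ?sqr_ge0// mulr_ge0 ?mulr_ge0// subr_ge0 mulr_ile1.
  apply: le_trans (sqrt_holder vr0 (v0 _ (latent01 X w i))) _.
  apply: le_trans (sqrt_young _ q0) _ => //.
  by rewrite lerD2r ler_wpM2l// ler_pM2l.
have -> : \int[P]_w E w = M * (2^-1 * (q * (delta ^- 2 *
    (\int[P]_w `|Dk 3%N w| + \int[P]_w `|Dk 4%N w| + n%:R^-1))) + 2^-1 * q^-1).
  have b1 := bounded_measurableM (bc (delta ^- 2)) bsum.
  have b2 := bounded_measurableM (bc q) b1.
  have b3 := bounded_measurableM (bc 2^-1) b2.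
  rewrite /E expectZ; last exact: (bounded_measurableD b3 (bc _)).
  rewrite (expectD P b3 (bc _)) expect_cst (expectZ P _ b2) (expectZ P _ b1).
  rewrite (expectZ P _ bsum) (expectD P (bounded_measurableD (bN _) (bN _)) (bc _)).
  by rewrite (expectD P (bN _) (bN _)) expect_cst.
have h3 := moment_deviation_norm 3; have h4 := moment_deviation_norm 4.
rewrite -/(Dk 3%N) -/(Dk 4%N) in h3 h4.
rewrite -[leRHS]mulrA ler_wpM2l//.
have hn : n%:R^-1 <= r^-1 :> R.
  by rewrite nE lef_pV2 ?posrE ?exprn_gt0// expr2 ler_peMr// ltW.
have hs : \int[P]_w `|Dk 3%N w| + \int[P]_w `|Dk 4%N w| + n%:R^-1 <= 3 * r^-1.
  by move: h3 h4 hn; rewrite /Dk; lra.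
apply: (@le_trans _ _ (2^-1 * (q * (delta ^- 2 * (3 * r^-1))) + 2^-1 * q^-1)).
  by rewrite lerD2r ler_wpM2l// ler_pM2l// ler_pM2l.
rewrite -q2.
have -> : 2^-1 * (q * (delta ^- 2 * (3 * (q ^+ 2)^-1))) + 2^-1 * q^-1 =
  (3 * delta ^- 2 + 1) / q / 2 by field; rewrite !gt_eqF.
rewrite ler_pdivrMr// ler_peMr ?ler1n//.
by rewrite divr_ge0 ?(ltW q0)// addr_ge0// mulr_ge0// ltW.
Qed.

Lemma expect_limit_mixture :
  \int[P]_w (\1_D (lat w i) *
      gauss_smooth f (Num.sqrt (limit_variance (lat w i))) 0) =
  \int[F]_x (\1_D (unit_clamp x) *
      gauss_smooth f (Num.sqrt (limit_variance (unit_clamp x))) 0).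
Proof.
have bu := bounded_measurable_unit_clamp R.
have bw : bounded_measurable (fun x => limit_variance (unit_clamp x)).
  apply: bounded_measurableM; first exact: bounded_measurable_cst.
  apply: bounded_measurableB; apply: bounded_measurableM => //.
  - exact: bounded_measurable_cst.
  - exact: bounded_measurableX.
  - exact: bounded_measurable_cst.
apply: (expect_vertex (RDPG_law XA) i (g := fun x => \1_D (unit_clamp x) *
  gauss_smooth f (Num.sqrt (limit_variance (unit_clamp x))) 0)).
exact: (bounded_measurableM bounded_measurable_indic_clamp
  (bounded_measurable_comp bw.1 (bounded_measurable_gauss_smooth_sqrt c M0))).
Qed.

Lemma clt_bound (K : R) : 1 <= K ->
  Num.sqrt ((4 * K + 2) / r) <= delta / 8 -> K / r <= delta / 2 ->
  (forall x, 0 <= x <= 1 -> 0 <= limit_variance x) ->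
  `|\int[P]_w (\1_D (lat w i) * f (scaled_error w)) -
    \int[F]_x (\1_D (unit_clamp x) *
      gauss_smooth f (Num.sqrt (limit_variance (unit_clamp x))) 0)| <=
  M * remainder_bound K + 6 / K ^+ 2 +
  M ^+ 3 * (1 + gauss_moment3 R) / (delta ^+ 3 * r) +
  M * (3 * delta ^- 2 + 1) / Num.sqrt r.
Proof.
move=> K1 hk he v0; rewrite -expect_limit_mixture.
have h1 := expect_linearize K1 hk he.
have h2 := expect_row_gauss; have h3 := expect_variance_limit v0.
exact: (le_trans (ler_distD _ _ _)
  (lerD (le_trans (ler_distD _ _ _) (lerD h1 h2)) h3)).
Qed.

End LimitBound.

(** * Vanishing limit variance *)

Section MomentFacts.
Context (R : realType) (F : probability R R).
Hypotheses (F01 : F `[0, 1]%classic = 1%E) (delta_gt0 : 0 < moment F 2).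

Lemma moment_le34 : moment F 4 <= moment F 3.
Proof.
rewrite !moment_clamp//; apply: le_expect; try exact: bounded_measurable_clamp_pow.
move=> x; have /andP[c0 c1] := unit_clamp01 x.
by rewrite exprS ler_piMl ?exprn_ge0.
Qed.

(** The variance of the squared position is nonnegative, so the fourth moment is at least the square
    of the second. *)
Lemma moment4_gt0 : 0 < moment F 4.
Proof.
apply: (@lt_le_trans _ _ (moment F 2 ^+ 2)); first by rewrite exprn_gt0.
have bX k := bounded_measurable_clamp_pow R k.
have bc a := @bounded_measurable_cst _ R R a.
have : 0 <= \int[F]_x ((unit_clamp x ^+ 2 - moment F 2) ^+ 2).
  by apply: Rintegral_ge0 => x _; exact: sqr_ge0.
have -> : \int[F]_x ((unit_clamp x ^+ 2 - moment F 2) ^+ 2) =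
  \int[F]_x (unit_clamp x ^+ 4 - 2 * moment F 2 * unit_clamp x ^+ 2 + moment F 2 ^+ 2).
  by apply: eq_Rintegral => x _; ring.
have b1 := bounded_measurableM (bc (2 * moment F 2)) (bX 2%N).
rewrite (expectD F (bounded_measurableB (bX 4%N) b1) (bc _)) expect_cst.
rewrite (expectB F (bX _) b1) expectZ// -!moment_clamp//; lra.
Qed.

Lemma limit_variance_ge0 x : 0 <= x <= 1 -> 0 <= limit_variance F x.
Proof.
move=> /andP[x0 x1]; rewrite /limit_variance mulr_ge0 ?invr_ge0 ?sqr_ge0//.
have m4 := moment4_gt0; have m34 := moment_le34; rewrite /sigma2 subr_ge0.
apply: (@le_trans _ _ (x * moment F 4)); last by rewrite ler_wpM2l.
by rewrite ler_wpM2r ?(ltW m4)// expr2 ler_piMl.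
Qed.

(** If [x != 0], then [moment F 3 = x * moment F 4], which with [moment F 4 <= moment F 3] forces
    [x = 1]. Equality of these two moments means that [F] is carried by [0] and [1]. *)
Lemma limit_variance_eq0 x : 0 <= x <= 1 -> limit_variance F x = 0 ->
  x = 0 \/ x = 1 /\ moment F 3 = moment F 4.
Proof.
move=> /andP[x0 x1] /eqP; rewrite /limit_variance mulf_eq0.
rewrite invr_eq0 expf_eq0/= gt_eqF//= /sigma2 subr_eq0 expr2 -mulrA => /eqP.
have [->|xn0] := eqVneq x 0; first by left.
move=> /(mulfI xn0) E; right; have m4 := moment4_gt0; have m34 := moment_le34.
have x1' : 1 <= x by rewrite -(ler_pM2r m4) mul1r -E.
have xE : x = 1 by apply/eqP; rewrite eq_le x1 x1'.
by split => //; rewrite E xE mul1r.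
Qed.

End MomentFacts.

(** * Sign of the error where the limit variance vanishes *)

Section DegenerateError.
Context (R : realType) (F : probability R R) (n : nat) (d : measure_display)
  (T : measurableType d) (P : probability T R) (X : 'I_n -> {RV P >-> R})
  (A : 'I_n -> 'I_n -> {RV P >-> bool}) (Xhat : 'I_n -> {RV P >-> R}) (i : 'I_n).
Hypotheses (F01 : F `[0, 1]%classic = 1%E) (XA : RDPG F X A)
  (est : forall w, is_estimate (\col_k X k w) (\matrix_(k, l) (A k l w)%:R)
        (\col_k Xhat k w)) (delta_gt0 : 0 < moment F 2).
Local Notation config := {ffun 'I_n * 'I_n -> bool}.
Local Notation conf := (edge_config A).
Local Notation lat := (latent X).

Lemma probability1_setI (B C : set T) : measurable B -> measurable C ->
  P B = 1%E -> P C = 1%E -> P (B `&` C) = 1%E.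
Proof.
move=> mB mC PB PC; have mI := measurableI _ _ mB mC.
have h : P (~` (B `&` C)) = 0%E.
  apply/eqP; rewrite eq_le measure_ge0 andbT setCI -[leRHS]adde0.
  have hB : P (~` B) = 0%E by rewrite probability_setC// PB subee.
  have hC : P (~` C) = 0%E by rewrite probability_setC// PC subee.
  have := measureU2 P (measurableC mB) (measurableC mC).
  by rewrite /= hB hC.
have := probability_setC P mI; rewrite h => hI.
have fI : P (B `&` C) \is a fin_num by exact: fin_num_measure.
by apply/eqP; move/eqP: hI; rewrite eq_sym sube_eq// ?add0e// => /eqP <-.
Qed.

Lemma expect_edge_noise_sqr (x : 'I_n -> R) k l : (forall j, 0 <= x j <= 1) ->
  bernoulli_expect (edge_prob x) (fun a => edge_noise x a k l ^+ 2) =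
  (k != l)%:R * (x k * x l * (1 - x k * x l)).
Proof.
move=> x01; have [->|kl] := eqVneq k l.
  under eq_bernoulli_expect do rewrite edge_noise_diag expr0n.
  by rewrite bernoulli_expect_cst mul0r.
rewrite mul1r (bernoulli_expect_coord _ (edge k l)) edge_prob_edge//.
rewrite -[RHS](bernoulli_expect_cst (edge_prob x)); apply: eq_bernoulli_expect => a.
by rewrite /edge_noise (negbTE kl) !ffunE eqxx /=; ring.
Qed.

Let bx k : bounded_measurable (fun y : n.-tuple R => clamp_tuple y k).
Proof. exact: bounded_measurable_coord. Qed.

(** Given [x_i = 0], all edge variances of row [i] vanish, so the squared noise of that row, cut off
    to this event, has zero expectation. *)
Lemma zero_row_ae : exists2 Om, measurable Om & P Om = 1%E /\
  forall w, Om w -> lat w i = 0 -> forall j, edge_noise (lat w) (conf w) i j = 0.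
Proof.
pose Q (x : 'I_n -> R) (a : config) : R :=
  \1_[set 0] (x i) * \sum_j edge_noise x a i j ^+ 2.
have bQ a : bounded_measurable (fun y : n.-tuple R => Q (clamp_tuple y) a).
  apply: bounded_measurableM.
    apply: (bounded_measurable_comp (bx i).1).
    by apply: bounded_measurable_indic; exact: measurable_set1.
  apply: bounded_measurable_sum => j _; apply: bounded_measurableX.
  exact: bounded_measurable_edge_noise.
have Q0 x a : 0 <= Q x a by rewrite mulr_ge0// sumr_ge0// => j _; exact: sqr_ge0.
have EQ : \int[P]_w Q (lat w) (conf w) = 0.
  rewrite (expect_graph F01 XA bQ) -[RHS](expect_cst P 0).
  apply: eq_Rintegral => w _; rewrite bernoulli_expectZ bernoulli_expect_sum.
  rewrite indicE; have [|_] := boolP (lat w i \in _); last by rewrite mul0r.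
  move=> /set_mem /= xi; rewrite big1 ?mulr0// => j _.
  by rewrite expect_edge_noise_sqr ?xi ?mul0r ?mulr0// => k; exact: latent01.
have bf : bounded_measurable (fun w => Q (lat w) (conf w)).
  by apply: bounded_measurable_graph_clamp; exact: bQ.
have [ Om mO [PO OE]] := expect_eq0 bf (fun w => Q0 _ _) EQ.
exists Om => //; split => // w Ow xi j.
have := OE w Ow; rewrite /Q indicE mem_set// mul1r => /eqP.
rewrite psumr_eq0 => [/allP h|k _]; last exact: sqr_ge0.
by have /implyP/(_ isT) := h j (mem_index_enum _); rewrite sqrf_eq0 => /eqP.
Qed.

(** The terms [x_k^3 - x_k^4] are nonnegative and have zero expectation; they vanish only at [0] and
    [1]. *)
Lemma binary_ae : moment F 3 = moment F 4 ->
  exists2 Om, measurable Om & P Om = 1%E /\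
    forall w, Om w -> forall k, lat w k = 0 \/ lat w k = 1.
Proof.
move=> m34.
have bl k : bounded_measurable (fun w => lat w k) by exact: bounded_measurable_latent.
have bX p k := bounded_measurableX p (bl k).
pose f w : R := \sum_k (lat w k ^+ 3 - lat w k ^+ 4).
have bf : bounded_measurable f.
  by apply: bounded_measurable_sum => k _; exact: bounded_measurableB.
have t0 w k : 0 <= lat w k ^+ 3 - lat w k ^+ 4.
  have /andP[c0 c1] := latent01 X w k.
  by rewrite subr_ge0 exprS ler_piMl ?exprn_ge0.
have f0 w : 0 <= f w by apply: sumr_ge0.
have Ef : \int[P]_w f w = 0.
  rewrite /f expect_sum => [|k _]; last exact: bounded_measurableB.
  apply: big1 => k _; rewrite expectB//.
  have E p := expect_vertex (RDPG_law XA) k (bounded_measurable_clamp_pow R p).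
  by rewrite !E -!moment_clamp// m34 subrr.
have [ Om mO [PO OE]] := expect_eq0 bf f0 Ef.
exists Om => //; split => // w Ow k.
have := OE w Ow => /eqP; rewrite /f psumr_eq0// => /allP h.
have /implyP/(_ isT) := h k (mem_index_enum _).
rewrite (exprSr _ 3) -[X in X - _]mulr1 -mulrBr mulf_eq0 expf_eq0/= subr_eq0.
by move=> /orP[/eqP ->|/eqP <-]; [left|right].
Qed.

(** For positions in [{0, 1}] every edge probability is [0] or [1], so all edge variances vanish. *)
Lemma clique_ae : moment F 3 = moment F 4 ->
  exists2 Om, measurable Om & P Om = 1%E /\
    forall w, Om w -> (forall k, lat w k = 0 \/ lat w k = 1) /\
      forall k l, edge_noise (lat w) (conf w) k l = 0.
Proof.
move=> m34; have [ O1 mO1 [PO1 O1E]] := binary_ae m34.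
pose Q (x : 'I_n -> R) (a : config) : R := \sum_k \sum_l edge_noise x a k l ^+ 2.
have bQ a : bounded_measurable (fun y : n.-tuple R => Q (clamp_tuple y) a).
  apply: bounded_measurable_sum => k _; apply: bounded_measurable_sum => j _.
  by apply: bounded_measurableX; exact: bounded_measurable_edge_noise.
have Q0 x a : 0 <= Q x a.
  by apply: sumr_ge0 => k _; apply: sumr_ge0 => j _; exact: sqr_ge0.
have EQ : \int[P]_w Q (lat w) (conf w) = 0.
  rewrite (expect_graph F01 XA bQ) -[RHS](expect_cst P 0).
  apply: (eq_expect_ae _ _ mO1 PO1).
  - exact: bounded_measurable_bernoulli_expect.
  - exact: bounded_measurable_cst.
  move=> w Ow; rewrite bernoulli_expect_sum big1// => k _.
  rewrite bernoulli_expect_sum big1// => l _.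
  rewrite expect_edge_noise_sqr; last by move=> j; exact: latent01.
  case: (O1E w Ow k) => ->; first by rewrite !mul0r mulr0.
  case: (O1E w Ow l) => ->; first by rewrite !(mulr0, mul0r).
  by rewrite !mulr1 subrr !mulr0.
have bf : bounded_measurable (fun w => Q (lat w) (conf w)).
  by apply: bounded_measurable_graph_clamp; exact: bQ.
have [ O2 mO2 [PO2 O2E]] := expect_eq0 bf (fun w => Q0 _ _) EQ.
exists (O1 `&` O2); first exact: measurableI.
split; first exact: probability1_setI.
move=> w [Ow1 Ow2]; split; first exact: O1E.
move=> k l; have := O2E w Ow2 => /eqP; rewrite /Q psumr_eq0; last first.
  by move=> j _; apply: sumr_ge0 => j' _; exact: sqr_ge0.
move=> /allP h; have /implyP/(_ isT) := h k (mem_index_enum _).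
rewrite psumr_eq0 => [/allP h'|j _]; last exact: sqr_ge0.
by have /implyP/(_ isT) := h' l (mem_index_enum _); rewrite sqrf_eq0 => /eqP.
Qed.

Lemma degenerate_error_le0 : exists2 Om, measurable Om & P Om = 1%E /\
  forall w, Om w -> limit_variance F (lat w i) = 0 -> scaled_error X Xhat i w <= 0.
Proof.
have [ OX mX [PX XE]] := latent_eq_ae F01 XA.
have [ O1 m1 [P1 E1]] := zero_row_ae.
have zero w : OX w -> O1 w -> lat w i = 0 -> scaled_error X Xhat i w <= 0.
  move=> OXw O1w xi; rewrite /scaled_error -XE// xi subr0.
  have := estimate_zero_row (i := i) (est w).
  rewrite mxE => ->; first by rewrite mulr0.
  move=> j; rewrite mxE; have [->|ij] := eqVneq i j; first by rewrite (RDPG_diag XA).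
  have := E1 w O1w xi j; rewrite /edge_noise (negbTE ij) (edge_config_sym XA)//.
  by rewrite xi mul0r subr0.
have [m34|m34] := eqVneq (moment F 3) (moment F 4); last first.
  exists (OX `&` O1); first exact: measurableI.
  split; first exact: probability1_setI.
  move=> w [OXw O1w] v0.
  have [xi|[_ E]] := limit_variance_eq0 F01 delta_gt0 (latent01 X w i) v0.
    exact: zero.
  by move: m34; rewrite E eqxx.
have [ O2 m2 [P2 E2]] := clique_ae m34.
exists (OX `&` O1 `&` O2); first by apply: measurableI => //; exact: measurableI.
split.
  apply: probability1_setI => //; first exact: measurableI.
  exact: probability1_setI.
move=> w [[OXw O1w] O2w] v0.
have [xi|[xi _]] := limit_variance_eq0 F01 delta_gt0 (latent01 X w i) v0.
  exact: zero.
have [bin noise0] := E2 w O2w.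
rewrite /scaled_error -XE// xi mulr_ge0_le0 ?sqrtr_ge0// subr_le0.
suff : (\col_k Xhat k w) i 0 <= 1 by rewrite mxE.
apply: (estimate_clique_le1 (est w)).
- by move=> k; rewrite mxE -XE//; exact: bin.
- move=> k l kl; rewrite !mxE -!XE//.
  have := noise0 k l; rewrite /edge_noise (negbTE kl) (edge_config_sym XA)//.
  by move/eqP; rewrite subr_eq0 => /eqP.
- by move=> k; rewrite mxE (RDPG_diag XA).
- by rewrite mxE -XE.
Qed.

End DegenerateError.

(** * Passage to the limit *)

Section VertexLimit.
Context (R : realType).

Lemma cvg_invr_sqrt_succ : (Num.sqrt (n.+1%:R : R))^-1 @[n --> \oo] --> (0 : R).
Proof.
have -> : (fun n => (Num.sqrt (n.+1%:R : R))^-1) = Num.sqrt \o @harmonic R.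
  by apply/funext => n /=; rewrite sqrtrV.
have := @sqrt_continuous R 0; rewrite /continuous_at sqrtr0.
exact: cvg_comp (@cvg_harmonic R).
Qed.

Lemma cvgZ_invr_sqrt_succ (c : R) : c / Num.sqrt n.+1%:R @[n --> \oo] --> (0 : R).
Proof. by rewrite -[X in _ --> X](mulr0 c); apply: cvgMl_tmp; exact: cvg_invr_sqrt_succ. Qed.

Lemma cvg_sqrt_succ0 (u : nat -> R) : u n @[n --> \oo] --> (0 : R) ->
  Num.sqrt (u n) @[n --> \oo] --> (0 : R).
Proof.
move=> u0; have := @sqrt_continuous R 0; rewrite /continuous_at sqrtr0.
exact: cvg_comp.
Qed.

Context (F : probability R R).

Lemma cvg_remainder_bound (K : R) : remainder_bound F n.+1 K @[n --> \oo] --> (0 : R).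
Proof.
rewrite /remainder_bound -[X in _ --> X]addr0; apply: cvgD; last first.
  under eq_fun do rewrite invfM; exact: cvgZ_invr_sqrt_succ.
set C := remainder_const _ _; rewrite -[X in _ --> X](mulr0 C); apply: cvgMl_tmp.
rewrite -[X in _ --> X]addr0; apply: cvgD; last exact: cvg_invr_sqrt_succ.
rewrite -[X in _ --> X]addr0; apply: cvgD; last exact: cvgZ_invr_sqrt_succ.
exact/cvg_sqrt_succ0/cvgZ_invr_sqrt_succ.
Qed.

Hypotheses (F01 : F `[0, 1]%classic = 1%E) (delta_gt0 : 0 < moment F 2).
Context (d : nat -> measure_display) (T : forall n : nat, measurableType (d n))
  (P : forall n : nat, probability (T n) R)
  (X : forall n : nat, 'I_n.+1 -> {RV (P n) >-> R})
  (A : forall n : nat, 'I_n.+1 -> 'I_n.+1 -> {RV (P n) >-> bool})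
  (Xhat : forall n : nat, 'I_n.+1 -> {RV (P n) >-> R})
  (i : forall n : nat, 'I_n.+1).
Hypotheses (XA : forall n : nat, RDPG F (@X n) (@A n))
  (est : forall (n : nat) (w : T n),
      is_estimate (\col_k @X n k w) (\matrix_(k, l) (@A n k l w)%:R)
        (\col_k @Xhat n k w)).

Lemma cvg_expect_logistic (D : set R) (M c : R) : measurable D -> 0 <= M ->
  \int[P n]_w (\1_D (latent (@X n) w (@i n)) *
    logistic_step M c (scaled_error (@X n) (@Xhat n) (@i n) w)) @[n --> \oo] -->
  \int[F]_x (\1_D (unit_clamp x) *
    gauss_smooth (logistic_step M c) (Num.sqrt (limit_variance F (unit_clamp x))) 0).
Proof.
move=> mD M0; apply/cvgrPdist_le => e e0.
set L := \int[F]_x _.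
have e4 : 0 < e / 4 by rewrite divr_gt0.
(* [24 / e <= K <= K^2] makes the failure term [6 / K^2] at most [e / 4]. The other three errors
   vanish as [n] grows, [K] being fixed. *)
pose K : R := 1 + 24 / e.
have eK : 0 < 24 / e by rewrite divr_gt0.
have K1 : 1 <= K by rewrite lerDl ltW.
have K2 : 6 / K ^+ 2 <= e / 4.
  have K0 : 0 < K by exact: lt_le_trans K1.
  rewrite ler_pdivrMr ?exprn_gt0//.
  have -> : 6 = e / 4 * (24 / e) by field; rewrite gt_eqF.
  rewrite ler_pM2l// expr2 (@le_trans _ _ K)// ?lerDr// ler_peMl//.
  exact: ltW.
have small (u : nat -> R) (b : R) : 0 < b -> u n @[n --> \oo] --> (0 : R) ->
    \forall n \near \oo, u n <= b.
  move=> b0 /cvgrPdist_le /(_ b b0); apply: filterS => n.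
  by rewrite sub0r normrN; apply: le_trans; exact: ler_norm.
have d8 : 0 < moment F 2 / 8 by rewrite divr_gt0.
have d2 : 0 < moment F 2 / 2 by rewrite divr_gt0.
have hr : M * remainder_bound F n.+1 K @[n --> \oo] --> (0 : R).
  by rewrite -[X in _ --> X](mulr0 M); apply: cvgMl_tmp; exact: cvg_remainder_bound.
have hm : M ^+ 3 * (1 + gauss_moment3 R) / (moment F 2 ^+ 3 * Num.sqrt n.+1%:R)
    @[n --> \oo] --> (0 : R).
  by under eq_fun do rewrite invfM mulrA; exact: cvgZ_invr_sqrt_succ.
have hs : M * (3 * moment F 2 ^- 2 + 1) / Num.sqrt (Num.sqrt n.+1%:R)
    @[n --> \oo] --> (0 : R).
  rewrite -[X in _ --> X](mulr0 (M * (3 * moment F 2 ^- 2 + 1))); apply: cvgMl_tmp.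
  under eq_fun do rewrite -sqrtrV ?sqrtr_ge0//.
  exact/cvg_sqrt_succ0/cvg_invr_sqrt_succ.
near=> n; rewrite distrC.
apply: le_trans (clt_bound (@i n) F01 (@XA n) (@est n) delta_gt0 c M0 mD K1 _ _ _) _.
- near: n; apply: small => //; exact/cvg_sqrt_succ0/cvgZ_invr_sqrt_succ.
- near: n; apply: small => //; exact: cvgZ_invr_sqrt_succ.
- by move=> x x01; exact: limit_variance_ge0.
have h1 : M * remainder_bound F n.+1 K <= e / 4 by near: n; exact: small.
have h2 : M ^+ 3 * (1 + gauss_moment3 R) / (moment F 2 ^+ 3 * Num.sqrt n.+1%:R)
  <= e / 4 by near: n; exact: small.
have h3 : M * (3 * moment F 2 ^- 2 + 1) / Num.sqrt (Num.sqrt n.+1%:R) <= e / 4.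
  by near: n; exact: small.
rewrite (_ : e = e / 4 + e / 4 + e / 4 + e / 4); last by field.
by rewrite !lerD.
Unshelve. all: end_near. Qed.

End VertexLimit.

(** * Measurability of the limit distribution function in the variance *)

Section MixtureLimit.
Context (R : realType).

Lemma cvg_expect (d : measure_display) (T : measurableType d) (P : probability T R)
    (f : nat -> T -> R) (g : T -> R) (c : R) :
  (forall k, bounded_measurable (f k)) -> measurable_fun setT g ->
  (forall k x, `|f k x| <= c) -> (forall x, f k x @[k --> \oo] --> g x) ->
  \int[P]_x f k x @[k --> \oo] --> \int[P]_x g x.
Proof.
move=> bf mg fc fg.
have bg : bounded_measurable g.
  split => //; exists c => x.
  have h : `|f k x| @[k --> \oo] --> `|g x| by apply: cvg_norm; exact: fg.
  rewrite -(cvg_lim _ h)//; apply: limr_le; first by apply/cvg_ex; exists `|g x|.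
  exact: nearW.
have [| | | | |_ _ h] := (@dominated_convergence _ _ _ P setT measurableT
  (fun k x => (f k x)%:E) (fun x => (g x)%:E) (fun x => c%:E)).
- by move=> k; apply/measurable_EFinP; case: (bf k).
- exact/measurable_EFinP.
- by apply: aeW => x _; apply: cvg_EFin; [exact: nearW|exact: fg].
- exact: (bounded_measurable_integrable P (bounded_measurable_cst _ c)).
- by apply: aeW => x k _ /=; rewrite lee_fin.
by apply: fine_cvg; rewrite -/(\int[P]_x g x) EFin_expect.
Qed.

Lemma Phi01 (z v : R) : (0 <= Phi z v <= 1)%E.
Proof.
rewrite /Phi; case: ifP => _; last by rewrite measure_ge0 probability_le1.
by rewrite diracE; case: (_ \in _); rewrite /= !lee_fin ?lexx ?ler01.
Qed.

Lemma fin_num_Phi (z v : R) : Phi z v \is a fin_num.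
Proof.
by rewrite /Phi; case: ifP => _; [rewrite diracE|exact: fin_num_measure].
Qed.

Lemma Phi0_ge0 (z : R) : 0 <= z -> Phi z 0 = 1%E.
Proof. by move=> z0; rewrite /Phi eqxx diracE mem_set//= in_itv. Qed.

(** Confines the question to positive arguments: [h] is glued from its positive part, its value at
    [0] and a constant on the negative half-line. *)
Lemma measurable_fun_pos (h : R -> R) (c : R) :
  measurable_fun setT (fun v => \1_[set u : R | 0 < u] v * h v) ->
  (forall v, v < 0 -> h v = c) -> measurable_fun setT h.
Proof.
move=> mh hc.
have i1 (B : set R) v : B v -> \1_B v = 1 :> R by move=> ?; rewrite indicE mem_set.
have i0 (B : set R) v : ~ B v -> \1_B v = 0 :> R by move=> ?; rewrite indicE memNset.
rewrite (_ : h = fun v => \1_[set u : R | 0 < u] v * h v +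
    (\1_[set 0] v * h 0 + \1_[set u : R | u < 0] v * c)).
  have mneg : measurable [set u : R | u < 0].
    have -> : [set u : R | u < 0] = `]-oo, 0[%classic; last by [].
    by apply/seteqP; split => u /=; rewrite in_itv.
  apply: measurable_funD => //; apply: measurable_funD.
    by apply: measurable_funM => //; exact/measurable_indic/measurable_set1.
  by apply: measurable_funM => //; exact/measurable_indic.
apply/funext => v; have [v0|v0|vE] := ltgtP v 0.
- rewrite (i0 [set u | 0 < u]) ?(i0 [set 0]) ?(i1 [set u | u < 0])//=.
  + by rewrite !mul0r !add0r mul1r hc.
  + by move=> vE; rewrite vE ltxx in v0.
  + by apply/negP; rewrite -leNgt ltW.
- rewrite (i1 [set u | 0 < u]) ?(i0 [set 0]) ?(i0 [set u | u < 0])//=.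
  + by rewrite !mul0r !addr0 mul1r.
  + by apply/negP; rewrite -leNgt ltW.
  + by move=> vE; rewrite vE ltxx in v0.
- rewrite vE (i0 [set u | 0 < u]) ?(i1 [set 0]) ?(i0 [set u | u < 0])//= ?ltxx//.
  by rewrite !mul0r mul1r add0r addr0.
Qed.

Lemma Phi_lt0 (z v : R) : v < 0 -> Phi z v = normal_prob 0 0 `]-oo, z].
Proof. by move=> v0; rewrite /Phi lt_eqF// ler0_sqrtr// ltW. Qed.

(** For [v > 0] it is a pointwise limit of Gaussian smoothings of logistic steps. For [v < 0] the
    square root is [0] and the value does not depend on [v]. *)
Lemma bounded_measurable_Phi (z : R) :
  bounded_measurable (fun v : R => fine (Phi z v)).
Proof.
split; last first.
  exists 1 => v; have := Phi01 z v; rewrite -(fineK (fin_num_Phi z v)) !lee_fin.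
  by move=> /andP[h0 h1]; rewrite ger0_norm.
pose g v : R := \1_[set u : R | 0 < u] v * fine (Phi z v).
have mpos : measurable [set u : R | 0 < u].
  rewrite (_ : [set u | _] = `]0, +oo[%classic)//.
  by apply/seteqP; split => u /=; rewrite in_itv/= andbT.
have mg : measurable_fun setT g.
  apply: (@measurable_fun_cvg _ _ _ _ (fun k v => \1_[set u : R | 0 < u] v *
    gauss_smooth (logistic_step (k.+1%:R ^+ 2) (z + 1 * k.+1%:R^-1)) (Num.sqrt v) 0)).
    move=> k; apply: measurable_funM; first exact: measurable_indic.
    by case: (bounded_measurable_gauss_smooth_sqrt (z + 1 * k.+1%:R^-1) (sqr_ge0 k.+1%:R)).
  move=> v _; rewrite /g indicE; have [/set_mem /= v0|_] := boolP (v \in _).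
    apply: cvgMl_tmp.
    have vN0 : v != 0 \/ z != 0 by left; rewrite gt_eqF.
    have e1 : `|1 : R| <= 1 by rewrite normr1.
    have := cvg_gauss_smooth_logistic e1 (ltW v0) vN0.
    by rewrite -(fineK (fin_num_Phi z v)) => /fine_cvg.
  under eq_fun do rewrite mul0r; rewrite mul0r; exact: cvg_cst.
by apply: (measurable_fun_pos mg) => v v0; congr fine; exact: Phi_lt0.
Qed.

End MixtureLimit.

(** * Two-sided bounds on the distribution function of the error *)

Section ErrorSandwich.
Context (R : realType) (F : probability R R) (z : R).
Local Notation lv := (limit_variance F).

(** The positions treated by the squeeze. All [z >= 0] with zero variance go to the complement,
    including [z > 0], since a nonpositive error settles them together. *)
Definition smooth_part : set R := [set y | lv y != 0 \/ z < 0].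

Lemma measurable_limit_variance : measurable_fun setT lv.
Proof.
apply: continuous_measurable_fun => x; rewrite /limit_variance /sigma2.
apply: cvgMl_tmp; apply: cvgB; first by apply: cvgMr_tmp; exact: cvg_id.
by apply: cvgMr_tmp; exact: exprn_continuous.
Qed.

Lemma measurable_smooth_part : measurable smooth_part.
Proof.
have [z0|z0] := ltP z 0.
  rewrite (_ : smooth_part = setT)//.
  by apply/seteqP; split => // y _; right.
rewrite (_ : smooth_part = setT `&` lv @^-1` (~` [set 0])).
  exact: (measurable_limit_variance measurableT (measurableC (measurable_set1 0))).
rewrite setTI; apply/seteqP; split => y /=.
  by case=> [/eqP//|]; rewrite ltNge z0.
by move=> h; left; apply/eqP.
Qed.

Lemma smooth_partC y : ~ smooth_part y -> lv y = 0 /\ 0 <= z.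
Proof.
move=> Dy; split; last by rewrite leNgt; apply/negP => z0; apply: Dy; right.
by apply/eqP/negPn/negP => v0; apply: Dy; left.
Qed.

Hypotheses (F01 : F `[0, 1]%classic = 1%E) (delta_gt0 : 0 < moment F 2).
Local Notation D := smooth_part.

Let bC : bounded_measurable (fun x : R => \1_(~` D) (unit_clamp x) : R).
Proof. by apply: bounded_measurable_indic_clamp; exact: (measurableC measurable_smooth_part). Qed.

Section Finite.
Context (n : nat) (d : measure_display)
  (T : measurableType d) (P : probability T R) (X : 'I_n -> {RV P >-> R})
  (A : 'I_n -> 'I_n -> {RV P >-> bool}) (Xhat : 'I_n -> {RV P >-> R}) (i : 'I_n).
Hypotheses (XA : RDPG F X A)
  (est : forall w, is_estimate (\col_k X k w) (\matrix_(k, l) (A k l w)%:R)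
        (\col_k Xhat k w)).
Local Notation lat := (latent X).
Local Notation err := (scaled_error X Xhat i).
Local Notation q := (\int[F]_x (\1_(~` D) (unit_clamp x) : R)).

Lemma measurable_scaled_error : measurable_fun setT err.
Proof. by apply: measurable_funM => //; exact: measurable_funB. Qed.

Lemma measurable_error_le : measurable [set w | err w <= z].
Proof.
rewrite (_ : [set w | _] = setT `&` err @^-1` `]-oo, z]%classic).
  exact: measurable_scaled_error.
by rewrite setTI; apply/seteqP; split => w /=; rewrite in_itv.
Qed.

Let mZ := measurable_error_le.

Let indicZ w : \1_[set w | err w <= z] w = \1_(`]-oo, z]%classic : set R) (err w) :> R.
Proof. by rewrite !indicE; congr (_%:R); apply/idP/idP => /set_mem /= h; apply/mem_set; move: h; rewrite /= in_itv. Qed.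

Let bD M c : bounded_measurable (fun w => \1_D (lat w i) * logistic_step M c (err w)).
Proof. by apply: bounded_measurable_scaled_error; exact: measurable_smooth_part. Qed.

Let bCw : bounded_measurable (fun w => \1_(~` D) (lat w i) : R).
Proof. by apply: (bounded_measurable_comp _ bC). Qed.

Let qE : q = \int[P]_w \1_(~` D) (lat w i).
Proof. by rewrite -(expect_vertex (RDPG_law XA) i bC). Qed.

(** On [D] the indicator is below the shifted logistic step plus [exp (- K)]; outside [D] it is
    bounded by 1, and [q] is the mass of that part. *)
Lemma prob_error_le (K : R) : 0 < K -> fine (P [set w | err w <= z]) <=
  \int[P]_w (\1_D (lat w i) * logistic_step (K ^+ 2) (z + K^-1) (err w)) +
  (expR (- K) + q).
Proof.
move=> K0; rewrite qE -expect_indic// -[expR (- K)](expect_cst P).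
rewrite -expectD//; last exact: bounded_measurable_cst.
rewrite -expectD//; last by apply: bounded_measurableD => //; exact: bounded_measurable_cst.
apply: le_expect; first exact: bounded_measurable_indic.
  by do 2![apply: bounded_measurableD => //]; exact: bounded_measurable_cst.
move=> w; rewrite indicZ [\1_D _]indicE [\1_(~` D) _]indicE.
have [/set_mem Dw|/negP Dw] := boolP (lat w i \in D).
  by rewrite memNset// mul1r addr0; exact: logistic_step_upper.
rewrite mem_set; last by move=> h; apply/Dw/mem_set.
by rewrite mul0r add0r ler_wpDl ?expR_ge0// indicE; case: (_ \in _).
Qed.

(** Outside [D] the error is almost surely nonpositive and [z >= 0], so the event holds there: the
    trivial bound [q] of the upper estimate is attained. *)
Lemma prob_error_ge (K : R) : 0 < K ->
  \int[P]_w (\1_D (lat w i) * logistic_step (K ^+ 2) (z - K^-1) (err w)) +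
  (q - expR (- K)) <= fine (P [set w | err w <= z]).
Proof.
move=> K0; rewrite qE -expect_indic// -[expR (- K)](expect_cst P).
have bK : bounded_measurable (fun _ : T => expR (- K)) by exact: bounded_measurable_cst.
rewrite -expectB// -expectD//; last exact: bounded_measurableB.
have [ Om mO [PO OE]] := degenerate_error_le0 i F01 XA est delta_gt0.
have bZ : bounded_measurable (fun w => \1_[set w | err w <= z] w : R).
  exact: bounded_measurable_indic.
have bO : bounded_measurable (fun w => \1_(~` Om) w : R).
  by apply: bounded_measurable_indic; exact: measurableC.
rewrite [leRHS](@eq_expect_ae _ _ _ P _
  (fun w => \1_[set w | err w <= z] w + \1_(~` Om) w) Om)//.
- apply: le_expect; first by apply: bounded_measurableD => //; exact: bounded_measurableB.
    exact: bounded_measurableD.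
  move=> w; rewrite indicZ [\1_D _]indicE [\1_(~` D) _]indicE.
  have o0 : 0 <= \1_(~` Om) w :> R by rewrite indicE.
  have [/set_mem Dw|/negP Dw] := boolP (lat w i \in D).
    rewrite memNset// mul1r add0r ler_wpDr//; exact: logistic_step_lower.
  have nDw : ~ D (lat w i) by move=> h; apply/Dw/mem_set.
  have [v0 z0] := smooth_partC nDw.
  rewrite mem_set// mul0r add0r lerBlDr ler_wpDr ?expR_ge0//.
  have [/set_mem Ow|/negP Ow] := boolP (w \in Om).
    rewrite ler_wpDr// indicE mem_set//= in_itv/=.
    exact: le_trans (OE w Ow v0) z0.
  by rewrite ler_wpDl// ?indicE ?ler0n// mem_set// => h; apply/Ow/mem_set.
- exact: bounded_measurableD.
- by move=> w Ow; rewrite [\1_(~` Om) w]indicE memNset ?addr0.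
Qed.

End Finite.

End ErrorSandwich.

(** * The limit mixture *)

Section MixtureIntegral.
Context (R : realType) (F : probability R R) (z : R).
Hypotheses (F01 : F `[0, 1]%classic = 1%E) (delta_gt0 : 0 < moment F 2).
Local Notation lv := (limit_variance F).
Local Notation D := (smooth_part F z).

Definition mixture_mass (x : R) : R :=
  \1_D (unit_clamp x) * fine (Phi z (lv (unit_clamp x))).

Let bI (B : set R) : measurable B -> bounded_measurable (fun x : R => \1_B (unit_clamp x) : R).
Proof. exact: bounded_measurable_indic_clamp. Qed.

Let mlc : measurable_fun setT (fun x => lv (unit_clamp x)).
Proof. exact: (measurableT_comp (measurable_limit_variance F) (bounded_measurable_unit_clamp R).1). Qed.

Let bPhi : bounded_measurable (fun x => fine (Phi z (lv (unit_clamp x)))).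
Proof. exact: (bounded_measurable_comp mlc (bounded_measurable_Phi z)). Qed.

Let bmass : bounded_measurable mixture_mass.
Proof. by apply: bounded_measurableM => //; exact: bI (measurable_smooth_part F z). Qed.

Lemma cvg_mixture (s : R) : `|s| <= 1 ->
  \int[F]_x (\1_D (unit_clamp x) *
    gauss_smooth (logistic_step (k.+1%:R ^+ 2) (z + s * k.+1%:R^-1))
      (Num.sqrt (lv (unit_clamp x))) 0) @[k --> \oo] --> \int[F]_x mixture_mass x.
Proof.
move=> s1; have bg k := bounded_measurable_gauss_smooth_sqrt
  (z + s * k.+1%:R^-1) (sqr_ge0 (k.+1%:R : R)).
apply: (@cvg_expect _ _ _ _ _ _ 1).
- move=> k; apply: bounded_measurableM; first exact: bI (measurable_smooth_part F z).
  exact: (bounded_measurable_comp mlc (bg k)).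
- exact: bmass.1.
- move=> k x; rewrite normrM -[leRHS]mulr1 ler_pM//.
    by rewrite indicE; case: (_ \in _); rewrite /= ?normr1 ?normr0 ?ler01.
  apply: norm_expect_le.
    exact/bounded_measurable_affine/bounded_measurable_logistic_step.
  move=> y; rewrite gtr0_norm ?logistic_step_gt0//; exact/ltW/logistic_step_lt1.
- move=> x; rewrite /mixture_mass indicE.
  have [/set_mem /= Dx|_] := boolP (unit_clamp x \in _); last first.
    under eq_fun do rewrite mul0r; rewrite mul0r; exact: cvg_cst.
  apply: cvgMl_tmp; set v := lv _.
  have v0 : 0 <= v by apply: limit_variance_ge0 => //; exact: unit_clamp01.
  have vz : v != 0 \/ z != 0 by case: Dx => [|zlt]; [left|right; rewrite lt_eqF].
  have := cvg_gauss_smooth_logistic s1 v0 vz.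
  by rewrite -(fineK (fin_num_Phi z v)) => /fine_cvg.
Qed.

(** Outside [D] the integrand is [Phi z 0 = 1] because [z >= 0]; this part has the mass [q] that
    appears in both bounds on the probability. *)
Lemma integral_mixture : (\int[F]_x Phi z (lv x))%E =
  (\int[F]_x mixture_mass x + \int[F]_x (\1_(~` D) (unit_clamp x) : R))%:E.
Proof.
have bC := bI (measurableC (measurable_smooth_part F z)).
rewrite -expectD// EFin_expect; last exact: bounded_measurableD.
apply: ae_eq_integral => //.
- apply: (eq_measurable_fun (fun x => (fine (Phi z (lv x)))%:E)).
    by move=> x _; rewrite fineK ?fin_num_Phi.
  apply/measurable_EFinP.
  exact: (bounded_measurable_comp (measurable_limit_variance F) (bounded_measurable_Phi z)).1.
- by apply/measurable_EFinP; case: (bounded_measurableD bmass bC).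
have mI : measurable (`[0, 1]%classic : set R) by [].
exists (~` `[0, 1]%classic); split; first exact: measurableC.
  by rewrite /= probability_setC// F01 subee.
move=> x /= nE x01; apply: nE => _.
rewrite /mixture_mass unit_clamp_id; last by move: x01; rewrite in_itv.
rewrite !indicE; have [/set_mem Dx|/negP Dx] := boolP (x \in D).
  by rewrite memNset// mul1r addr0 fineK ?fin_num_Phi.
have nDx : ~ D x by move=> h; apply/Dx/mem_set.
have [v0 z0] := smooth_partC nDx.
by rewrite mem_set// mul0r add0r v0 Phi0_ge0.
Qed.

End MixtureIntegral.

(** An iterated limit: [k] is fixed first, so that [La k], [Lb k] and [eps k] are within [e / 3] of
    their limits, and [n] grows afterwards. *)
Lemma cvg_squeeze_family (R : realType) (p : nat -> R) (a b : nat -> nat -> R)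
    (La Lb eps : nat -> R) (G q : R) :
  (forall k, a k n @[n --> \oo] --> La k) ->
  (forall k, b k n @[n --> \oo] --> Lb k) ->
  La k @[k --> \oo] --> G -> Lb k @[k --> \oo] --> G ->
  eps k @[k --> \oo] --> (0 : R) ->
  (forall k n, a k n + (q - eps k) <= p n <= b k n + (eps k + q)) ->
  p n @[n --> \oo] --> G + q.
Proof.
move=> ca cb cLa cLb ceps ab; apply/cvgrPdist_le => e e0.
have e3 : 0 < e / 3 by rewrite divr_gt0.
have /cvgrPdist_le /(_ _ e3) c1 := ceps.
have /cvgrPdist_le /(_ _ e3) c2 := cLa.
have /cvgrPdist_le /(_ _ e3) c3 := cLb.
have [k _ /(_ k (leqnn k)) [[k1 k2] k3]] := filterI (filterI c1 c2) c3.
have /cvgrPdist_le /(_ _ e3) u1 := ca k.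
have /cvgrPdist_le /(_ _ e3) u2 := cb k.
near=> n.
have h1 : `|La k - a k n| <= e / 3 by near: n; exact: u1.
have h2 : `|Lb k - b k n| <= e / 3 by near: n; exact: u2.
move: (ab k n) k1 k2 k3 h1 h2; rewrite /= sub0r normrN !ler_norml.
move=> /andP[? ?] /andP[? ?] /andP[? ?] /andP[? ?] /andP[? ?] /andP[? ?].
by apply/andP; split; lra.
Unshelve. all: end_near. Qed.

(* The n-th graph has n.+1 vertices; [inord i] is the vertex [i] as soon as
   [i <= n]. *)
Theorem theorem3p3 (R : realType) (F : probability R R)
    (F01 : F `[0, 1]%classic = 1%E) (delta_gt0 : 0 < moment F 2)
    (d : nat -> measure_display) (T : forall n : nat, measurableType (d n))
    (P : forall n : nat, probability (T n) R)
    (X : forall n : nat, 'I_n.+1 -> {RV (P n) >-> R})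
    (A : forall n : nat, 'I_n.+1 -> 'I_n.+1 -> {RV (P n) >-> bool})
    (Xhat : forall n : nat, 'I_n.+1 -> {RV (P n) >-> R})
    (XA_RDPG : forall n : nat, RDPG F (X n) (A n))
    (Xhat_estimate : forall (n : nat) (w : T n),
      is_estimate (\col_k X n k w) (\matrix_(k, l) (A n k l w)%:R)
        (\col_k Xhat n k w))
    (i : nat) (z : R) :
  P n [set w | Num.sqrt n.+1%:R * (Xhat n (inord i) w - X n (inord i) w) <= z]
    @[n --> \oo]
  --> (\int[F]_x Phi z (moment F 2 ^- 2 * sigma2 F x))%E.
Proof.
rewrite (integral_mixture z F01).
(* [G] is the contribution of the positions in [smooth_part], and [q] the mass of the others. *)
set G := \int[F]_x _; set q := \int[F]_x _.
pose p n := fine (P n [set w | scaled_error (X n) (Xhat n) (inord i) w <= z]).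
suff h : p n @[n --> \oo] --> G + q.
  apply: cvg_EFin; last exact: h.
  apply: nearW => n; apply: fin_num_measure.
  exact: (measurable_error_le z (X n) (Xhat n) (inord i)).
(* One family for both bounds: [s = 1] shifts the step to the right for the upper bound, [s = -1] to
   the left for the lower one, with [K = k.+1]. *)
pose f s k := logistic_step (k.+1%:R ^+ 2 : R) (z + s * k.+1%:R^-1).
pose I s k n := \int[P n]_w (\1_(smooth_part F z) (latent (X n) w (inord i)) *
  f s k (scaled_error (X n) (Xhat n) (inord i) w)).
pose J s k := \int[F]_x (\1_(smooth_part F z) (unit_clamp x) *
  gauss_smooth (f s k) (Num.sqrt (limit_variance F (unit_clamp x))) 0).
have cI s k : I s k n @[n --> \oo] --> J s k.
  have M0 := sqr_ge0 (k.+1%:R : R).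
  exact: (@cvg_expect_logistic R F F01 delta_gt0 _ _ _ _ _ _ (fun n => inord i)
    XA_RDPG Xhat_estimate _ _ _ (measurable_smooth_part F z) M0).
have s1 : `|1 : R| <= 1 by rewrite normr1.
have s2 : `|-1 : R| <= 1 by rewrite normrN1.
apply: (@cvg_squeeze_family R p (I (-1)) (I 1) (J (-1)) (J 1)
  (fun k => expR (- k.+1%:R)) G q (cI (-1)) (cI 1)).
- exact: (@cvg_mixture R F z F01 delta_gt0 _ s2).
- exact: (@cvg_mixture R F z F01 delta_gt0 _ s1).
- exact: cvg_expRN_succ.
move=> k n; have K0 : 0 < k.+1%:R :> R by [].
apply/andP; split.
  have := prob_error_ge z F01 delta_gt0 (inord i) (XA_RDPG n) (@Xhat_estimate n) K0.
  by rewrite /I /f mulN1r.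
have := prob_error_le z (Xhat n) (inord i) (XA_RDPG n) K0.
by rewrite /I /f mul1r.
Qed.
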